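(* Suppose $d\ge1$ and $q\in\{2,3,\dots\}$. Then $$H_K(\beta_c(d))=0.$$ Moreover, there exists $\epsilon_d\in(0,\beta_c(d)-\beta_P(d))$ such that $$H_K(\beta_P(d)+\epsilon_d)\in(0,\infty).$$
   Context: Random cluster model with ghost vertex. Extend the nearest neighbor graph $(\mathbb{Z}^d,\mathbb{E}^d)$ by a ghost vertex $g$ and edges $\{z,g\}$, $z\in\mathbb{Z}^d$ (external edges; edges in $\mathbb{E}^d$ are internal). For finite $\Lambda\subseteq\mathbb{Z}^d$, let $\overline{\mathscr{B}}(\Lambda)$ be the set of internal edges with at least one endpoint in $\Lambda$, and $\mathscr{E}(\Lambda)=\{\{z,g\}:z\in\Lambda\}$. For $\beta,H\ge0$, the random cluster measure with wired boundary condition $\mathbb{P}_{\Lambda,w,\beta,H}$ on $\{0,1\}^{\overline{\mathscr{B}}(\Lambda)\cup\mathscr{E}(\Lambda)}$ is $$\mathbb{P}_{\Lambda,w,\beta,H}(\omega)\propto q^{\mathcal{K}(\omega)}\prod_{e\in\overline{\mathscr{B}}(\Lambda)}(1-e^{-2\beta})^{\omega_e}(e^{-2\beta})^{1-\omega_e}\prod_{e\in\mathscr{E}(\Lambda)}(1-e^{-2H})^{\omega_e}(e^{-2H})^{1-\omega_e},$$ where all edges (internal and external) outside $\overline{\mathscr{B}}(\Lambda)\cup\mathscr{E}(\Lambda)$ are declared open and $\mathcal{K}(\omega)$ is the number of open clusters of the resulting configuration that intersect $\Lambda$ and do not contain $g$. An edge $e$ is open if $\omega_e=1$ and closed otherwise.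 $\mathbb{P}_{\mathbb{Z}^d,w,\beta,H}$ is the infinite volume limit of $\mathbb{P}_{\Lambda,w,\beta,H}$ as $\Lambda\to\mathbb{Z}^d$. Set $\theta(\beta,H)=\mathbb{P}_{\mathbb{Z}^d,w,\beta,H}(0\overset{\mathbb{Z}^d}{\longleftrightarrow}\infty)$, the probability that the origin is in an infinite open cluster using only internal edges. The critical inverse temperature at zero field is $\beta_c(d)=\sup\{\beta\ge0:\theta(\beta,0)=0\}$ (it depends also on $q$), and the Kertész line is the function $H_K(\beta)=\sup\{H\ge0:\theta(\beta,H)=0\}$, with $\sup\emptyset=0$. The number $\beta_P(d)$ is defined by $1-e^{-2\beta_P(d)}=p_c^b(d)$, where $p_c^b(d)$ is the critical probability of independent Bernoulli bond percolation on $\mathbb{Z}^d$. This random cluster model corresponds to the $q$-state Potts model on $\{1,\dots,q\}^{\Lambda}$ with weights $\exp\big[2\beta\sum_{\{u,v\}}\delta_{\sigma_u,\sigma_v}+2H\sum_u\delta_{\sigma_u,1}\big]$ (plus the boundary interaction), which for $q=2$ is the Ising model with inverse temperature $\beta$ and constant external field $H$.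
   Formalization: The ''moreover'' claim is stated for d ≥ 2 only: for d = 1 both β_c(1) and β_P(1) are +∞, so the interval (0, β_c−β_P) is undefined and H_K(∞)=0. The first claim holds for all d ≥ 1, with β_c(1)=+∞ allowed and e^{-∞}=0. ε_d may depend on q. *)

(* Defs.v *)
From mathcomp Require Import all_boot all_order all_algebra finmap.
From mathcomp Require Import all_classical all_reals all_analysis.
From mathcomp.analysis.showcase Require Import summability.

Set Implicit Arguments.
Unset Strict Implicit.
Unset Printing Implicit Defensive.

Import Order.TTheory GRing.Theory Num.Theory.
Import numFieldNormedType.Exports.

Local Open Scope classical_set_scope.
Local Open Scope fset_scope.
Local Open Scope ring_scope.

(** Bond configurations: [true] is open, [false] is closed. *)

Definition cylinders (E : Type) : set (set (E -> bool)) :=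
  [set A | exists e b, A = [set w : E -> bool | w e = b]].

Definition config (E : Type) := g_sigma_algebraType (@cylinders E).

(** A multigraph is given by the endpoints of its edges, in arbitrary order. *)

Definition open_step (V E : Type) (ends : E -> V * V) (w : E -> bool) : rel V :=
  fun u v => `[< exists e, w e /\ (ends e = (u, v) \/ ends e = (v, u)) >].

Definition open_cluster (V E : Type) (ends : E -> V * V) (w : E -> bool) (u : V) :
    set V :=
  [set v | exists2 p : seq V, path (open_step ends w) u p & last u p = v].

(** Vertices are the [Some x] with [x] in Z^d, and the ghost [None].  The
    internal edge [(x, i)] is {x, x + e_i}, so that each unordered pair of
    nearest neighbours is encoded exactly once; [inl] marks internal edges,
    and [inr x] is the external edge {x, g}. *)

Definition zlattice (d : nat) := 'rV[int]_d.
Definition iedge (d : nat) := (zlattice d * 'I_d)%type.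
Definition edge (d : nat) := (iedge d + zlattice d)%type.

Definition unit_vec (d : nat) (i : 'I_d) : zlattice d := delta_mx 0 i.

Definition iends (d : nat) (e : iedge d) : zlattice d * zlattice d :=
  (e.1, e.1 + unit_vec e.2).

Definition ends (d : nat) (e : edge d) :
    option (zlattice d) * option (zlattice d) :=
  match e with
  | inl e' => (Some (iends e').1, Some (iends e').2)
  | inr x => (Some x, None)
  end.

(** The internal edges with at least one endpoint in [L], and the external
    edges of [L]. *)
Definition internal_edges (d : nat) (L : {fset zlattice d}) : {fset iedge d} :=
  [fset ((x, i) : iedge d) | x in L, i in 'I_d]
  `|` [fset ((x - unit_vec i, i) : iedge d) | x in L, i in 'I_d].

Definition box_edges (d : nat) (L : {fset zlattice d}) : {fset edge d} :=
  [fset (inl e : edge d) | e in internal_edges L]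
  `|` [fset (inr x : edge d) | x in L].

Definition wired_ext (d : nat) (L : {fset zlattice d})
    (w : {ffun box_edges L -> bool}) : edge d -> bool :=
  fun e => if insub e is Some e' then w e' else true.

Definition nclusters (d : nat) (L : {fset zlattice d}) (w : edge d -> bool) :
    nat :=
  #|` [fset open_cluster (@ends d) w (Some x) | x in L
        & `[< ~ open_cluster (@ends d) w (Some x) None >]] |.

(** [closed_prob b] is e^{-2b}, with e^{-oo} = 0: the inverse temperature is
    allowed to be +oo because the critical point of Z is infinite. *)
Definition closed_prob (R : realType) (b : \bar R) : R :=
  fine (expeR (- (2%:E * b))%E).

Definition rc_weight (R : realType) (d q : nat) (beta : \bar R) (H : R)
    (L : {fset zlattice d}) (w : edge d -> bool) : R :=
  q%:R ^+ nclusters L w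
  * (\prod_(e <- internal_edges L)
       ((1 - closed_prob beta) ^+ w (inl e)
        * closed_prob beta ^+ (1 - w (inl e))%N))
  * (\prod_(x <- L)
       ((1 - closed_prob H%:E) ^+ w (inr x)
        * closed_prob H%:E ^+ (1 - w (inr x))%N)).

(** The finite-volume wired measure, seen on configurations of all the edges
    (those outside [L] being open). *)
Definition rc_wired (R : realType) (d q : nat) (beta : \bar R) (H : R)
    (L : {fset zlattice d}) (A : set (edge d -> bool)) : R :=
  (\sum_(w : {ffun box_edges L -> bool} | `[< A (wired_ext w) >])
     rc_weight q beta H L (wired_ext w))
  / \sum_(w : {ffun box_edges L -> bool}) rc_weight q beta H L (wired_ext w).

(** Infinite-volume limit as L increases to Z^d along finite sets ordered by
    inclusion: convergence of the probabilities of all events that depend on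
    finitely many edges (these determine the limit measure). *)
Definition is_rc_limit (R : realType) (d q : nat) (beta : \bar R) (H : R)
    (P : probability (config (edge d)) R) : Prop :=
  forall (F : {fset edge d}) (eta : edge d -> bool),
    let A := [set w : edge d -> bool | forall e, e \in F -> w e = eta e] in
    (rc_wired q beta H L A)%:E @[L --> totally] --> P A.

(** The limit measure is unique when it exists; [get] selects it. *)
Definition rc_infinite (R : realType) (d q : nat) (beta : \bar R) (H : R) :
    probability (config (edge d)) R :=
  get [set P | is_rc_limit q beta H P].

Definition percolates (d : nat) (w : iedge d -> bool) : Prop :=
  infinite_set (open_cluster (@iends d) w 0).

Definition theta (R : realType) (d q : nat) (beta : \bar R) (H : R) : \bar R :=
  rc_infinite d q beta H [set w | percolates (fun e => w (inl e))].

(** Supremum of a set of nonnegative reals, with the convention sup set0 = 0. *)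
Definition sup_nneg (R : realType) (A : set R) : \bar R :=
  if A == set0 then 0%E else ereal_sup [set x%:E | x in A].

Definition beta_c (R : realType) (d q : nat) : \bar R :=
  sup_nneg [set b : R | 0 <= b /\ theta d q b%:E 0 = 0%E].

Definition kertesz (R : realType) (d q : nat) (beta : \bar R) : \bar R :=
  sup_nneg [set H : R | 0 <= H /\ theta d q beta H = 0%E].

Definition is_bernoulli (R : realType) (d : nat) (p : R)
    (P : probability (config (iedge d)) R) : Prop :=
  forall (F : {fset iedge d}) (eta : iedge d -> bool),
    P [set w : iedge d -> bool | forall e, e \in F -> w e = eta e]
    = (\prod_(e <- F) (if eta e then p else 1 - p))%:E.

Definition bernoulli_bond (R : realType) (d : nat) (p : R) :
    probability (config (iedge d)) R :=
  get [set P | is_bernoulli p P].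

Definition p_c (R : realType) (d : nat) : R :=
  sup [set p : R | 0 <= p <= 1 /\
         bernoulli_bond d p [set w | percolates w] = 0%E].

(** The unique solution in [0, +oo]; it is +oo when p_c = 1. *)
Definition beta_P (R : realType) (d : nat) : \bar R :=
  get [set b : \bar R | (0 <= b)%E /\ 1 - closed_prob b = p_c R d].

(* Main.v *)
(** All comparisons are made in finite volume, uniformly in the volume, for
    increasing functions of the internal edges.

    - Lowering the cluster weight from [s] to [s2 < s] compensates a small
      decrease of the edge density.  Along the path of measures with density
      [exp (t * G)], where [G] is minus a combination of the number of open
      internal edges and of the number [k] of clusters, the mean of an
      increasing [X] has derivative [cov (X, G)].  As [k - 1/2 #{isolated
      vertices}] is decreasing, and as a vertex can be isolated by closing the
      other edges at this vertex at a bounded cost, FKG bounds [- cov (X, k)]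
      from below by a multiple of the covariance of [X] with the number of open
      edges.
    - A positive field lowers the effective cluster weight strictly, since two
      vertices are connected through the ghost with positive probability.

    Together these give [theta (b, 0) <= theta (beta_c, H)] for [H > 0] and some
    [b > beta_c], hence the first claim.  Lowering the weight from [q] to [1] at
    [H = 1] gives a [b > beta_P] at which the model is dominated by a
    subcritical Bernoulli percolation, while for a strong field the effective
    weight is close to [1], and the model dominates a supercritical Bernoulli
    percolation.  That the critical probability lies strictly between [0] and
    [1] is shown by counting self-avoiding paths and dual contours.  The
    infinite-volume measures are images of Lebesgue measure under a quantile
    map. *)

From HB Require Import structures.
Require Import Defs.
From mathcomp Require Import all_boot all_order all_algebra finmap.
From mathcomp Require Import all_classical all_reals all_analysis.
From mathcomp.analysis.showcase Require Import summability.
From mathcomp Require Import ring lra zify.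

Set Implicit Arguments.
Unset Strict Implicit.
Unset Printing Implicit Defensive.

Import Order.TTheory GRing.Theory Num.Theory.
Import numFieldNormedType.Exports.

Local Open Scope classical_set_scope.
Local Open Scope ring_scope.

#[local] Existing Instance totally_filter.

(** * Correlation inequalities on finite sets of edges *)

(** The obstacle is strictness. An inequality that is strict in every box may become an equality in
    the limit, so each gain in density must be a constant depending only on [d], the densities and
    the cluster weights. This is why everything is reduced to local data: the star of a vertex, with
    at most [2 * d + 1] edges, and the two ghost edges at the ends of an internal edge. The factor
    1/2 in front of the isolated vertices comes from the two stars that an edge can belong to.
    Cluster weights are real numbers at least 1, so that they can be lowered continuously, and means
    are compared in cross-multiplied form. Tilting needs positive edge weights, whereas at zero
    field the open ghost edges have weight 0. The zero-field model is therefore rewritten on the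
    internal edges alone, and the model with a field is compared with it through its marginal on
    these edges. *)

Section Configurations.
Variables (E : eqType) (R : realFieldType).
Implicit Types (w : E -> bool) (l : seq E) (f g : (E -> bool) -> R).

(* [lec] is the pointwise order; [sumc l f w] sums [f] over the configurations
   that agree with [w] off [l]. *)
Definition upd w (e : E) (b : bool) : E -> bool := fun x => if x == e then b else w x.
Definition meetc w w' : E -> bool := fun x => w x && w' x.
Definition joinc w w' : E -> bool := fun x => w x || w' x.
Definition lec w w' := forall x, w x -> w' x.

Fixpoint sumc l f w : R :=
  if l is e :: l' then sumc l' f (upd w e false) + sumc l' f (upd w e true)
  else f w.

Definition incr f := forall w w', lec w w' -> f w <= f w'.

Lemma upd_same w e b : upd w e b e = b.
Proof. by rewrite /upd eqxx. Qed.

Lemma upd_id w e : upd w e (w e) = w.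
Proof. by apply/funext => x; rewrite /upd; case: eqP => // ->. Qed.

Lemma updC w e e' b b' : e != e' -> upd (upd w e b) e' b' = upd (upd w e' b') e b.
Proof.
move=> nee; apply/funext => x; rewrite /upd; case: eqP => // ->.
by rewrite eq_sym (negbTE nee).
Qed.

Lemma lec_upd w w' e b b' : lec w w' -> (b ==> b') -> lec (upd w e b) (upd w' e b').
Proof. by move=> h /implyP hb x; rewrite /upd; case: eqP => // _; exact: h. Qed.

Lemma meetc_upd w w' e b b' : meetc (upd w e b) (upd w' e b') = upd (meetc w w') e (b && b').
Proof. by apply/funext => x; rewrite /meetc /upd; case: eqP. Qed.

Lemma joinc_upd w w' e b b' : joinc (upd w e b) (upd w' e b') = upd (joinc w w') e (b || b').
Proof. by apply/funext => x; rewrite /joinc /upd; case: eqP. Qed.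

Lemma meetcc w : meetc w w = w.
Proof. by apply/funext => x; rewrite /meetc andbb. Qed.

Lemma joincc w : joinc w w = w.
Proof. by apply/funext => x; rewrite /joinc orbb. Qed.

Lemma eq_sumc l f g w : (forall w', {in predC (mem l), w' =1 w} -> f w' = g w') ->
  sumc l f w = sumc l g w.
Proof.
elim: l w => [|e l IH] w h /=; first by apply: h.
by congr (_ + _); apply: IH => w' hw'; apply: h => x /=;
  rewrite inE negb_or => /andP[xe xl]; rewrite hw' // /upd (negbTE xe).
Qed.

Lemma eq_sumcT l f g w : f =1 g -> sumc l f w = sumc l g w.
Proof. by move=> fg; congr (sumc _ _ _); apply/funext. Qed.

Lemma le_sumc l f g w : (forall w', {in predC (mem l), w' =1 w} -> f w' <= g w') ->
  sumc l f w <= sumc l g w.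
Proof.
elim: l w => [|e l IH] w h /=; first by apply: h.
by apply: lerD; apply: IH => w' hw'; apply: h => x /=;
  rewrite inE negb_or => /andP[xe xl]; rewrite hw' // /upd (negbTE xe).
Qed.

Lemma sumc_ge0 l f w : (forall w', 0 <= f w') -> 0 <= sumc l f w.
Proof. by move=> h; elim: l w => [|e l IH] w //=; rewrite addr_ge0. Qed.

Lemma sumc_gt0 l f w : (forall w', 0 < f w') -> 0 < sumc l f w.
Proof. by move=> h; elim: l w => [|e l IH] w //=; rewrite addr_gt0. Qed.

Lemma sumcD l f g w : sumc l (fun w => f w + g w) w = sumc l f w + sumc l g w.
Proof. by elim: l w => [|e l IH] w //=; rewrite !IH addrACA. Qed.

Lemma sumcZ l f (a : R) w : sumc l (fun w => a * f w) w = a * sumc l f w.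
Proof. by elim: l w => [|e l IH] w //=; rewrite !IH mulrDr. Qed.

Lemma sumcB l f g w : sumc l (fun w => f w - g w) w = sumc l f w - sumc l g w.
Proof.
rewrite -[- sumc l g w]mulN1r -sumcZ -sumcD.
by apply: eq_sumcT => w'; rewrite mulN1r.
Qed.

Lemma sumc_sum (I : Type) (r : seq I) (F : I -> (E -> bool) -> R) l w :
  sumc l (fun w => \sum_(i <- r) F i w) w = \sum_(i <- r) sumc l (F i) w.
Proof.
elim: r => [|i r IH].
  rewrite big_nil (@eq_sumcT _ _ (fun w => 0 * 0)); last first.
    by move=> w'; rewrite big_nil mulr0.
  by rewrite sumcZ mul0r.
rewrite big_cons -IH -sumcD; apply: eq_sumcT => w'; by rewrite big_cons.
Qed.

Lemma sumc_cat l1 l2 f w : sumc (l1 ++ l2) f w = sumc l1 (sumc l2 f) w.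
Proof. by elim: l1 w => [|e l IH] w //=; rewrite !IH. Qed.

Lemma sumc_upd l f w e b : e \notin l ->
  sumc l f (upd w e b) = sumc l (fun w => f (upd w e b)) w.
Proof.
elim: l w => [|e' l IH] w //=; rewrite inE negb_or => /andP[ee' el].
by rewrite ![upd (upd w e b) _ _]updC // !IH.
Qed.

(** A pointwise comparison is weakened to one made after summing over the state of a single edge.
    This is how the conditional law of an edge given the others enters. *)
Lemma le_sumc_resample l f g w e : uniq l -> e \in l ->
  (forall w', f (upd w' e false) + f (upd w' e true)
              <= g (upd w' e false) + g (upd w' e true)) ->
  sumc l f w <= sumc l g w.
Proof.
move=> ul el h; elim: l w ul el => [|e' l IH] w //= /andP[e'l ul].
rewrite inE => /orP[/eqP ee'|el]; last by apply: lerD; exact: IH.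
move: e'l; rewrite -ee' => e'l.
by rewrite !sumc_upd // -!sumcD; apply: le_sumc.
Qed.

End Configurations.

Section FourFunctions.
Variables (E : eqType) (R : realFieldType).
Implicit Types (w : E -> bool) (l : seq E) (f g : (E -> bool) -> R).

(** The one-edge case of the four functions theorem. Only the mixed terms matter: if [A] and [B] are
    at most [X] and [A * B <= X * C], expanding [(X - A) * (X - B) >= 0] gives
    [X * (A + B) <= X * (X + C)]. *)
Lemma four_numbers (a0 a1 b0 b1 c0 c1 d0 d1 : R) :
  0 <= a0 -> 0 <= a1 -> 0 <= b0 -> 0 <= b1 ->
  0 <= c0 -> 0 <= c1 -> 0 <= d0 -> 0 <= d1 ->
  a0 * b0 <= c0 * d0 -> a0 * b1 <= c0 * d1 -> a1 * b0 <= c0 * d1 -> a1 * b1 <= c1 * d1 ->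
  (a0 + a1) * (b0 + b1) <= (c0 + c1) * (d0 + d1).
Proof.
move=> a00 a10 b00 b10 c00 c10 d00 d10 h00 h01 h10 h11.
suff h : a0 * b1 + a1 * b0 <= c0 * d1 + c1 * d0 by rewrite !mulrDl !mulrDr; lra.
have A0 : 0 <= a0 * b1 by rewrite mulr_ge0.
have B0 : 0 <= a1 * b0 by rewrite mulr_ge0.
have C0 : 0 <= c1 * d0 by rewrite mulr_ge0.
have X0 : 0 <= c0 * d1 by rewrite mulr_ge0.
have AB : (a0 * b1) * (a1 * b0) <= (c0 * d1) * (c1 * d0).
  rewrite mulrACA [b1 * b0]mulrC mulrACA.
  by rewrite (_ : c0 * d1 * (c1 * d0) = (c0 * d0) * (c1 * d1)); [apply: ler_pM; rewrite ?mulr_ge0|ring].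
move: A0 B0 C0 X0 AB h01 h10.
set A := a0 * b1; set B := a1 * b0; set C := c1 * d0; set X := c0 * d1 => A0 B0 C0 X0 AB AX BX.
have [X00|Xpos] := eqVneq X 0; first by lra.
have {}Xpos : 0 < X by rewrite lt_def Xpos.
rewrite -(ler_pM2l Xpos).
have P0 : 0 <= (X - A) * (X - B) by rewrite mulr_ge0 // subr_ge0.
rewrite -subr_ge0; move: AB; rewrite -subr_ge0 => AB.
have -> : X * (X + C) - X * (A + B) = (X - A) * (X - B) + (X * C - A * B) by ring.
exact: addr_ge0.
Qed.

(** The Ahlswede-Daykin theorem. Meets and joins commute with setting one edge, so the induction
    hypothesis for the four choices of states of [e] gives exactly the hypotheses of
    [four_numbers]. *)
Lemma four_functions l (al be ga de : (E -> bool) -> R) :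
  (forall w, 0 <= al w) -> (forall w, 0 <= be w) ->
  (forall w, 0 <= ga w) -> (forall w, 0 <= de w) ->
  (forall w w', al w * be w' <= ga (meetc w w') * de (joinc w w')) ->
  forall w w', sumc l al w * sumc l be w' <= sumc l ga (meetc w w') * sumc l de (joinc w w').
Proof.
move=> al0 be0 ga0 de0 h; elim: l => [|e l IH] w w' //=.
have H b b' := IH (upd w e b) (upd w' e b').
have := H false false; have := H false true; have := H true false; have := H true true.
rewrite !meetc_upd !joinc_upd /= => h11 h10 h01 h00.
by apply: four_numbers => //; apply: sumc_ge0.
Qed.

(** Four functions with [X] attached to [m1] on the left and to [m2] on the right: as [X] is
    increasing, its value at [w] is at most its value at the join. The conclusion is the stochastic
    domination of [m1] by [m2], free of normalising constants. *)
Lemma holley l (m1 m2 X : (E -> bool) -> R) w :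
  (forall w, 0 <= m1 w) -> (forall w, 0 <= m2 w) -> (forall w, 0 <= X w) -> incr X ->
  (forall w w', m1 w * m2 w' <= m1 (meetc w w') * m2 (joinc w w')) ->
  sumc l (fun w => X w * m1 w) w * sumc l m2 w <=
  sumc l m1 w * sumc l (fun w => X w * m2 w) w.
Proof.
move=> m10 m20 X0 Xi h.
have := @four_functions l (fun w => X w * m1 w) m2 m1 (fun w => X w * m2 w).
move=> /(_ _ _ _ _ _ w w); rewrite meetcc joincc; apply => //.
- by move=> ?; rewrite mulr_ge0.
- by move=> ?; rewrite mulr_ge0.
move=> w1 w2; rewrite -mulrA [leRHS]mulrCA; apply: ler_pM => //.
  by rewrite mulr_ge0.
by apply: Xi => x; rewrite /joinc => ->.
Qed.

(* The edges of [w] are added one after the other to the smaller configuration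
   [meetc w w'] and to the larger one [w']. *)
Lemma local_to_global l (F G : (E -> bool) -> R) :
  (forall w, 0 < G w) ->
  (forall w w', {in l, w =1 w'} -> F w = F w') ->
  (forall w w', {in l, w =1 w'} -> G w = G w') ->
  (forall e A B, e \in l -> lec A B -> A e = false -> B e = false ->
     F (upd A e true) * G B <= F A * G (upd B e true)) ->
  forall w w', F w * G w' <= F (meetc w w') * G (joinc w w').
Proof.
move=> G0 Fl Gl h w w'.
pose A (m : seq E) x := meetc w w' x || ((x \in m) && w x).
pose B (m : seq E) x := w' x || ((x \in m) && w x).
suff H m : {subset m <= l} -> F (A m) * G w' <= F (meetc w w') * G (B m).
  have -> : F w = F (A l).
    by apply: Fl => x xl; rewrite /A /meetc xl; case: (w x) => //; rewrite orbT.
  have -> : G (joinc w w') = G (B l).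
    by apply: Gl => x xl; rewrite /B /joinc xl orbC.
  by apply: H.
elim: m => [|e m IH] ml.
  have -> : A [::] = meetc w w' by apply/funext => x; rewrite /A in_nil orbF.
  suff -> : B [::] = w' by [].
  by apply/funext => x; rewrite /B in_nil orbF.
have {}IH : F (A m) * G w' <= F (meetc w w') * G (B m).
  by apply: IH => x xm; apply: ml; rewrite inE xm orbT.
have [we|we] := boolP [&& w e, ~~ w' e & e \notin m]; last first.
  have -> : A (e :: m) = A m.
    apply/funext => x; rewrite /A inE; case: eqP => // -> /=; move: we.
    by rewrite /meetc; case: (w e); case: (w' e); case: (e \in m).
  suff -> : B (e :: m) = B m by [].
  apply/funext => x; rewrite /B inE; case: eqP => // -> /=; move: we.
  by case: (w e); case: (w' e); case: (e \in m).
case/and3P: we => we w'e em.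
have -> : A (e :: m) = upd (A m) e true.
  apply/funext => x; rewrite /A /upd inE; case: eqP => // -> /=.
  by rewrite we orbT.
have -> : B (e :: m) = upd (B m) e true.
  apply/funext => x; rewrite /B /upd inE; case: eqP => // -> /=.
  by rewrite we orbT.
have hl : F (upd (A m) e true) * G (B m) <= F (A m) * G (upd (B m) e true).
  apply: h.
  - by apply: ml; rewrite inE eqxx.
  - by move=> x; rewrite /A /B /meetc => /orP[/andP[_ ->//]|->]; rewrite orbT.
  - by rewrite /A /meetc (negbTE w'e) (negbTE em) andbF.
  - by rewrite /B (negbTE w'e) (negbTE em).
rewrite -(ler_pM2r (G0 (B m))).
apply: (@le_trans _ _ (F (A m) * G (upd (B m) e true) * G w')).
  by rewrite [leLHS]mulrAC ler_wpM2r // ltW.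
by rewrite [leLHS]mulrAC [leRHS]mulrAC ler_wpM2r // ltW.
Qed.

End FourFunctions.

(** * Covariances under a weight satisfying the lattice condition *)

Section Covariance.
Variables (E : eqType) (R : realType) (l : seq E) (mu : (E -> bool) -> R) (w0 : E -> bool).
Implicit Types (w : E -> bool) (X Y g : (E -> bool) -> R).

Definition mass f : R := sumc l (fun w => f w * mu w) w0.
(** The covariance under the normalised measure times the square of the total mass, which avoids
    divisions. *)
Definition cov f g : R := mass (fun w => f w * g w) * mass (fun=> 1) - mass f * mass g.

Lemma massD f g : mass (fun w => f w + g w) = mass f + mass g.
Proof. by rewrite /mass -sumcD; apply: eq_sumcT => w; rewrite mulrDl. Qed.

Lemma massZ a f : mass (fun w => a * f w) = a * mass f.
Proof. by rewrite /mass -sumcZ; apply: eq_sumcT => w; rewrite mulrA. Qed.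

Lemma eq_mass f g : f =1 g -> mass f = mass g.
Proof. by move=> fg; apply: eq_sumcT => w; rewrite fg. Qed.

Lemma mass_sum (I : Type) (r : seq I) (F : I -> (E -> bool) -> R) :
  mass (fun w => \sum_(i <- r) F i w) = \sum_(i <- r) mass (F i).
Proof. by rewrite /mass -sumc_sum; apply: eq_sumcT => w; rewrite mulr_suml. Qed.

Lemma covD X f g : cov X (fun w => f w + g w) = cov X f + cov X g.
Proof.
rewrite /cov massD (@eq_mass _ (fun w => X w * f w + X w * g w)).
  by rewrite massD; ring.
by move=> w; rewrite mulrDr.
Qed.

Lemma covZ X a f : cov X (fun w => a * f w) = a * cov X f.
Proof.
rewrite /cov massZ (@eq_mass _ (fun w => a * (X w * f w))).
  by rewrite massZ; ring.
by move=> w; rewrite mulrCA.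
Qed.

Lemma eq_cov X f g : f =1 g -> cov X f = cov X g.
Proof. by move=> /funext ->. Qed.

Lemma cov_sum X (I : Type) (r : seq I) (F : I -> (E -> bool) -> R) :
  cov X (fun w => \sum_(i <- r) F i w) = \sum_(i <- r) cov X (F i).
Proof.
rewrite /cov mass_sum (@eq_mass _ (fun w => \sum_(i <- r) X w * F i w)).
  by rewrite mass_sum sumrB mulr_suml mulr_sumr.
by move=> w; rewrite mulr_sumr.
Qed.

Lemma cov_cst X a : cov X (fun=> a) = 0.
Proof.
rewrite /cov (@eq_mass (fun=> a) (fun=> a * 1)); last by move=> w; rewrite mulr1.
rewrite massZ (@eq_mass _ (fun w => a * X w)); last by move=> w; rewrite mulrC.
by rewrite massZ; ring.
Qed.

Hypothesis mu_ge0 : forall w, 0 <= mu w.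
Hypothesis mu_lattice : forall w w', mu w * mu w' <= mu (meetc w w') * mu (joinc w w').

Lemma fkg X Y : (forall w, 0 <= X w) -> incr X -> incr Y -> 0 <= cov X Y.
Proof.
(* The covariance ignores constants, and [Y] is least at the all-closed configuration: this shift
   makes it nonnegative. *)
move=> X0 Xi Yi; pose m := - Y (fun=> false).
suff : 0 <= cov X (fun w => Y w + m) by rewrite covD cov_cst addr0.
have Y0 w : 0 <= Y w + m by rewrite subr_ge0; apply: Yi.
rewrite /cov subr_ge0.
have := @four_functions _ _ l (fun w => X w * mu w) (fun w => (Y w + m) * mu w) mu
  (fun w => X w * (Y w + m) * mu w).
move=> /(_ _ _ _ _ _ w0 w0); rewrite meetcc joincc [mass _ * mass (fun=> 1)]mulrC.
have -> : mass (fun=> 1) = sumc l mu w0 by apply: eq_sumcT => w; rewrite mul1r.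
apply => //; try by move=> w; rewrite !mulr_ge0.
move=> w w'; have -> : X w * mu w * ((Y w' + m) * mu w') = X w * (Y w' + m) * (mu w * mu w').
  by rewrite mulrACA.
rewrite [leRHS]mulrCA; apply: ler_pM => //; rewrite ?mulr_ge0 //.
apply: ler_pM => //; first by apply: Xi => x; rewrite /joinc => ->.
by rewrite lerD2r; apply: Yi => x; rewrite /joinc => ->; rewrite orbT.
Qed.

(* Replacing the indicator that [f] is closed by its conditional probability
   [r] does not decrease the covariance with [X], and turns [I * (r - c)] into
   a nonnegative decreasing function, to which [fkg] applies. *)
Lemma cov_closed (f : E) (I r : (E -> bool) -> R) (c : R) X :
  uniq l -> f \in l -> 0 <= c ->
  (forall w, 0 <= I w <= 1) -> incr (fun w => - I w) ->
  (forall w b, I (upd w f b) = I w) ->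
  (forall w, c <= r w <= 1) -> incr (fun w => - r w) ->
  (forall w b, r (upd w f b) = r w) ->
  (forall w, mu (upd w f false) = r w * (mu (upd w f false) + mu (upd w f true))) ->
  (forall w, 0 <= X w) -> incr X ->
  cov X (fun w => I w * (~~ w f)%:R) <= c * cov X I.
Proof.
move=> ul fl c0 I01 Idec If rc rdec rf mur X0 Xi.
pose Y w : R := I w * ((~~ w f)%:R - c).
pose Z w := I w * (r w - c).
have -> : cov X (fun w => I w * (~~ w f)%:R) = cov X Y + c * cov X I.
  rewrite -covZ -covD; apply: eq_cov => w; rewrite /Y; ring.
rewrite gerDr.
have Zdec : incr (fun w => - Z w).
  move=> w w' ww'; rewrite /Z lerN2; have /andP[a0 a1] := I01 w'.
  have := Idec _ _ ww'; have := rdec _ _ ww'; rewrite !lerN2 => rr II.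
  have /andP[rw' _] := rc w'.
  by apply: ler_pM => //; rewrite ?subr_ge0 ?lerD2r.
have : 0 <= cov X (fun w => -1 * Z w).
  by apply: fkg => //; move=> w w' /Zdec; rewrite !mulN1r.
rewrite covZ mulN1r oppr_ge0; apply: le_trans.
(* [Z] and [Y] have the same mass over the two states of [f], because [r] is the conditional
   probability that [f] is closed. *)
have ZY w : Z w * mu (upd w f false) + Z w * mu (upd w f true)
     = I w * (1 - c) * mu (upd w f false) + I w * (- c) * mu (upd w f true).
  move: (mur w); rewrite /Z; set m0 := mu (upd w f false); set m1 := mu (upd w f true) => h.
  have -> : I w * (r w - c) * m0 + I w * (r w - c) * m1 =
     I w * (1 - c) * m0 + I w * (- c) * m1 + I w * (r w * (m0 + m1) - m0) by ring.
  by rewrite -h subrr mulr0 addr0.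
have Zu w b : Z (upd w f b) = Z w by rewrite /Z If rf.
have Yu w b : Y (upd w f b) = I w * ((~~ b)%:R - c) by rewrite /Y If upd_same.
have e2 : mass Z = mass Y.
  apply/eqP; rewrite eq_le; apply/andP; split; apply: (le_sumc_resample _ ul fl) => w;
    by rewrite !Zu !Yu ZY /= sub0r.
(* The closed state of [f] goes with the smaller value of [X], so averaging the closed indicator
   over [f] can only raise the mean of the product. *)
have e1 : mass (fun w => X w * Y w) <= mass (fun w => X w * Z w).
  apply: (le_sumc_resample _ ul fl) => w; rewrite !Yu !Zu /= sub0r.
  have XX : X (upd w f false) <= X (upd w f true) by apply: Xi; exact: lec_upd.
  have /andP[Iw _] := I01 w.
  set x0 := X _; set x1 := X _.
  have -> : x0 * Z w * mu (upd w f false) + x1 * Z w * mu (upd w f true) =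
     x0 * (Z w * mu (upd w f false) + Z w * mu (upd w f true)) +
     (x1 - x0) * (Z w * mu (upd w f true)) by ring.
  rewrite ZY -subr_ge0.
  have -> : x0 * (I w * (1 - c) * mu (upd w f false) + I w * - c * mu (upd w f true)) +
     (x1 - x0) * (Z w * mu (upd w f true)) -
     (x0 * (I w * (1 - c)) * mu (upd w f false) + x1 * (I w * - c) * mu (upd w f true))
    = (x1 - x0) * (mu (upd w f true) * (Z w + I w * c)) by ring.
  have /andP[rw _] := rc w.
  have -> : Z w + I w * c = I w * r w by rewrite /Z; ring.
  by rewrite mulr_ge0 ?subr_ge0 // mulr_ge0 // mulr_ge0 // (le_trans c0).
rewrite /cov e2; apply: lerB => //.
apply: ler_wpM2r => //.
by apply: sumc_ge0 => w; rewrite mul1r.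
Qed.

Definition closed_all (T : seq E) w : R := \prod_(f <- T) (~~ w f)%:R.

Lemma closed_all01 T w : 0 <= closed_all T w <= 1.
Proof.
rewrite /closed_all; elim: T => [|f T IH]; first by rewrite big_nil lexx ler01.
rewrite big_cons; case: (w f) => /=; first by rewrite mul0r lexx ler01.
by rewrite mul1r.
Qed.

Lemma closed_all_dec T : incr (fun w => - closed_all T w).
Proof.
move=> w w' ww'; rewrite lerN2 /closed_all; elim: T => [|f T IH]; first by rewrite !big_nil.
rewrite !big_cons; apply: ler_pM => //; first by case/andP: (closed_all01 T w').
by rewrite ler_nat; case: (w f) (ww' f) => [/(_ isT) ->//|_]; case: (w' f).
Qed.

Lemma closed_all_upd T w f b : f \notin T -> closed_all T (upd w f b) = closed_all T w.
Proof.
move=> fT; apply: eq_big_seq => x xT; rewrite /upd; case: eqP => // xf.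
by rewrite xf (negbTE fT) in xT.
Qed.

(** The edges of [T] are closed one at a time, each costing a factor [c] by [cov_closed]. The edge
    [e] stays last, so that the induction ends at [1 - w e], whose covariance with [X] is minus that
    of [w e]. *)
Lemma cov_closed_all (r : E -> (E -> bool) -> R) (c : R) X (T : seq E) e :
  uniq l -> 0 <= c -> 
  (forall f w, f \in l -> c <= r f w <= 1) -> (forall f, f \in l -> incr (fun w => - r f w)) ->
  (forall f w b, r f (upd w f b) = r f w) ->
  (forall f w, f \in l ->
     mu (upd w f false) = r f w * (mu (upd w f false) + mu (upd w f true))) ->
  (forall w, 0 <= X w) -> incr X ->
  {subset T <= l} -> uniq (rcons T e) ->
  c ^+ size T * cov X (fun w => (w e)%:R) <= - cov X (closed_all (rcons T e)).
Proof.
move=> ul c0 rc rdec rf mur X0 Xi; elim: T => [_ _|f T IH Tl] /=.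
  rewrite expr0 mul1r (@eq_cov X (closed_all [:: e]) (fun w => 1 + -1 * (w e)%:R)).
    by rewrite covD cov_cst add0r covZ mulN1r opprK.
  by move=> w; rewrite /closed_all big_seq1; case: (w e) => /=; rewrite ?mulr0 ?mulr1 ?addr0 ?subrr.
case/andP => fT uT.
have fl : f \in l by apply: Tl; rewrite inE eqxx.
have {}IH : c ^+ size T * cov X (fun w => (w e)%:R) <= - cov X (closed_all (rcons T e)).
  by apply: IH => // x xT; apply: Tl; rewrite inE xT orbT.
have H : cov X (fun w => closed_all (rcons T e) w * (~~ w f)%:R)
     <= c * cov X (closed_all (rcons T e)).
  apply: (@cov_closed f _ (r f)) => //.
  - exact: closed_all01.
  - exact: closed_all_dec.
  - by move=> w b; apply: closed_all_upd.
  - by move=> w; apply: rc.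
  - exact: rdec.
  - by move=> w; apply: mur.
rewrite (@eq_cov X (closed_all (f :: rcons T e)) (fun w => closed_all (rcons T e) w * (~~ w f)%:R)).
  rewrite exprS -mulrA; apply: (le_trans (ler_wpM2l c0 IH)).
  by rewrite mulrN lerN2.
by move=> w; rewrite /closed_all big_cons mulrC.
Qed.

End Covariance.

(** * Monotonicity along exponential tilts *)

Section Path.
Variables (E : eqType) (R : realType) (l : seq E).
Implicit Types (w : E -> bool).

Lemma is_derive_sumc (h G : (E -> bool) -> R) w0 (t : R) :
  is_derive t 1 (fun t : R => sumc l (fun w => h w * expR (t * G w)) w0)
    (sumc l (fun w => h w * G w * expR (t * G w)) w0).
Proof.
elim: l w0 => [|e l' IH] w0 /=.
  have H : is_derive t 1 (fun t : R => expR (t * G w0)) (G w0 * expR (t * G w0)).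
    by apply: is_derive_eq; rewrite ?scaler0 ?addr0 ?add0r /GRing.scale /=; ring.
  have := @is_deriveZ _ _ _ _ (h w0) _ _ _ H.
  by rewrite /GRing.scale /= mulrA.
exact: is_deriveD.
Qed.

(** The tilted mean [N t / Z t] has derivative [cov / Z ^ 2], so the mean value theorem compares
    [t = 0] with [t = 1]. *)
Lemma tilt_mono (h X G : (E -> bool) -> R) w0 :
  (forall w, 0 < h w) ->
  (forall t : R, 0 <= t <= 1 -> 0 <= cov l (fun w => h w * expR (t * G w)) w0 X G) ->
  sumc l (fun w => X w * h w) w0 * sumc l (fun w => h w * expR (G w)) w0 <=
  sumc l h w0 * sumc l (fun w => X w * (h w * expR (G w))) w0.
Proof.
move=> h0 hcov.
pose N (t : R) : R := sumc l (fun w => X w * h w * expR (t * G w)) w0.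
pose Z (t : R) : R := sumc l (fun w => h w * expR (t * G w)) w0.
have Zp t : 0 < Z t by apply: sumc_gt0 => w; rewrite mulr_gt0 ?expR_gt0.
pose N' (t : R) : R := sumc l (fun w => X w * h w * G w * expR (t * G w)) w0.
pose Z' (t : R) : R := sumc l (fun w => h w * G w * expR (t * G w)) w0.
have dN (t : R) : is_derive t 1 N (N' t) by apply: is_derive_sumc.
have dZ (t : R) : is_derive t 1 Z (Z' t) by apply: is_derive_sumc.
pose f : R -> R := N * (fun t : R => (Z t)^-1).
pose f' (t : R) : R := N t * (- (Z t) ^- 2 * Z' t) + (Z t)^-1 * N' t.
have df (t : R) : is_derive t 1 f (f' t).
  have := is_deriveV (lt0r_neq0 (Zp t)) (dZ t) => dV.
  by have := is_deriveM (dN t) dV.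
have cf : {within `[0, 1], continuous f}%classic.
  by apply: derivable_within_continuous => x _; apply: ex_derive.
have [c] := @MVT_segment R f f' 0 1 ler01 (fun x _ => df x) cf.
rewrite in_itv /= => c01; rewrite subr0 mulr1 => fc.
have f'0 : 0 <= f' c.
  rewrite (_ : f' c = (Z c) ^- 2 * (N' c * Z c - N c * Z' c)).
    rewrite mulr_ge0 ?invr_ge0 ?exprn_ge0 ?(ltW (Zp c)) //.
    have := hcov c c01; rewrite /cov /mass.
    congr (0 <= _ * _ - _ * _); apply: eq_sumcT => w; rewrite ?mul1r //; ring.
  by rewrite /f'; field; apply: lt0r_neq0.
have : f 0 <= f 1 by rewrite -subr_ge0 fc.
rewrite /f /= -[(N * _) 0]/(N 0 * (Z 0)^-1) -[(N * _) 1]/(N 1 * (Z 1)^-1).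
rewrite ler_pdivrMr ?Zp // mulrAC ler_pdivlMr ?Zp // [leRHS]mulrC.
congr (_ * _ <= _ * _); apply: eq_sumcT => w; rewrite ?mul0r ?expR0 ?mul1r ?mulr1 //.
by rewrite mulrA.
Qed.

End Path.

(* [k w] stands for the number of clusters, and [cn e w] says that the two
   endpoints of [e] are connected without using [e]. *)
Record rc_system (E : eqType) (l : seq E) (k : (E -> bool) -> nat)
    (cn : E -> (E -> bool) -> bool) : Prop := RCSystem {
  rc_uniq : uniq l;
  rc_local : forall w w', {in l, w =1 w'} -> k w = k w';
  rc_step : forall e w, e \in l -> k (upd w e false) = (k (upd w e true) + ~~ cn e w)%N;
  rc_mono : forall e w w', lec w w' -> cn e w -> cn e w';
  rc_upd : forall e w b, cn e (upd w e b) = cn e w }.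

(** * Random-cluster weights *)

Section Weights.
Variables (E : eqType) (R : realType).
Implicit Types (w : E -> bool) (c : E -> bool -> R).

Definition cprod (l : seq E) c w : R := \prod_(e <- l) c e (w e).
Definition wgt (l : seq E) (k : (E -> bool) -> nat) c (s : R) w : R :=
  s ^+ k w * cprod l c w.

Lemma cprod_meet_join l c1 c2 w w' :
  (forall e b, 0 <= c1 e b) -> (forall e b, 0 <= c2 e b) ->
  (forall e, e \in l -> c1 e true * c2 e false <= c1 e false * c2 e true) ->
  cprod l c1 w * cprod l c2 w' <= cprod l c1 (meetc w w') * cprod l c2 (joinc w w').
Proof.
move=> c10 c20; rewrite /cprod; elim: l => [|e l IH] h; first by rewrite !big_nil.
rewrite !big_cons mulrACA [leRHS]mulrACA; apply: ler_pM.
- by rewrite mulr_ge0.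
- by rewrite mulr_ge0 // prodr_ge0.
- rewrite /meetc /joinc; case: (w e); case: (w' e) => //=.
  by apply: h; rewrite inE eqxx.
- by apply: IH => x xl; apply: h; rewrite inE xl orbT.
Qed.

Lemma cprod_upd l c w e b : uniq l -> e \in l ->
  cprod l c (upd w e b) = c e b * \prod_(f <- rem e l) c f (w f).
Proof.
move=> ul el; rewrite /cprod (big_rem e el) /= upd_same; congr (_ * _).
apply: eq_big_seq => x; rewrite mem_rem_uniq // inE => /andP[xe _].
by rewrite /upd (negbTE xe).
Qed.

Lemma ler_sum_subset (a : E -> R) (s1 s2 : seq E) : uniq s1 -> {subset s1 <= s2} ->
  (forall e, 0 <= a e) -> \sum_(e <- s1) a e <= \sum_(e <- s2) a e.
Proof.
move=> + + a0; elim: s1 s2 => [|e s1' IH] s2 /=.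
  by move=> _ _; rewrite big_nil sumr_ge0.
move=> /andP[es us] sub; have e2 : e \in s2 by apply: sub; rewrite inE eqxx.
rewrite big_cons (big_rem e e2) /= lerD2l; apply: IH => // x xs1.
have : x \in s2 by apply: sub; rewrite inE xs1 orbT.
rewrite (perm_mem (perm_to_rem e2)) inE => /orP[/eqP xe|//].
by rewrite -xe xs1 in es.
Qed.

Section System.
Variables (l : seq E) (k : (E -> bool) -> nat) (cn : E -> (E -> bool) -> bool).
Hypothesis sys : rc_system l k cn.

Let ul : uniq l := rc_uniq sys.

(** The number of clusters is supermodular: by [rc_mono], endpoints connected in the smaller
    configuration are connected in the larger one, where adding the edge thus destroys no more
    clusters. The bound [1 <= s2] turns this into an inequality between powers. *)
Lemma pow_meet_join (s1 s2 : R) w w' : 1 <= s2 -> s2 <= s1 ->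
  s1 ^+ k w * s2 ^+ k w' <= s1 ^+ k (meetc w w') * s2 ^+ k (joinc w w').
Proof.
move=> s21 s12; have s2p : 0 < s2 by rewrite (lt_le_trans ltr01).
have s11 : 1 <= s1 by rewrite (le_trans s21).
have s1p : 0 < s1 by rewrite (lt_le_trans ltr01).
apply: (@local_to_global _ _ l (fun w => s1 ^+ k w) (fun w => s2 ^+ k w)).
- by move=> ?; rewrite exprn_gt0.
- by move=> v v' /(rc_local sys) ->.
- by move=> v v' /(rc_local sys) ->.
move=> e A B el AB Ae Be.
have -> : k A = (k (upd A e true) + ~~ cn e A)%N by rewrite -(rc_step sys) // -Ae upd_id.
have -> : k B = (k (upd B e true) + ~~ cn e B)%N by rewrite -(rc_step sys) // -Be upd_id.
rewrite !exprD mulrA [leRHS]mulrAC; apply: ler_wpM2l.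
  by rewrite mulr_ge0 // exprn_ge0 // ltW.
have := rc_mono sys (e := e) AB.
by case: (cn e A) => [/(_ isT) ->//|_]; case: (cn e B).
Qed.

Lemma wgt_ge0 c s w : (forall e b, 0 <= c e b) -> 0 <= s -> 0 <= wgt l k c s w.
Proof. by move=> c0 s0; rewrite mulr_ge0 ?exprn_ge0 // prodr_ge0. Qed.

Lemma wgt_gt0 c s w : (forall e b, 0 < c e b) -> 0 < s -> 0 < wgt l k c s w.
Proof. by move=> c0 s0; rewrite mulr_gt0 ?exprn_gt0 // prodr_gt0. Qed.

Lemma wgt_meet_join c1 c2 (s1 s2 : R) w w' :
  (forall e b, 0 <= c1 e b) -> (forall e b, 0 <= c2 e b) ->
  (forall e, e \in l -> c1 e true * c2 e false <= c1 e false * c2 e true) ->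
  1 <= s2 -> s2 <= s1 ->
  wgt l k c1 s1 w * wgt l k c2 s2 w' <=
  wgt l k c1 s1 (meetc w w') * wgt l k c2 s2 (joinc w w').
Proof.
move=> c10 c20 h s21 s12; rewrite /wgt mulrACA [leRHS]mulrACA.
have s20 : 0 <= s2 by rewrite (le_trans ler01).
have s10 : 0 <= s1 by rewrite (le_trans s20).
apply: ler_pM; rewrite ?mulr_ge0 ?exprn_ge0 ?prodr_ge0 //.
- exact: pow_meet_join.
- exact: cprod_meet_join.
Qed.

Lemma wgt_step c s w e : e \in l ->
  c e true * wgt l k c s (upd w e false) =
  s ^+ (~~ cn e w) * c e false * wgt l k c s (upd w e true).
Proof.
move=> el; rewrite /wgt !cprod_upd // (rc_step sys) // exprD; ring.
Qed.

Lemma wgt_local c s w w' : {in l, w =1 w'} -> wgt l k c s w = wgt l k c s w'.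
Proof.
move=> h; rewrite /wgt (rc_local sys h); congr (_ * _).
by apply: eq_big_seq => x xl; rewrite h.
Qed.

(** Meant for a [G] that is not itself a random-cluster weight on [l], such as a marginal. Only the
    one-edge odds of [G] at [B] are compared with random-cluster odds at the same [B]; [rc_mono]
    then passes to the smaller [A]. *)
Lemma wgt_meet_join_local c s (G : (E -> bool) -> R) :
  (forall e b, 0 < c e b) -> 1 <= s -> (forall w, 0 < G w) ->
  (forall w w', {in l, w =1 w'} -> G w = G w') ->
  (forall e B, e \in l -> B e = false ->
     c e true * G B <= c e false * s ^+ (~~ cn e B) * G (upd B e true)) ->
  forall w w', wgt l k c s w * G w' <= wgt l k c s (meetc w w') * G (joinc w w').
Proof.
move=> c0 s1 G0 Gl h; have s0 : 0 < s by rewrite (lt_le_trans ltr01).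
apply: (@local_to_global _ _ l) => //; first exact: wgt_local.
move=> e A B el AB Ae Be.
rewrite -(ler_pM2l (c0 e true)) [leRHS]mulrA.
have -> : wgt l k c s A = wgt l k c s (upd A e false) by rewrite -Ae upd_id.
rewrite wgt_step // mulrCA.
have W0 : 0 < wgt l k c s (upd A e true) by rewrite wgt_gt0.
apply: (le_trans (ler_wpM2l (ltW W0) (h _ _ el Be))).
rewrite mulrA; apply: ler_wpM2r; first exact: ltW.
rewrite [leLHS]mulrC; apply: ler_wpM2r; first exact: ltW.
rewrite mulrC; apply: ler_wpM2r; first exact: ltW.
have := rc_mono sys (e := e) AB.
by case: (cn e A) => [/(_ isT) ->//|_]; case: (cn e B).
Qed.

Lemma le_incr_local (f : (E -> bool) -> R) :
  (forall w w', {in l, w =1 w'} -> f w = f w') ->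
  (forall w e, e \in l -> f (upd w e false) <= f (upd w e true)) -> incr f.
Proof.
move=> fl fe w w' ww'.
(* Exponentiating [f] makes the multiplicative lemma additive; with the constant 1 as first function
   it says that [f] grows along one-edge openings. *)
have := @local_to_global _ _ l (fun=> 1) (fun w => expR (f w)) _ _ _ _ w' w.
have -> : joinc w' w = w'.
  by apply/funext => x; rewrite /joinc; case: (w' x) (ww' x) => //; case: (w x) => // ->.
rewrite !mul1r ler_expR; apply => //.
- by move=> ?; rewrite expR_gt0.
- by move=> v v' /fl ->.
- move=> e A B el _ _ Be; rewrite !mul1r ler_expR -[in leLHS](upd_id B e) Be.
  exact: fe.
Qed.

Variables (I : eqType) (xs : seq I) (star : I -> seq E) (D : nat) (int : pred E).
Hypothesis star_sub : forall x, x \in xs -> {subset star x <= l}.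
Hypothesis star_uniq : forall x, x \in xs -> uniq (star x).
Hypothesis star_size : forall x, x \in xs -> (size (star x) <= D)%N.
Hypothesis int_star : forall e, e \in l -> int e -> exists2 x, x \in xs & e \in star x.
(** Opening [f] destroys at most two isolated vertices, and none unless it merges two clusters: the
    number of isolated vertices minus twice the number of clusters is increasing. *)
Hypothesis star_step : forall f w, f \in l ->
  \sum_(x <- xs) (closed_all R (star x) (upd w f false)
                 - closed_all R (star x) (upd w f true)) <= 2 * (~~ cn f w)%:R.

Section OneWeight.
Variables (c : E -> bool -> R) (s kap : R) (X : (E -> bool) -> R) (w0 : E -> bool).
Hypotheses (c0 : forall e b, 0 < c e b) (s1 : 1 <= s).
Hypotheses (kap0 : 0 <= kap).
Hypothesis kapc : forall f, f \in l -> kap * (c f false + c f true) <= c f false.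
Hypotheses (X0 : forall w, 0 <= X w) (Xi : incr X).
Let mu := wgt l k c s.

Let c0' e b : 0 <= c e b. Proof. exact: ltW. Qed.
Let s0 : 0 < s. Proof. exact: lt_le_trans ltr01 s1. Qed.
Let mu0 w : 0 <= mu w. Proof. by apply: wgt_ge0 => //; exact: ltW. Qed.
Let mu_lat w w' : mu w * mu w' <= mu (meetc w w') * mu (joinc w w').
Proof. by apply: wgt_meet_join => // e _; rewrite mulrC. Qed.

Lemma cov_star x e : x \in xs -> e \in star x -> kap <= 1 ->
  kap ^+ D * cov l mu w0 X (fun w => (w e)%:R)
  <= - cov l mu w0 X (closed_all R (star x)).
Proof.
move=> xx ex kap1.
(* The conditional probability that [f] is closed given the other edges. It is at least [kap]
   because [1 <= s], and it decreases with [w] because [cn] increases. *)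
pose r f w := s ^+ (~~ cn f w) * c f false / (s ^+ (~~ cn f w) * c f false + c f true).
have sn n : 1 <= s ^+ n by rewrite exprn_ege1.
have sp n : 0 < s ^+ n by rewrite exprn_gt0.
have den f w : 0 < s ^+ (~~ cn f w) * c f false + c f true.
  by rewrite addr_gt0 // mulr_gt0.
have C0 : 0 <= cov l mu w0 X (fun w => (w e)%:R).
  apply: fkg => // w w' /(_ e); rewrite ler_nat.
  by case: (w e) => // /(_ isT) ->.
have := @cov_closed_all _ _ l mu w0 mu0 mu_lat r kap X (rem e (star x)) e ul kap0.
have ext : perm_eq (rcons (rem e (star x)) e) (star x).
  by rewrite perm_rcons perm_sym perm_to_rem.
have -> : closed_all R (rcons (rem e (star x)) e) = closed_all R (star x).
  by apply/funext => w; apply: perm_big.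
move=> H; apply: le_trans (H _ _ _ _ _ _ _ _).
- apply: ler_wpM2r => //; apply: ler_wiXn2l => //.
  by rewrite size_rem // (leq_trans (leq_pred _)) // star_size.
- move=> f w fl; apply/andP; split.
  + rewrite ler_pdivlMr // mulrDr.
    have := kapc fl; rewrite mulrDr => kc.
    have h : kap * (s ^+ (~~ cn f w) * c f false) - kap * c f false <=
      s ^+ (~~ cn f w) * c f false - c f false.
      rewrite -mulrBr ler_piMl // subr_ge0 ler_peMl //.
    lra.
  + by rewrite ler_pdivrMr // mul1r lerDl ltW.
- move=> f fl w w' ww'; rewrite lerN2.
  have := rc_mono sys (e := f) ww'; rewrite /r.
  case: (cn f w) => [/(_ isT) ->//|_]; case: (cn f w') => //=.
  rewrite expr0 expr1 mul1r ler_pdivrMr ?addr_gt0 // mulrAC ler_pdivlMr; last first.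
    by rewrite addr_gt0 // mulr_gt0.
  rewrite -subr_ge0; set u := c f false; set v := c f true.
  have -> : s * u * (u + v) - u * (s * u + v) = (s - 1) * (u * v) by ring.
  by rewrite mulr_ge0 ?subr_ge0 // mulr_ge0 // ltW // c0.
- by move=> f w b; rewrite /r (rc_upd sys).
- move=> f w fl; rewrite /r.
  have := wgt_step c s w fl; rewrite -/mu.
  set m0 := mu _; set m1 := mu _; set t := s ^+ _ => h.
  have d0 := den f w; rewrite -/t in d0.
  rewrite mulrAC -[LHS](mulfK (lt0r_neq0 d0)); congr (_ / _).
  by rewrite !mulrDr [m0 * c _ _]mulrC h; ring.
- exact: X0.
- exact: Xi.
- by move=> y /mem_rem; apply: star_sub.
- by rewrite (perm_uniq ext) star_uniq.
Qed.

(** Both sides are compared with the covariance [S] of [X] with minus the number of isolated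
    vertices. Every internal edge lies in some star of at most [D] edges, whence the factor [D]; FKG
    applied to [star_step] gives the factor 2. *)
Lemma cov_clusters : kap <= 1 ->
  kap ^+ D * cov l mu w0 X (fun w => \sum_(e <- l | int e) (w e)%:R)
  <= 2 * D%:R * - cov l mu w0 X (fun w => (k w)%:R).
Proof.
move=> kap1.
have C0 e : 0 <= cov l mu w0 X (fun w => (w e)%:R).
  apply: fkg => // w w' /(_ e); rewrite ler_nat.
  by case: (w e) => // /(_ isT) ->.
pose J x := closed_all R (star x).
pose S := \sum_(x <- xs) - cov l mu w0 X (J x).
have kS : S <= 2 * - cov l mu w0 X (fun w => (k w)%:R).
  have : 0 <= cov l mu w0 X (fun w => \sum_(x <- xs) (J x w) + (-2) * (k w)%:R).
    apply: fkg => //; apply: le_incr_local.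
      move=> w w' ww'; congr (_ + _ * _%:R); last exact: rc_local sys _ _ ww'.
      rewrite !big_seq; apply: eq_bigr => x xx; apply: eq_big_seq => f fx.
      by rewrite ww' // (star_sub xx).
    move=> w f fl; rewrite (rc_step sys) // natrD mulrDr.
    have := star_step w fl; rewrite sumrB -/J; lra.
  rewrite covD covZ cov_sum /S sumrN; lra.
have intS : kap ^+ D * cov l mu w0 X (fun w => \sum_(e <- l | int e) (w e)%:R) <= D%:R * S.
  rewrite (@eq_cov _ _ _ _ _ _ _ (fun w => \sum_(e <- [seq e <- l | int e]) (w e)%:R)); last first.
    by move=> w; rewrite big_filter.
  rewrite cov_sum.
  apply: (@le_trans _ _ (kap ^+ D * \sum_(e <- flatten [seq star x | x <- xs])
      cov l mu w0 X (fun w => (w e)%:R))).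
    apply: ler_wpM2l; first exact: exprn_ge0.
    apply: ler_sum_subset => //; first exact: filter_uniq.
    move=> e; rewrite mem_filter => /andP[ie el].
    have [x xx ex] := int_star el ie; apply/flattenP; exists (star x) => //.
    exact: map_f.
  rewrite big_flatten big_map !mulr_sumr big_seq [leRHS]big_seq.
  apply: ler_sum => x xx; rewrite mulr_sumr.
  have neg0 : 0 <= - cov l mu w0 X (J x).
    case E1 : (star x) => [|e t].
      rewrite /J E1 (@eq_cov _ _ _ _ _ _ _ (fun=> 1)) ?cov_cst ?oppr0 //.
      by move=> w; rewrite /closed_all big_nil.
    apply: le_trans (@cov_star x e xx _ kap1); last by rewrite E1 inE eqxx.
    by rewrite mulr_ge0 // exprn_ge0.
  apply: (@le_trans _ _ (\sum_(e <- star x) - cov l mu w0 X (J x))).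
    by rewrite big_seq [leRHS]big_seq; apply: ler_sum => e ex; apply: cov_star.
  rewrite big_const_seq count_predT iter_addr_0 -[leLHS]mulr_natl.
  by rewrite ler_wpM2r // ler_nat star_size.
apply: (le_trans intS); rewrite -mulrA mulrCA.
by rewrite ler_wpM2l.
Qed.

End OneWeight.

(* Decreasing [log s] by [b] outweighs decreasing all internal log-odds by [a]. *)
Lemma wgt_tradeoff (c c2 : E -> bool -> R) (s s2 kap a b : R) (X : (E -> bool) -> R) w0 :
  (forall e (o : bool), c2 e o = if int e && o then c e o * expR (- a) else c e o) ->
  s2 = s * expR (- b) ->
  (0 < D)%N -> (forall e b, 0 < c e b) -> 0 <= kap <= 1 ->
  (forall f, f \in l -> kap * (c f false + c f true) <= c f false) ->
  0 <= a -> 0 <= b -> 1 <= s2 -> a * (2 * D%:R) <= b * kap ^+ D ->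
  (forall w, 0 <= X w) -> incr X ->
  sumc l (fun w => X w * wgt l k c s w) w0 * sumc l (wgt l k c2 s2) w0 <=
  sumc l (wgt l k c s) w0 * sumc l (fun w => X w * wgt l k c2 s2 w) w0.
Proof.
move=> c2E s2E D0 c0 /andP[kap0 kap1] kapc a0 b0 + ab X0 Xi; rewrite s2E => sb.
have e0 x : 0 < expR x :> R := expR_gt0 x.
have s0 : 0 < s by rewrite -(pmulr_lgt0 _ (e0 (- b))) (lt_le_trans ltr01).
pose N w : R := \sum_(e <- l | int e) (w e)%:R.
pose G w := - a * N w + - b * (k w)%:R.
pose ct t e (o : bool) := if int e && o then c e o * expR (- (t * a)) else c e o.
(* The tilted weight is again a random-cluster weight, with internal odds multiplied by
   [expR (- (t * a))]; hence the correlation inequalities hold at every point of the path. *)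
have wt t w : wgt l k c s w * expR (t * G w) = wgt l k (ct t) (s * expR (- (t * b))) w.
  rewrite /wgt exprMn -expRM_natl /cprod.

  have -> : \prod_(e <- l) ct t e (w e) = \prod_(e <- l) c e (w e) * expR (- (t * a) * N w).
    rewrite /N mulr_sumr expR_sum [X in _ * X]big_mkcond -big_split /=.
    apply: eq_bigr => e _; rewrite /ct; case: (int e) => /=; last by rewrite mulr1.
    by case: (w e); rewrite ?mulr1 // mulr0 expR0 mulr1.
  have -> : t * G w = (k w)%:R * - (t * b) + - (t * a) * N w by rewrite /G; ring.
  rewrite expRD mulrACA; congr (_ * _).
have H w : wgt l k c2 s2 w = wgt l k c s w * expR (G w).
  rewrite -[G w]mul1r wt s2E !mul1r; congr (wgt _ _ _ _ _).
  by apply/funext => e; apply/funext => o; rewrite c2E /ct mul1r.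
have -> : wgt l k c2 (s * expR (- b)) = fun w => wgt l k c s w * expR (G w) by rewrite -s2E; apply/funext.
apply: tilt_mono => [w|t /andP[t0 t1]]; first exact: wgt_gt0.
have -> : (fun w => wgt l k c s w * expR (t * G w)) =
  wgt l k (ct t) (s * expR (- (t * b))) by apply/funext => w.
rewrite covD !covZ.
have ct0 e o : 0 < ct t e o by rewrite /ct; case: ifP => // _; rewrite mulr_gt0.
have st1 : 1 <= s * expR (- (t * b)).
  apply: (le_trans sb); rewrite ler_wpM2l ?(ltW s0) // ler_expR lerN2.
  by rewrite ler_piMl.
(* Tilting only lowers open weights, so one [kap] serves for all [t]. *)
have kapt f : f \in l -> kap * (ct t f false + ct t f true) <= ct t f false.
  move=> fl; have := kapc f fl; rewrite /ct andbF andbT.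
  case: ifP => // _; apply: le_trans; apply: ler_wpM2l => //; rewrite lerD2l.
  by rewrite ler_piMr ?(ltW (c0 _ _)) // -expR0 ler_expR oppr_le0 mulr_ge0.
have := cov_clusters w0 ct0 st1 kap0 kapt X0 Xi kap1.
set cN := cov _ _ _ _ _; set ck := cov _ _ _ _ (fun w => (k w)%:R) => h.
have cN0 : 0 <= cN.
  apply: fkg => //.
  - by move=> w; apply: ltW; rewrite wgt_gt0 // (lt_le_trans ltr01).
  - by move=> w w'; apply: wgt_meet_join => // [e o|e o|e _]; rewrite ?(ltW (ct0 _ _)) // mulrC.
  - move=> w w' ww'; apply: ler_sum => e _; rewrite ler_nat.
    by case: (w e) (ww' e) => // /(_ isT) ->.
suff : 0 <= b * - ck - a * cN by rewrite !mulNr mulrN addrC.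
rewrite subr_ge0 -(@ler_pM2l _ (2 * D%:R)); last by rewrite mulr_gt0 // ltr0n.
apply: (@le_trans _ _ (b * (kap ^+ D * cN))).
  by rewrite [leLHS]mulrA [leRHS]mulrA [_ * a]mulrC ler_wpM2r.
by rewrite [leRHS]mulrCA ler_wpM2l.
Qed.

End System.
End Weights.

(** * Integrating out the ghost edges *)

Section Marginal.
Variables (E : eqType) (R : realType).
Implicit Types (w : E -> bool).

Definition open_all (T : seq E) w : R := \prod_(f <- T) (w f)%:R.

Lemma open_all_ge0 T w : 0 <= open_all T w.
Proof. by rewrite prodr_ge0. Qed.

Lemma open_allE T w : open_all T w = (all w T)%:R.
Proof.
rewrite /open_all; elim: T => [|f T IH] /=; first by rewrite big_nil.
by rewrite big_cons IH; case: (w f); rewrite ?mul1r ?mul0r.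
Qed.

(** The edges of [T] are opened successively: given all the others, each is open with conditional
    probability at least [a]. *)
Lemma sumc_open_all (le : seq E) (M : (E -> bool) -> R) (a : R) (T : seq E) w0 :
  uniq le -> uniq T -> {subset T <= le} -> 0 <= a ->
  (forall f w, f \in le -> a * (M (upd w f false) + M (upd w f true)) <= M (upd w f true)) ->
  a ^+ size T * sumc le M w0 <= sumc le (fun w => open_all T w * M w) w0.
Proof.
move=> ule + + a0 h; elim: T => [_ _|f T IH /= /andP[fT uT] sub].
  rewrite expr0 mul1r; apply: le_sumc => w _.
  by rewrite /open_all big_nil mul1r.
have {}IH : a ^+ size T * sumc le M w0 <= sumc le (fun w => open_all T w * M w) w0.
  by apply: IH => // x xT; apply: sub; rewrite inE xT orbT.
have fle : f \in le by apply: sub; rewrite inE eqxx.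
rewrite exprS -mulrA; apply: (le_trans (ler_wpM2l a0 IH)).
rewrite -sumcZ; apply: (le_sumc_resample _ ule fle) => w.
have oT b : open_all T (upd w f b) = open_all T w.
  apply: eq_big_seq => x xT; rewrite /upd; case: eqP => // xf.
  by rewrite xf (negbTE fT) in xT.
have of_ b : open_all (f :: T) (upd w f b) = b%:R * open_all T w.
  by rewrite {1}/open_all big_cons upd_same -/(open_all T _) oT.
rewrite !oT !of_ !mul0r add0r mul1r -!mulrDr mulrCA.
rewrite ler_wpM2l ?open_all_ge0 //.
exact: h.
Qed.

Lemma sumc_indep (l1 l2 : seq E) (f : (E -> bool) -> R) w w' :
  (forall w w', {in l1 ++ l2, w =1 w'} -> f w = f w') -> {in l1, w =1 w'} ->
  sumc l2 f w = sumc l2 f w'.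
Proof.
elim: l2 l1 w w' => [|e l2 IH] l1 w w' h ww' /=.
  by apply: h; rewrite cats0.
have H b : sumc l2 f (upd w e b) = sumc l2 f (upd w' e b).
  apply: (IH (rcons l1 e)) => [v v'|x]; rewrite ?cat_rcons.
    exact: h.
  by rewrite mem_rcons inE /upd; case: eqP => // _ /ww'.
by rewrite !H.
Qed.

Variables (li le : seq E) (k k0 : (E -> bool) -> nat).
Variables (cn cn0 : E -> (E -> bool) -> bool) (ghost_ends : E -> seq E) (c : E -> bool -> R) (s : R).
Hypothesis sys : rc_system (li ++ le) k cn.
Hypothesis sys0 : rc_system li k0 cn0.
Hypothesis cn0_cn : forall e w w', {in predC (mem le), w' =1 w} -> cn0 e w -> cn e w'.
Hypothesis ghost_ends_uniq : forall e, uniq (ghost_ends e).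
Hypothesis ghost_ends_sub : forall e, e \in li -> {subset ghost_ends e <= le}.
Hypothesis ghost_ends_size : forall e, (size (ghost_ends e) <= 2)%N.
Hypothesis ghost_ends_cn : forall e w, e \in li -> all w (ghost_ends e) -> cn e w.
Hypothesis c0 : forall e b, 0 < c e b.
Hypothesis s1 : 1 <= s.

(* [a] bounds the conditional probability of an open ghost edge, so that both
   ends of an internal edge are connected through the ghost with probability at
   least [a ^+ 2]: seen from the internal edges, the field lowers the cluster
   weight from [s] to [t] at least. *)
Lemma ghost_marginal (a t : R) (X : (E -> bool) -> R) w0 :
  0 <= a <= 1 -> (forall f, f \in le -> a * (c f true + s * c f false) <= c f true) ->
  1 <= t -> t^-1 <= s^-1 + (1 - s^-1) * a ^+ 2 ->
  (forall w, 0 <= X w) -> incr X ->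
  (forall w w', {in predC (mem le), w' =1 w} -> X w' = X w) ->
  sumc li (fun w => X w * wgt li k0 c t w) w0 * sumc (li ++ le) (wgt (li ++ le) k c s) w0 <=
  sumc li (wgt li k0 c t) w0 * sumc (li ++ le) (fun w => X w * wgt (li ++ le) k c s w) w0.
Proof.
move=> /andP[a0 a1] ha t1 hts X0 Xi Xle.
have s0 : 0 < s by rewrite (lt_le_trans ltr01).
have t0 : 0 < t by rewrite (lt_le_trans ltr01).
pose mu := wgt (li ++ le) k c s.
(* The marginal weight of the internal edges, to be compared with a random-cluster weight through
   its one-edge odds. *)
pose G := sumc le mu.
have mu0 w : 0 < mu w by exact: wgt_gt0.
have := rc_uniq sys; rewrite cat_uniq => /and3P[uli /hasPn dis ule].
have -> : sumc (li ++ le) mu w0 = sumc li G w0 by rewrite sumc_cat.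
have -> : sumc (li ++ le) (fun w => X w * mu w) w0 = sumc li (fun w => X w * G w) w0.
  rewrite sumc_cat; apply: eq_sumcT => w; rewrite -sumcZ; apply: eq_sumc => w' /Xle ->.
  by [].
have Gl w w' : {in li, w =1 w'} -> G w = G w'.
  by apply: sumc_indep => v v' vv'; apply: (wgt_local sys).
apply: holley => //.
- by move=> w; apply: wgt_ge0 => [e b|]; exact: ltW.
- by move=> w; apply: sumc_ge0 => v; apply: ltW.
apply: (wgt_meet_join_local sys0) => //.
  by move=> w; apply: sumc_gt0 => v.
move=> e B el Be.
have enle : e \notin le by apply/negP => ele; have := dis _ ele; rewrite el.
have ell : e \in li ++ le by rewrite mem_cat el.
have -> : G B = sumc le (fun w => mu (upd w e false)) B.
  by rewrite -sumc_upd // -Be upd_id.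
rewrite /G sumc_upd //.
rewrite -!sumcZ.
have step w := wgt_step sys c s w ell.
(* If the ends of [e] are connected without the ghost, both models give [e] the same odds; otherwise
   the gain comes from connections through the ghost. *)
have [cB|cB] := boolP (cn0 e B).
  apply: le_sumc => w wB; rewrite step (cn0_cn wB cB) /= expr0 mul1r mulr1.
  by [].
rewrite /= expr1.
pose M w := mu (upd w e false).
(* Closing a ghost edge gains at most a factor [s], so [ha] bounds its conditional probability of
   being open by [a] from below. *)
have HM f w : f \in le -> a * (M (upd w f false) + M (upd w f true)) <= M (upd w f true).
  move=> fle; have fe : f != e by apply: contraNneq enle => <-.
  rewrite /M ![upd (upd w f _) e _]updC //.
  set v := upd w e false.
  have fl : f \in li ++ le by rewrite mem_cat fle orbT.
  have := wgt_step sys c s v fl; rewrite -/mu => stf.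
  rewrite -(ler_pM2l (c0 f true)) mulrCA mulrDr stf -mulrDl mulrA.
  rewrite ler_wpM2r ?(ltW (mu0 _)) //; apply: le_trans (ha _ fle).
  rewrite ler_wpM2l // addrC lerD2l ler_wpM2r //; first exact: ltW.
  by case: (cn f v) => /=; rewrite ?expr0 ?expr1.
have HO : a ^+ 2 * sumc le M B <= sumc le (fun w => open_all (ghost_ends e) w * M w) B.
  apply: le_trans (@sumc_open_all le M a (ghost_ends e) B ule (ghost_ends_uniq e) (ghost_ends_sub el) a0 HM).
  apply: ler_wpM2r; first by apply: sumc_ge0 => w; apply: ltW; apply: mu0.
  by apply: ler_wiXn2l => //; exact: ghost_ends_size.
(* When both ghost edges are open, opening [e] merges nothing and costs a factor 1; in all cases it
   costs at least the factor [s^-1]. *)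
have lower : c e true * (s^-1 * sumc le M B + (1 - s^-1) * sumc le (fun w => open_all (ghost_ends e) w * M w) B)
   <= sumc le (fun w => c e false * mu (upd w e true)) B.
  rewrite -!sumcZ -sumcD -sumcZ; apply: le_sumc => w _.
  have -> : c e true * (s^-1 * M w + (1 - s^-1) * (open_all (ghost_ends e) w * M w)) =
    (s^-1 + (1 - s^-1) * open_all (ghost_ends e) w) * (c e true * M w) by ring.
  rewrite /M step open_allE mulrA ler_wpM2r ?(ltW (mu0 _)) // mulrA.
  rewrite ler_piMl ?(ltW (c0 _ _)) //.
  have sV1 : s^-1 <= 1 by rewrite invf_le1.
  case: (boolP (all w (ghost_ends e))) => [/(ghost_ends_cn el) ->|_] /=.
    by rewrite expr0; lra.
  rewrite mulr0 addr0; case: (cn e w) => /=; rewrite ?expr0 ?expr1 ?mulr1 //.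
  by rewrite mulVf // gt_eqF.
rewrite sumcZ -[X in _ <= X](_ : t * sumc le (fun w => c e false * mu (upd w e true)) B = _).
  apply: (@le_trans _ _ (t * (c e true * (t^-1 * sumc le M B)))).
    by rewrite mulrCA [t * _]mulrA mulfV ?mul1r // gt_eqF.
  rewrite ler_wpM2l ?(ltW t0) //; apply: le_trans lower.
  rewrite ler_wpM2l ?(ltW (c0 _ _)) //.
  apply: (@le_trans _ _ ((s^-1 + (1 - s^-1) * a ^+ 2) * sumc le M B)).
    by rewrite ler_wpM2r // sumc_ge0 // => w; apply: ltW; apply: mu0.
  rewrite mulrDl lerD2l -mulrA ler_wpM2l // subr_ge0 invf_le1 //.
by rewrite -sumcZ; apply: eq_sumcT => w; rewrite mulrA [t * _]mulrC.
Qed.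

End Marginal.

(** * Clusters in a wired box *)

Section Clusters.
Variables (V : Type) (E : eqType) (ends : E -> V * V).
Implicit Types (w : E -> bool) (u v x y : V).

Local Notation oc := (open_cluster ends).

Lemma oc_refl w u : oc w u u. Proof. by exists [::]. Qed.

Lemma oc_trans w u v x : oc w u v -> oc w v x -> oc w u x.
Proof.
move=> [p pp <-] [q qq <-]; exists (p ++ q); first by rewrite cat_path pp.
by rewrite last_cat.
Qed.

Lemma oc_step w u v : open_step ends w u v -> oc w u v.
Proof. by move=> h; exists [:: v] => //=; rewrite h. Qed.

Lemma open_step_sym w u v : open_step ends w u v -> open_step ends w v u.
Proof. by move=> /asboolP[e [we h]]; apply/asboolP; exists e; split=> //; case: h; auto. Qed.

Lemma oc_ind w (P : V -> Prop) u : P u ->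
  (forall x y, P x -> open_step ends w x y -> P y) -> forall v, oc w u v -> P v.
Proof.
move=> Pu h v [p pp <-]; elim: p u pp Pu => [|x p IH] u //= /andP[ux xp] Pu.
by apply: IH => //; apply: h ux.
Qed.

Lemma oc_sym w u v : oc w u v -> oc w v u.
Proof.
apply: (oc_ind (P := fun v => oc w v u)); first exact: oc_refl.
move=> x y xu /open_step_sym/oc_step; move=> h; exact: oc_trans h xu.
Qed.

Lemma oc_le w w' u v : lec w w' -> oc w u v -> oc w' u v.
Proof.
move=> ww'; apply: oc_ind; first exact: oc_refl.
move=> x y ux /asboolP[e [we h]]; apply: (oc_trans ux); apply: oc_step.
by apply/asboolP; exists e; split=> //; apply: ww'.
Qed.

Lemma oc_edge w e : w e -> oc w (ends e).1 (ends e).2.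
Proof. by move=> we; apply: oc_step; apply/asboolP; exists e; split=> //; left; case: (ends e). Qed.

Lemma oc_eq w u v : oc w u v -> oc w u = oc w v.
Proof.
move=> uv; apply/seteqP; split=> x h; last exact: oc_trans uv h.
by apply: oc_trans h; apply: oc_sym.
Qed.

(** A path may be taken to cross [e] at most once, in one of its two directions. *)
Lemma oc_add w e x y : oc (upd w e true) x y ->
  let w0 := upd w e false in
  oc w0 x y \/ (oc w0 x (ends e).1 /\ oc w0 (ends e).2 y) \/
  (oc w0 x (ends e).2 /\ oc w0 (ends e).1 y).
Proof.
move=> h w0; move: y h; apply: oc_ind; first by left; exact: oc_refl.
move=> u v IH /asboolP[f [wf hf]].
have [fe|fe] := eqVneq f e; last first.
  have uv : oc w0 u v.
    apply: oc_step; apply/asboolP; exists f; split=> //.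
    by move: wf; rewrite /w0 /upd (negbTE fe).
  case: IH => [h|[[h1 h2]|[h1 h2]]]; first by left; exact: oc_trans h uv.
  - by right; left; split=> //; apply: oc_trans h2 uv.
  - by right; right; split=> //; apply: oc_trans h2 uv.
rewrite fe in hf.
case: hf => ee; move: IH; rewrite ee /= => IH.
- case: IH => [h|[[h1 h2]|[h1 h2]]].
  + by right; left; split=> //; exact: oc_refl.
  + by right; left; split=> //; exact: oc_refl.
  + by left.
- case: IH => [h|[[h1 h2]|[h1 h2]]].
  + by right; right; split=> //; exact: oc_refl.
  + by left.
  + by right; right; split=> //; exact: oc_refl.
Qed.

Lemma oc_add_same w e x : let w0 := upd w e false in
  ~ oc w0 x (ends e).1 -> ~ oc w0 x (ends e).2 -> oc (upd w e true) x = oc w0 x.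
Proof.
move=> w0 h1 h2; apply/seteqP; split=> y; last first.
  by apply: oc_le; apply: lec_upd.
by move=> /oc_add[//|[[]|[]]].
Qed.

Lemma oc_add_conn w e : let w0 := upd w e false in
  oc w0 (ends e).1 (ends e).2 -> oc (upd w e true) = oc w0.
Proof.
move=> w0 h; apply/funext => x; apply/seteqP; split=> y; last first.
  by apply: oc_le; apply: lec_upd.
move=> /oc_add[//|[[h1 h2]|[h1 h2]]].
- exact: oc_trans h1 (oc_trans h h2).
- by apply: oc_trans h1 (oc_trans _ h2); apply: oc_sym.
Qed.

End Clusters.

Section Box.
Local Open Scope fset_scope.
Local Open Scope ring_scope.
Variable d : nat.
Implicit Types (L : {fset zlattice d}) (w v : edge d -> bool) (x y : zlattice d).

Local Notation oc := (open_cluster (@ends d)).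

Lemma unit_vec_neq0 (i : 'I_d) : unit_vec i != 0.
Proof.
apply/eqP => /matrixP/(_ 0 i); rewrite !mxE !eqxx /= => /eqP.
by rewrite oner_eq0.
Qed.

Lemma in_internal_edges L (e : iedge d) :
  (e \in internal_edges L) = (e.1 \in L) || (e.1 + unit_vec e.2 \in L).
Proof.
apply/idP/idP.
  rewrite /internal_edges inE => /orP[] /imfset2P[x xL [i _ ->]] /=; first by rewrite xL.
  by rewrite subrK xL orbT.
rewrite /internal_edges inE; case: e => x i /= /orP[xL|xL]; apply/orP; [left|right];
  apply/imfset2P.
  by exists x => //; exists i.
by exists (x + unit_vec i) => //; exists i => //; rewrite addrK.
Qed.

Definition ints L : seq (edge d) := [seq inl e | e <- internal_edges L].
Definition exts L : seq (edge d) := [seq inr x | x <- L].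

Lemma ints_uniq L : uniq (ints L).
Proof. by rewrite map_inj_uniq ?fset_uniq // => x y []. Qed.

Lemma exts_uniq L : uniq (exts L).
Proof. by rewrite map_inj_uniq ?fset_uniq // => x y []. Qed.

Lemma mem_ints_inl L e : (inl e \in ints L) = (e \in internal_edges L).
Proof. by rewrite mem_map // => x y []. Qed.
Lemma mem_ints_inr L x : (inr x \in ints L) = false.
Proof. by apply/negP => /mapP[]. Qed.
Lemma mem_exts_inr L x : (inr x \in exts L) = (x \in L).
Proof. by rewrite mem_map // => y z []. Qed.
Lemma mem_exts_inl L e : (inl e \in exts L) = false.
Proof. by apply/negP => /mapP[]. Qed.

Definition mem_ie := (mem_ints_inl, mem_ints_inr, mem_exts_inr, mem_exts_inl, mem_cat).

Lemma box_uniq L : uniq (ints L ++ exts L).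
Proof.
rewrite cat_uniq ints_uniq exts_uniq andbT /=; apply/hasPn => -[e|x].
  by rewrite mem_exts_inl.
by rewrite mem_ints_inr.
Qed.

Lemma mem_box L e : (e \in box_edges L) = (e \in ints L ++ exts L).
Proof.
rewrite /box_edges inE mem_cat; congr (_ || _).
  by apply/imfsetP/mapP => -[x xL ->]; exists x.
by apply/imfsetP/mapP => -[x xL ->]; exists x.
Qed.

(* With [g = false] the ghost edges of [L] are kept closed. *)
Definition wire (g : bool) L w : edge d -> bool := fun e =>
  match e with
  | inl i => (i \notin internal_edges L) || w e
  | inr x => (x \notin L) || (g && w e)
  end.

Definition box (g : bool) L := ints L ++ (if g then exts L else [::]).

Definition wired_nclusters g L w : nat := nclusters L (wire g L w).

Definition cn g L (e : edge d) w : bool :=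
  `[< oc (upd (wire g L w) e false) (ends e).1 (ends e).2 >].

Lemma wire_upd g L w e b : e \in box g L -> wire g L (upd w e b) = upd (wire g L w) e b.
Proof.
move=> eb; apply/funext => f; rewrite /wire /upd.
case: f => [i|x]; case: eqP => // ef; move: eb; rewrite -ef /box mem_cat.
  by rewrite mem_ints_inl; case: (g); rewrite ?mem_exts_inl orbF => ->.
by rewrite mem_ints_inr; case: (g) => //=; rewrite mem_exts_inr => ->.
Qed.

Lemma wire_le (g g' : bool) L w w' : (g -> g') -> lec w w' -> lec (wire g L w) (wire g' L w').
Proof.
move=> gg ww' [i|x] /=; case: (_ \in _) => //=; first exact: ww'.
by move=> /andP[/gg -> /ww'].
Qed.

Lemma oc_outside L v x : (forall y, y \notin L -> v (inr y)) -> x \notin L ->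
  oc v (Some x) None.
Proof. by move=> h /h; exact: oc_edge. Qed.

Lemma clustersP L v (C : set (option (zlattice d))) :
  reflect (exists x, [/\ x \in L, ~ oc v (Some x) None & C = oc v (Some x)])
    (C \in [fset oc v (Some x) | x in L & `[< ~ oc v (Some x) None >]]).
Proof.
apply: (iffP (imfsetP _ _ _ _)) => /= [[x]|[x [xL /asboolP h ->]]].
  by rewrite !inE => /andP[xL /asboolP h] ->; exists x.
by exists x => //; rewrite !inE xL.
Qed.

Lemma cfset_D1 (T : choiceType) (A : {fset T}) (x : T) : x \in A -> #|` A| = #|` A `\ x|.+1.
Proof. by move=> xA; rewrite (cardfsD1 x) xA. Qed.

(** Only clusters avoiding the ghost count. Opening an edge between two distinct clusters either
    lets the ghost cluster absorb a counted one or merges two counted clusters; the number drops by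
    one in both cases. *)
Lemma nclusters_step L v (e : edge d) : (forall x, x \notin L -> v (inr x)) -> e \in box_edges L ->
  nclusters L (upd v e false) =
  (nclusters L (upd v e true) + ~~ `[< oc (upd v e false) (ends e).1 (ends e).2 >])%N.
Proof.
move=> vL eL; set w0 := upd v e false; set w1 := upd v e true.
have outb (b : bool) x : x \notin L -> upd v e b (inr x).
  move=> xL; rewrite /upd; case: eqP => [xe|_]; last exact: vL.
  by move: eL; rewrite -xe mem_box mem_cat mem_ints_inr mem_exts_inr (negbTE xL).
case: asboolP => [ab|nab] /=.
  by rewrite addn0 /nclusters /w1 (oc_add_conn ab).
move: nab (@oc_add _ _ (@ends d) v e) (@oc_add_same _ _ (@ends d) v e) (oc_edge (@ends d) (upd_same v e true)).
rewrite -/w0 -/w1; set a := (ends e).1; set b := (ends e).2 => nab add same ab1.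
have le01 (x y : option (zlattice d)) : oc w0 x y -> oc w1 x y by apply: oc_le; apply: lec_upd.
rewrite /nclusters.
set F0 := [fset oc w0 (Some x) | x in L & _]; set F1 := [fset oc w1 (Some x) | x in L & _].
(* Vertices outside [L] are wired to the ghost, so a vertex cut off from it belongs to [L] and its
   cluster is counted. *)
have vert u : ~ oc w0 u None -> exists2 y, y \in L & u = Some y.
  case: u => [y|] h; last by case: h; exact: oc_refl.
  by exists y => //; apply: contra_notT h => yL; exact: oc_outside (outb false) yL.
(* The absorbing case: [t] is joined to the ghost, [u] is not, and exactly the cluster of [u]
   disappears. *)
have one (u t : option (zlattice d)) : ~ oc w0 u t -> ~ oc w0 u None -> oc w0 t None ->
    (forall x : option (zlattice d), ~ oc w0 x u -> ~ oc w0 x t -> oc w1 x = oc w0 x) ->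
    oc w1 u t ->
    #|` F0| = (#|` F1| + 1)%N.
  move=> nut nu tg sm ut.
  have uF : oc w0 u \in F0.
    by have [y yL uy] := vert _ nu; apply/clustersP; exists y; rewrite -uy.
  rewrite (cfset_D1 uF) addn1; congr _.+1; congr #|` _|.
  apply/fsetP => C; rewrite in_fsetD1; apply/andP/clustersP.
    move=> [Cu /clustersP[x [xL xg CE]]]; exists x.
    have xu : ~ oc w0 (Some x) u by move=> h; move: Cu; rewrite CE (oc_eq h) eqxx.
    have xt : ~ oc w0 (Some x) t by move=> h; apply: xg; apply: oc_trans h tg.
    by rewrite sm.
  move=> [x [xL xg CE]].
  have xu : ~ oc w0 (Some x) u.
    move=> /le01 h; apply: xg; apply: oc_trans h _; apply: oc_trans ut _; exact: le01.
  have xt : ~ oc w0 (Some x) t by move=> h; apply: xg; apply: le01; apply: oc_trans h tg.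
  rewrite sm // in xg CE; split; last by apply/clustersP; exists x.
  by apply/eqP => Cu; apply: xu; rewrite -CE Cu; exact: oc_refl.
have [ag|ag] := pselect (oc w0 a None).
  apply: (one b a) => //.
  - by move=> h; apply: nab; apply: oc_sym.
  - by move=> h; apply: nab; apply: oc_trans ag (oc_sym h).
  - by move=> x h1 h2; apply: same.
  - exact: oc_sym.
have [bg|bg] := pselect (oc w0 b None); first by apply: (one a b).
(* The merging case: the clusters of [a] and [b] are removed on one side, their union on the other,
   and the remaining clusters agree. *)
have aF : oc w0 a \in F0.
  by have [y yL uy] := vert _ ag; apply/clustersP; exists y; rewrite -uy.
have bF : oc w0 b \in F0 `\ oc w0 a.
  rewrite in_fsetD1; apply/andP; split; last first.
    by have [y yL uy] := vert _ bg; apply/clustersP; exists y; rewrite -uy.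
  apply/eqP => h; apply: nab; rewrite -h; exact: oc_refl.
have ag1 : ~ oc w1 a None.
  by move=> /add[//|[[_ //]|[//]]].
have cF : oc w1 a \in F1.
  by have [y yL uy] := vert _ ag; apply/clustersP; exists y; rewrite -uy.
rewrite (cfset_D1 aF) (cfset_D1 bF) (cfset_D1 cF) addn1; do 2 congr _.+1; congr #|` _|.
apply/fsetP => C; rewrite !in_fsetD1; apply/idP/idP.
  move=> /and3P[Cb Ca /clustersP[x [xL xg CE]]].
  have xa : ~ oc w0 (Some x) a by move=> h; move: Ca; rewrite CE (oc_eq h) eqxx.
  have xb : ~ oc w0 (Some x) b by move=> h; move: Cb; rewrite CE (oc_eq h) eqxx.
  apply/andP; split; last by apply/clustersP; exists x; rewrite same.
  apply/eqP => h; apply: xa; rewrite -CE h; exact: oc_refl.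
move=> /andP[Ca /clustersP[x [xL xg CE]]].
have xa : ~ oc w0 (Some x) a by move=> /le01 h; move: Ca; rewrite CE (oc_eq h) eqxx.
have xb : ~ oc w0 (Some x) b.
  move=> /le01 h; move: Ca; rewrite CE (oc_eq h) => /eqP; apply; apply: oc_eq.
  exact: oc_sym.
rewrite same // in xg CE; apply/and3P; split; last by apply/clustersP; exists x.
  by apply/eqP => Cu; apply: xb; rewrite -CE Cu; exact: oc_refl.
by apply/eqP => Cu; apply: xa; rewrite -CE Cu; exact: oc_refl.
Qed.

Lemma box_sub g L : {subset box g L <= box_edges L}.
Proof.
move=> e; rewrite mem_box /box !mem_cat; case: (g); last by rewrite in_nil orbF => ->.
by [].
Qed.

Lemma rc_sys g L : rc_system (box g L) (wired_nclusters g L) (cn g L).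
Proof.
split.
- by rewrite /box; case: (g); rewrite ?cats0; [exact: box_uniq|exact: ints_uniq].
- move=> w w' ww'; rewrite /wired_nclusters; congr nclusters; apply/funext => -[i|x] /=.
    have [iL|//] := boolP (i \in internal_edges L); rewrite /= ww' // /box.
    by rewrite mem_cat mem_ints_inl iL.
  have [xL|//] := boolP (x \in L); case: (boolP g) => //= gT; rewrite ww' // /box gT.
  by rewrite mem_cat mem_exts_inr xL orbT.
- move=> e w eb; rewrite /wired_nclusters !wire_upd // nclusters_step //.
  + by move=> x xL /=; rewrite xL.
  + exact: box_sub eb.
- move=> e w w' ww' /asboolP h; apply/asboolP; apply: oc_le h.
  by apply: lec_upd => //; apply: wire_le.
- move=> e w b; rewrite /cn; congr `[< oc _ _ _ >].
  by apply/funext => f; rewrite /upd /wire; case: f => [i|x]; case: eqP.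
Qed.

Definition star g x : seq (edge d) :=
  [seq inl (x, i) | i <- enum 'I_d] ++ [seq inl (x - unit_vec i, i) | i <- enum 'I_d]
  ++ (if g then [:: inr x] else [::]).

Lemma mem_star_inl g x (e : iedge d) :
  (inl e \in star g x) = (x == e.1) || (x == e.1 + unit_vec e.2).
Proof.
rewrite /star !mem_cat orbA; have -> : (inl e \in (if g then [:: inr x] else [::])) = false.
  by case: (g).
rewrite orbF; case: e => y i /=; apply/orP/orP => -[].
- by move=> /mapP[j _ [-> _]]; left.
- by move=> /mapP[j _ [-> ->]]; right; rewrite subrK.
- by move=> /eqP ->; left; apply/mapP; exists i => //; rewrite mem_enum.
- by move=> /eqP ->; right; apply/mapP; exists i; rewrite ?mem_enum // addrK.
Qed.

Lemma mem_star_inr g x y : (inr y \in star g x) = g && (x == y).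
Proof.
have h (f : 'I_d -> iedge d) : (inr y \in [seq (inl (f i) : edge d) | i <- enum 'I_d]) = false.
  by apply/negP => /mapP[].
rewrite /star !mem_cat !h; case: (g); last by [].
by rewrite /= inE (inj_eq inr_inj) eq_sym.
Qed.

Definition internal (e : edge d) := if e is inl _ then true else false.

Lemma star_sub g L x : x \in L -> {subset star g x <= box g L}.
Proof.
move=> xL [e|y]; rewrite /box.
  by rewrite mem_star_inl mem_cat mem_ints_inl in_internal_edges => /orP[]/eqP <-; rewrite xL ?orbT.
rewrite mem_star_inr mem_cat => /andP[-> /eqP <-].
by rewrite mem_exts_inr xL orbT.
Qed.

Lemma star_uniq g x : uniq (star g x).
Proof.
rewrite /star !cat_uniq; apply/and5P; split.
- by rewrite map_inj_uniq ?enum_uniq // => i j [].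
- rewrite has_cat negb_or; apply/andP; split; last first.
    by case: (g) => //=; rewrite orbF; apply/negP => /mapP[].
  apply/hasPn => e /mapP[i _ ->]; apply/negP => /mapP[j _ [h ij]].
  have := unit_vec_neq0 i; rewrite -oppr_eq0 => /eqP; apply.
  by apply: (addrI x); rewrite h addr0.
- by rewrite map_inj_uniq ?enum_uniq // => i j [].
- by case: (g) => //=; rewrite orbF; apply/negP => /mapP[].
- by case: (g).
Qed.

Lemma star_size g x : (size (star g x) <= (d + d).+1)%N.
Proof.
have hs (f : 'I_d -> edge d) : size [seq f i | i <- enum 'I_d] = d by rewrite size_map size_enum_ord.
by rewrite /star !size_cat !hs addnA; case: (g); rewrite /= ?addn1 ?addn0.
Qed.

Lemma int_star g L e : e \in box g L -> internal e -> exists2 x, x \in L & e \in star g x.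
Proof.
case: e => // e; rewrite /box mem_cat mem_ints_inl in_internal_edges.
have -> : (inl e \in (if g then exts L else [::])) = false by case: (g) => //; rewrite mem_exts_inl.
rewrite orbF => /orP[] xL _; [exists e.1|exists (e.1 + unit_vec e.2)] => //;
  by rewrite mem_star_inl eqxx ?orbT.
Qed.

(** The centres of the stars that can contain [e]. A ghost edge has only its lattice endpoint, taken
    twice, since the ghost has no star. *)
Definition pt1 (e : edge d) := match e with inl e => e.1 | inr x => x end.
Definition pt2 (e : edge d) := match e with inl e => e.1 + unit_vec e.2 | inr x => x end.

Lemma star_pt g x (e : edge d) : e \in star g x -> (x == pt1 e) || (x == pt2 e).
Proof.
by case: e => e; rewrite ?mem_star_inl ?mem_star_inr // => /andP[_ ->].
Qed.

(** All edges at [x] that the wiring leaves free are in its star, because [x] is in [L]. With [e]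
    removed and the others closed, the cluster of [x] is a singleton, and [e] joins [x] to a
    different vertex. *)
Lemma isolated g L x w (e : edge d) : x \in L -> e \in star g x ->
  all (fun f => ~~ w f) (rem e (star g x)) -> ~~ cn g L e w.
Proof.
move=> xL es /allP cl; apply/negP => /asboolP.
set v := upd _ _ _ => h.
have vs f : f \in star g x -> v f = false.
  move=> fs; rewrite /v /upd; case: eqP => // /eqP fe.
  have wf : w f = false.
    by apply/negbTE/cl; rewrite mem_rem_uniq ?star_uniq // inE fe.
  have := star_sub xL fs; rewrite /box mem_cat.
  case: f {fs fe} wf => [f|y] wf; rewrite mem_ie.
    by case: (g); rewrite ?mem_exts_inl orbF /= wf => ->.
  by case: (g) => //=; rewrite mem_exts_inr wf => ->.
have iso u : oc v (Some x) u -> u = Some x.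
  move: u.
  apply: oc_ind => // _ y -> /asboolP[f [vf hf]]; exfalso.
  suff fs : f \in star g x by rewrite vs in vf.
  case: f vf hf => [f|z] vf /= hf; rewrite ?mem_star_inl ?mem_star_inr; move: hf.
    by case=> /pair_equal_spec[h1 h2]; [case: h1 => ->|case: h2 => ->]; rewrite eqxx ?orbT.
  move=> hf; have zx : z = x by case: hf => /pair_equal_spec[h1 h2]; [case: h1|case: h2].
  rewrite zx {hf}.
  rewrite eqxx andbT; move: vf; rewrite /v /upd.
  by case: eqP => // _; rewrite /= zx xL /= => /andP[].
have ne : (ends e).1 != (ends e).2.
  case: (e) => //= f; rewrite (inj_eq Some_inj) eq_sym -subr_eq0 addrC addKr.
  exact: unit_vec_neq0.
have : (ends e).1 = Some x \/ (ends e).2 = Some x.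
  case: (e) es => f; rewrite ?mem_star_inl ?mem_star_inr.
    by move=> /orP[]/eqP ->; [left|right].
  by move=> /andP[_ /eqP ->]; left.
case=> ee; move: ne; rewrite ee.
  by rewrite ee in h; rewrite (iso _ h) eqxx.
by rewrite ee in h; rewrite (iso _ (oc_sym h)) eqxx.
Qed.

(** Only the stars centred at [pt1 f] and [pt2 f] see [f]. Such a star changes from closed to not
    closed only if its other edges are closed, and then [isolated] says that [f] joins two
    clusters. *)
Lemma star_step (R : realType) g L (f : edge d) w : f \in box g L ->
  \sum_(x <- L) (closed_all R (star g x) (upd w f false)
                 - closed_all R (star g x) (upd w f true)) <= 2 * (~~ cn g L f w)%:R.
Proof.
move=> fb; set N : R := (~~ cn g L f w)%:R.
have N0 : 0 <= N by rewrite ler0n.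
have cnt p : \sum_(x <- L) (x == p)%:R <= 1 :> R.
  rewrite -natr_sum -[1]/(1%:R) ler_nat.
  under eq_bigr do rewrite -[nat_of_bool _]/(if _ then 1%N else 0%N).
  by rewrite -big_mkcond sum1_count (count_uniq_mem _ (fset_uniq L)) leq_b1.
apply: (@le_trans _ _ (\sum_(x <- L) ((x == pt1 f)%:R + (x == pt2 f)%:R) * N)); last first.
  rewrite -mulr_suml ler_wpM2r // big_split /= -[2]/(1 + 1).
  exact: lerD.
rewrite big_seq [leRHS]big_seq; apply: ler_sum => x xL.
have [fs|fs] := boolP (f \in star g x); last first.
  by rewrite !closed_all_upd // subrr mulr_ge0 // addr_ge0 // ler0n.
have /andP[J0 _] := closed_all01 R (star g x) (upd w f true).
have /andP[_ J1] := closed_all01 R (star g x) (upd w f false).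
apply: (@le_trans _ _ N); last first.
  rewrite ler_peMl // -natrD -[1]/(1%:R) ler_nat.
  by case/orP: (star_pt fs) => ->; rewrite ?leq_addl ?leq_addr.
have [h|h] := boolP (all (fun f => ~~ w f) (rem f (star g x))).
  by rewrite /N (isolated xL fs h) /=; lra.
suff -> : closed_all R (star g x) (upd w f false) = 0 by lra.
case/allPn: h => e er; rewrite negbK => we.
have es : e \in star g x := mem_rem er.
have ef : e != f by move: er; rewrite mem_rem_uniq ?star_uniq // inE => /andP[].
by rewrite /closed_all (big_rem e es) /= /upd (negbTE ef) we mul0r.
Qed.

(** An endpoint outside [L] is left out because its ghost edge is always open by the wiring. *)
Definition ghost_ends L (e : edge d) : seq (edge d) :=
  if e is inl i then [seq inr x | x <- [:: i.1; i.1 + unit_vec i.2] & x \in L] else [::].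

Lemma ghost_ends_uniq L e : uniq (ghost_ends L e).
Proof.
case: e => // e; rewrite /ghost_ends map_inj_uniq; last by move=> ? ? [].
rewrite filter_uniq //= inE andbT eq_sym -subr_eq0 addrC addKr.
exact: unit_vec_neq0.
Qed.

Lemma ghost_ends_sub L e : {subset ghost_ends L e <= exts L}.
Proof.
case: e => // e x /mapP[y]; rewrite mem_filter => /andP[yL _] ->.
by rewrite mem_exts_inr.
Qed.

Lemma ghost_ends_size L e : (size (ghost_ends L e) <= 2)%N.
Proof. by case: e => // e; rewrite /ghost_ends size_map size_filter (leq_trans (count_size _ _)). Qed.

Lemma ghost_ends_cn L e w : e \in ints L -> all w (ghost_ends L e) -> cn true L e w.
Proof.
case: e => [i|x]; last by rewrite mem_ints_inr.
move=> _ /allP h; apply/asboolP => /=.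
have H y : y \in [:: i.1; i.1 + unit_vec i.2] ->
   open_cluster (@ends d) (upd (wire true L w) (inl i) false) (Some y) None.
  move=> yi; apply: (@oc_edge _ _ (@ends d) _ (inr y)); rewrite /upd /=.
  have [yL|//] := boolP (y \in L); rewrite /= h //.
  by apply: map_f; rewrite mem_filter yL.
apply: (oc_trans (H i.1 _)); first by rewrite inE eqxx.
by apply: oc_sym; apply: H; rewrite !inE eqxx orbT.
Qed.

Lemma cn0_cn L e w w' : {in predC (mem (exts L)), w' =1 w} -> cn false L e w -> cn true L e w'.
Proof.
move=> ww' /asboolP h; apply/asboolP; apply: oc_le h; apply: lec_upd => // -[i|x] /=.
  by rewrite ww' //= inE /= mem_exts_inl.
by case: (x \in L).
Qed.

End Box.

Definition cyl (E : eqType) (l : seq E) (eta : E -> bool) : set (E -> bool) :=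
  [set w : E -> bool | {in l, w =1 eta}].

Section CylinderMeasurable.
Variable E : eqType.

Lemma measurable_edge (e : E) (b : bool) : measurable ([set w : E -> bool | w e = b] : set (config E)).
Proof. by apply: sub_sigma_algebra; exists e, b. Qed.

Lemma cyl_nil (eta : E -> bool) : cyl [::] eta = setT.
Proof. by apply/seteqP; split. Qed.

Lemma cyl_cons (e : E) l (eta : E -> bool) : cyl (e :: l) eta = [set w : E -> bool | w e = eta e] `&` cyl l eta.
Proof.
apply/seteqP; split=> w /=.
  by move=> h; split; [apply: h; rewrite inE eqxx|move=> x xl; apply: h; rewrite inE xl orbT].
by move=> [we h] x; rewrite inE => /orP[/eqP ->|/h].
Qed.

Lemma measurable_cyl (l : seq E) (eta : E -> bool) : measurable (cyl l eta : set (config E)).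
Proof.
elim: l => [|e l IH]; first by rewrite cyl_nil.
by rewrite cyl_cons; apply: measurableI => //; exact: measurable_edge.
Qed.

Lemma cyl_split (e : E) l (eta : E -> bool) : e \notin l ->
  cyl l eta = cyl (e :: l) (upd eta e false) `|` cyl (e :: l) (upd eta e true).
Proof.
move=> el; have H b w : cyl (e :: l) (upd eta e b) w <-> w e = b /\ cyl l eta w.
  rewrite cyl_cons; split=> -[/=]; rewrite upd_same => -> h; split=> // x xl.
    by rewrite h // /upd; case: eqP => // xe; rewrite -xe xl in el.
  by rewrite h // /upd; case: eqP => // xe; rewrite -xe xl in el.
apply/seteqP; split=> w; last by move=> [/H[]|/H[]].
by move=> h; case E1 : (w e); [right|left]; apply/H.
Qed.

Lemma cyl_disj (e : E) l (eta : E -> bool) :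
  cyl (e :: l) (upd eta e false) `&` cyl (e :: l) (upd eta e true) = set0.
Proof.
apply/seteqP; split=> // w [h1 h2].
have := h1 e (mem_head _ _); have := h2 e (mem_head _ _); rewrite !upd_same => ->.
by [].
Qed.

End CylinderMeasurable.

(** * Construction of infinite-volume measures *)

Section Extension.
Local Notation pickle := choice.pickle.
Local Notation unpickle := choice.unpickle.
Variables (R : realType) (E : countType) (p : seq E -> (E -> bool) -> R).
Hypothesis p_nil : forall eta, p [::] eta = 1.
Hypothesis p_ge0 : forall l eta, 0 <= p l eta.
Hypothesis p_local : forall l eta eta', {in l, eta =1 eta'} -> p l eta = p l eta'.
Hypothesis p_mem : forall (l l' : seq E) eta, l =i l' -> p l eta = p l' eta.
Hypothesis p_split : forall l e eta, e \notin l ->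
  p l eta = p (e :: l) (upd eta e false) + p (e :: l) (upd eta e true).

(** The edges of code less than [n]. The test on [pickle e] discards integers that decode to an edge
    without being its code. *)
Fixpoint stage (n : nat) : seq E :=
  if n is n'.+1 then (if unpickle n' is Some e then
    (if pickle e == n' then e :: stage n' else stage n') else stage n') else [::].

Lemma mem_stage n e : (e \in stage n) = (pickle e < n)%N.
Proof.
elim: n => [|n IH] //=.
case E1 : (unpickle n) => [e'|].
  case: eqP => pe'.
    rewrite inE IH ltnS [in RHS]leq_eqVlt; congr (_ || _).
    apply/eqP/eqP => [->//|h].
    by apply: (pcan_inj choice.pickleK); rewrite pe'.
  rewrite IH ltnS [in RHS]leq_eqVlt; case: eqP => //= h.
  by move: E1 pe'; rewrite -h choice.pickleK => -[->].
rewrite IH ltnS [in RHS]leq_eqVlt; case: eqP => //= h.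
by move: E1; rewrite -h choice.pickleK.
Qed.

Lemma stage_uniq n : uniq (stage n).
Proof.
elim: n => //= n IH; case: unpickle => [e|] //; case: eqP => //= h.
by rewrite IH andbT mem_stage h ltnn.
Qed.

(* The quantile transform: the interval [0, 1[ is cut into consecutive
   intervals of lengths [p (stage n) eta], each refined at the next stage. *)
Fixpoint left_end (n : nat) (eta : E -> bool) : R :=
  if n is n'.+1 then (if unpickle n' is Some e then
    (if (pickle e == n') && eta e then left_end n' eta + p (e :: stage n') (upd eta e false)
     else left_end n' eta) else left_end n' eta) else 0.

Lemma left_end_local n eta eta' : {in stage n, eta =1 eta'} -> left_end n eta = left_end n eta'.
Proof.
elim: n => //= n IH; case E1: (unpickle n) => [e|] //; case: eqP => //= he h.
have hn : {in stage n, eta =1 eta'} by move=> x xl; apply: h; rewrite inE xl orbT.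
rewrite (IH hn) h ?mem_head //; case: (eta' e) => //; congr (_ + _).
apply: p_local => x; rewrite inE /upd; case: eqP => //= _; exact: hn.
Qed.

Fixpoint code (n : nat) (x : R) : E -> bool :=
  if n is n'.+1 then (if unpickle n' is Some e then
    (if pickle e == n' then
      upd (code n' x) e (left_end n' (code n' x) + p (e :: stage n') (upd (code n' x) e false) <= x)
     else code n' x) else code n' x)
  else fun=> false.

Definition quantile (x : R) (e : E) : bool := code (pickle e).+1 x e.

Lemma codeS n x e : e \in stage n -> code n.+1 x e = code n x e.
Proof.
move=> en /=; case: unpickle => [e'|] //; case: eqP => // h.
rewrite /upd; case: eqP => // ee.
by move: en; rewrite mem_stage ee h ltnn.
Qed.

Lemma code_quantile n x e : e \in stage n -> code n x e = quantile x e.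
Proof.
elim: n => // n IH; have [en|en] := boolP (e \in stage n); first by rewrite codeS // IH.
rewrite mem_stage ltnS leq_eqVlt -mem_stage (negbTE en) orbF => /eqP <-.
by [].
Qed.

Lemma quantile_interval n x eta : 0 <= x < 1 ->
  {in stage n, quantile x =1 eta} <-> left_end n eta <= x < left_end n eta + p (stage n) eta.
Proof.
move=> x01; elim: n => [|n IH] /=; first by rewrite p_nil add0r.
case E1 : (unpickle n) => [e|] //; case: eqP => // he.
have en : e \notin stage n by rewrite mem_stage he ltnn.
have := p_split eta en.
set p0 := p _ (upd eta e false); set p1 := p _ (upd eta e true) => pe.
have p00 : 0 <= p0 by apply: p_ge0.
have p10 : 0 <= p1 by apply: p_ge0.
have pE : p (e :: stage n) eta = if eta e then p1 else p0.
  by rewrite /p1 /p0; case E2: (eta e); rewrite -E2 upd_id.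
have split : {in e :: stage n, quantile x =1 eta} <-> {in stage n, quantile x =1 eta} /\ quantile x e = eta e.
  split=> [h|[h he']].
    by split; [move=> y yl; apply: h; rewrite inE yl orbT|apply: h; rewrite mem_head].
  by move=> y; rewrite inE => /orP[/eqP ->|/h].
rewrite split /= pE.
have qe : {in stage n, quantile x =1 eta} -> quantile x e = (left_end n eta + p0 <= x).
  move=> h; rewrite -(@code_quantile n.+1); last by rewrite mem_stage he ltnSn.
  rewrite /= E1 he eqxx upd_same.
  have hc : {in stage n, code n x =1 eta} by move=> y yl; rewrite code_quantile // h.
  rewrite (left_end_local hc); congr (_ + _ <= _); apply: p_local => y.
  by rewrite inE /upd; case: eqP => //= _; apply: hc.
split=> [[h]|].
  rewrite qe // => qeq; have := IH.1 h; rewrite pe => /andP[h1 h2].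
  case: (eta e) qeq => /=.
    by move=> ->/=; lra.
  by move/negbT; rewrite -ltNge h1 /= => ->.
move=> h; have h' : {in stage n, quantile x =1 eta}.
  apply: IH.2; rewrite pe; case: (eta e) h => /= /andP[]; lra.
split=> //; rewrite qe //; case: (eta e) h => /= /andP[] h1 h2.
  by rewrite h1.
by apply/negbTE; rewrite -ltNge.
Qed.

Lemma left_end_bounds n eta : 0 <= left_end n eta /\ left_end n eta + p (stage n) eta <= 1.
Proof.
elim: n => [|n [IH1 IH2]] /=; first by rewrite p_nil add0r.
case E1 : (unpickle n) => [e|] //; case: eqP => // he.
have en : e \notin stage n by rewrite mem_stage he ltnn.
have := p_split eta en; have := p_ge0 (e :: stage n) (upd eta e false).
have := p_ge0 (e :: stage n) (upd eta e true).
by case E2 : (eta e) => /=; have := upd_id eta e; rewrite E2 => -> ? ? ?; split; lra.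
Qed.

Let D : set R := `[0, 1[%classic.
Let S l eta : set R := D `&` quantile @^-1` (cyl l eta).

(** [r] lists the edges that complete [l] to a stage. Splitting the cylinder over their states ends
    with full-stage cylinders, whose preimages are intervals. *)
Lemma quantile_cyl r l n eta : uniq (r ++ l) -> r ++ l =i stage n ->
  measurable (S l eta) /\ lebesgue_measure (S l eta) = (p l eta)%:E.
Proof.
elim: r l eta => [|e r IH] l eta /=.
  move=> ul lstage.
  have -> : S l eta = `[left_end n eta, left_end n eta + p (stage n) eta[%classic `&` D.
    apply/seteqP; split=> x; rewrite /S /D /= !in_itv /=.
      move=> [x01 h]; split=> //; apply/(quantile_interval _ _ x01) => y.
      by rewrite -lstage => /h.
    move=> [h x01]; split=> //; move/(quantile_interval _ _ x01): h => h y.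
    by rewrite lstage => /h.
  rewrite (_ : p l eta = p (stage n) eta); last exact: p_mem.
  have := left_end_bounds n eta; set a := left_end n eta; set b := p _ eta => -[a0 ab].
  have b0 : 0 <= b by apply: p_ge0.
  have -> : `[a, a + b[%classic `&` D = `[a, a + b[%classic.
    apply/seteqP; split=> x; rewrite /D /= !in_itv /=; first by case.
    by move=> /andP[h1 h2]; rewrite h1 h2; split=> //; apply/andP; split; lra.
  split; first exact: measurable_itv.
  rewrite lebesgue_measure_itv /= lte_fin; case: ltP => h; first by congr (_%:E); ring.
  by congr (_%:E); lra.
move=> /andP[er url] rstage.
have el : e \notin l by move: er; rewrite mem_cat negb_or => /andP[].
have perm : perm_eq (r ++ e :: l) (e :: r ++ l) by rewrite perm_catC /= perm_cons perm_catC.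
have url' : uniq (r ++ e :: l) by rewrite (perm_uniq perm) /= er.
have rstage' : r ++ e :: l =i stage n by move=> x; rewrite (perm_mem perm) rstage.
have SE : S l eta = S (e :: l) (upd eta e false) `|` S (e :: l) (upd eta e true).
  by rewrite /S (cyl_split _ el) preimage_setU setIUr.
have [m0 e0] := IH (e :: l) (upd eta e false) url' rstage'.
have [m1 e1] := IH (e :: l) (upd eta e true) url' rstage'.
split; first by rewrite SE; apply: measurableU.
transitivity (lebesgue_measure (S (e :: l) (upd eta e false))
   + lebesgue_measure (S (e :: l) (upd eta e true)))%E; last first.
  by rewrite e0 e1 -EFinD -p_split.
rewrite SE; apply: measureU => //.
rewrite /S setIACA -[X in _ `&` X]preimage_setI cyl_disj preimage_set0 setI0 //.
Qed.

Lemma ext_cyl l : exists r n, uniq (r ++ undup l) /\ r ++ undup l =i stage n.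
Proof.
have [n stage_n] : exists n, forall x, x \in l -> (pickle x < n)%N.
  by exists (\max_(e <- l) pickle e).+1 => x xl; rewrite ltnS; apply: leq_bigmax_seq.
exists [seq e <- stage n | e \notin l], n; split.
  rewrite cat_uniq filter_uniq ?stage_uniq // undup_uniq andbT /=.
  by apply/hasPn => x; rewrite mem_undup mem_filter => ->.
move=> x; rewrite mem_cat mem_filter mem_undup.
have [xl|] := boolP (x \in l); last by rewrite orbF.
by rewrite mem_stage stage_n.
Qed.

Lemma cyl_undup (l : seq E) eta : cyl l eta = cyl (undup l) eta.
Proof. by apply/seteqP; split=> w h x; [rewrite mem_undup => /h|rewrite -mem_undup => /h]. Qed.

Lemma quantile_cylE l eta :
  measurable (S l eta) /\ lebesgue_measure (S l eta) = (p l eta)%:E.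
Proof.
have [r [n [ur rn]]] := ext_cyl l.
rewrite /S cyl_undup (_ : p l eta = p (undup l) eta); last first.
  by apply: p_mem => x; rewrite mem_undup.
exact: quantile_cyl ur rn.
Qed.

Lemma exists_measure : exists P : probability (config E) R,
  forall l eta, P (cyl l eta) = (p l eta)%:E.
Proof.
(* Outside [[0, 1[] the map takes a dummy value; this set is null for the restricted measure, and
   only measurability matters there. *)
have mD : measurable D by exact: measurable_itv.
pose T (x : measurableTypeR R) : config E := if x \in D then quantile x else fun=> false.
have mT : measurable_fun setT T.
  apply: (@measurability _ _ _ (config E) _ _ (@cylinders E)) => //.
  move=> _ [B [e [b ->]] <-]; rewrite setTI.
  have -> : T @^-1` [set w : E -> bool | w e = b] =
    S [:: e] (fun=> b) `|` (if b then set0 else ~` D).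
    apply/seteqP; split=> x; rewrite /T /= /S /cyl /=.
      case: ifPn => [/set_mem xD h|/negP xD <-].
        by left; split=> // y; rewrite inE => /eqP ->.
      by right => /= h; apply: xD; apply/mem_set.
    case=> [[xD h]|].
      by rewrite (mem_set xD) h // mem_head.
    case: (b) => //= xD; rewrite memNset //.
  apply: measurableU; first by case: (quantile_cylE [:: e] (fun=> b)).
  by case: (b); [exact: measurable0|exact: measurableC].
pose X : {mfun (measurableTypeR R) >-> config E} := HB.pack T (isMeasurableFun.Build _ _ _ _ T mT).
(* [D] has mass 1, so the normalisation divides by 1 and never falls back on its default [point]. *)
pose U := mnormalize (mrestr (@lebesgue_measure R) mD) point.
exists (distribution (U : probability _ R) X) => l eta.
have D1 : lebesgue_measure D = 1%:E by rewrite /D lebesgue_measure_itv /= lte01 oppr0 adde0.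
rewrite /distribution /pushforward /U /= /mnormalize /= /mrestr setTI D1 /=.
rewrite onee_eq0 /= invr1 mule1.
have -> : (X @^-1` cyl l eta) `&` D = S l eta.
  apply/seteqP; split=> x; rewrite /S /X /= /T.
    by move=> [+ xD]; rewrite mem_set.
  by move=> [xD h]; split=> //; rewrite mem_set.
by case: (quantile_cylE l eta).
Qed.

End Extension.

(** * Events depending on finitely many edges *)

Section LocalEvents.
Variables (E : eqType) (R : realType).

Definition local_event (l : seq E) (A : set (E -> bool)) :=
  forall w w', {in l, w =1 w'} -> A w -> A w'.

Definition ind (A : set (E -> bool)) (w : E -> bool) : R := (`[< A w >])%:R.

Lemma cyl_mem (l l' : seq E) (eta : E -> bool) : l =i l' -> cyl l eta = cyl l' eta.
Proof. by move=> ll; apply/seteqP; split=> w h x; [rewrite -ll => /h|rewrite ll => /h]. Qed.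

Lemma local_cyl (l : seq E) A eta : local_event l A ->
  A `&` cyl l eta = if `[< A eta >] then cyl l eta else set0.
Proof.
move=> lA; case: asboolP => h; apply/seteqP; split=> w //=.
- by case.
- by move=> hw; split=> //; apply: lA h => x xl; rewrite hw.
- by move=> [Aw hw]; apply: h; apply: lA Aw.
Qed.

(** Stated for a real set function that is additive when cylinders are split, so as to cover both
    probabilities and finite-volume means. *)
Lemma additive_local (nu : set (E -> bool) -> R) (l : seq E) (A : set (E -> bool)) w0 :
  nu set0 = 0 ->
  (forall m eta e, e \notin m ->
    nu (A `&` cyl m eta) = nu (A `&` cyl (e :: m) (upd eta e false))
                         + nu (A `&` cyl (e :: m) (upd eta e true))) ->
  uniq l -> local_event l A ->
  nu A = sumc l (fun eta => ind A eta * nu (cyl l eta)) w0.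
Proof.
move=> nu0 nuS ul lA.
suff H l1 m eta : uniq (l1 ++ m) -> l1 ++ m =i l ->
    nu (A `&` cyl m eta) = sumc l1 (fun eta => ind A eta * nu (cyl l eta)) eta.
  by rewrite -(H l [::]) ?cats0 // cyl_nil setIT.
elim: l1 m eta => [|e l1 IH] m eta /=.
  move=> _ ml; rewrite (cyl_mem _ ml) local_cyl // /ind.
  by case: asboolP => _; rewrite ?nu0 ?mul1r ?mul0r.
move=> /andP[]; rewrite mem_cat negb_or => /andP[el1 em] ul1m eq.
have perm : perm_eq (l1 ++ e :: m) (e :: l1 ++ m) by rewrite perm_catC /= perm_cons perm_catC.
have u' : uniq (l1 ++ e :: m) by rewrite (perm_uniq perm) /= mem_cat negb_or el1 em.
have eq' : l1 ++ e :: m =i l by move=> x; rewrite (perm_mem perm) eq.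
by rewrite (nuS _ _ _ em) !IH.
Qed.

Lemma measurable_local l (A : set (E -> bool)) : uniq l -> local_event l A ->
  measurable (A : set (config E)).
Proof.
move=> ul lA.
suff H l1 m eta : uniq (l1 ++ m) -> l1 ++ m =i l ->
    measurable (A `&` cyl m eta : set (config E)).
  by rewrite -[A]setIT -(@cyl_nil _ (fun=> true)); apply: (H l); rewrite ?cats0.
elim: l1 m eta => [|e l1 IH] m eta /=.
  move=> _ ml; rewrite (cyl_mem _ ml) local_cyl //.
  case: asboolP => _; [exact: measurable_cyl|exact: measurable0].
move=> /andP[]; rewrite mem_cat negb_or => /andP[el1 em] ul1m eq.
have perm : perm_eq (l1 ++ e :: m) (e :: l1 ++ m) by rewrite perm_catC /= perm_cons perm_catC.
have u' : uniq (l1 ++ e :: m) by rewrite (perm_uniq perm) /= mem_cat negb_or el1 em.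
have eq' : l1 ++ e :: m =i l by move=> x; rewrite (perm_mem perm) eq.
by rewrite (cyl_split _ em) setIUr; apply: measurableU; apply: IH.
Qed.

Lemma probability_local (P : probability (config E) R) l (A : set (E -> bool)) w0 :
  uniq l -> local_event l A ->
  P A = (sumc l (fun eta => ind A eta * fine (P (cyl l eta))) w0)%:E.
Proof.
move=> ul lA.
have mA := measurable_local ul lA.
have finP (B : set (config E)) : measurable B -> P B \is a fin_num by exact: fin_num_measure.
rewrite -[LHS]fineK ?finP //; congr (_%:E).
apply: (additive_local (nu := fun B : set (E -> bool) => fine (P B)) w0) => //.
  by rewrite measure0.
move=> m eta e em.
have m0 : measurable (A `&` cyl (e :: m) (upd eta e false) : set (config E)).
  by apply: measurableI => //; exact: measurable_cyl.
have m1 : measurable (A `&` cyl (e :: m) (upd eta e true) : set (config E)).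
  by apply: measurableI => //; exact: measurable_cyl.
rewrite -fineD ?finP // (cyl_split _ em) setIUr measureU //.
by rewrite setIACA cyl_disj setI0.
Qed.

End LocalEvents.

Lemma cvg_sumc (E : eqType) (R : realType) (T : Type) (F : set_system T) (FF : Filter F)
    (l : seq E) (f : T -> (E -> bool) -> R) (g : (E -> bool) -> R) w :
  (forall eta, f x eta @[x --> F] --> g eta) ->
  sumc l (f x) w @[x --> F] --> sumc l g w.
Proof.
move=> h; elim: l w => [|e l IH] w /=; first exact: h.
exact: cvgD.
Qed.

Definition ext_true (E : choiceType) (F : {fset E}) (w : {ffun F -> bool}) : E -> bool :=
  fun e => if insub e is Some e' then w e' else true.

Lemma sum_ffun_sumc (E : choiceType) (R : realType) (F : {fset E}) (f : (E -> bool) -> R)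
    (l : seq E) : uniq l -> l =i F ->
  \sum_(w : {ffun F -> bool}) f (ext_true w) = sumc l f (fun=> true).
Proof.
move=> ul lF.
(* Only the edges of [m] are free and the others are frozen at [w0], which follows the recursion of
   [sumc]. *)
suff H m (w0 : {ffun F -> bool}) : uniq m -> {subset m <= F} ->
    \sum_(w : {ffun F -> bool} | [forall x : F, (val x \notin m) ==> (w x == w0 x)]) f (ext_true w)
    = sumc m f (ext_true w0).
  have := H l [ffun=> true] ul; rewrite (_ : ext_true [ffun=> true] = fun=> true); last first.
    by apply/funext => e; rewrite /ext_true; case: insubP => // u _ _; rewrite ffunE.
  move=> <-; last by move=> x; rewrite lF.
  apply: eq_bigl => w; symmetry; apply/forallP => x.
  by rewrite lF (valP x).
elim: m w0 => [|e m IH] w0 /=.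
  move=> _ _; rewrite (big_pred1 w0) // => w; apply/forallP/eqP => [h|-> x]; last by rewrite eqxx.
  by apply/ffunP => x; apply/eqP; have := h x.
move=> /andP[em um] sub.
have eF : (e \in F)%fset by apply: sub; rewrite mem_head.
have subm : {subset m <= F} by move=> x xm; apply: sub; rewrite inE xm orbT.
pose e' : F := [` eF]%fset.
pose wb (b : bool) : {ffun F -> bool} := [ffun x => if x == e' then b else w0 x].
have ext_wb b : upd (ext_true w0) e b = ext_true (wb b).
  apply/funext => x; rewrite /upd /ext_true; case: insubP => [u ux xu|xF].
    rewrite ffunE -xu; case: eqP => [ue|ne].
      by rewrite (_ : u == e') //; apply/eqP/val_inj.
    by case: eqP => // ue; case: ne; rewrite ue.
  by case: eqP => // xe; rewrite xe eF in xF.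
rewrite !ext_wb -!IH // (bigID (fun w : {ffun F -> bool} => w e')) /= addrC.
have sel b : (fun w : {ffun F -> bool} => [forall x : F, (val x \notin e :: m) ==> (w x == w0 x)]
     && (w e' == b)) =1 (fun w => [forall x : F, (val x \notin m) ==> (w x == wb b x)]).
  move=> w; apply/andP/forallP.
    move=> [/forallP h /eqP we] x; apply/implyP => xm; rewrite ffunE.
    have [->|xe] := eqVneq x e'; first by rewrite we.
    apply: (implyP (h x)); rewrite inE negb_or xm andbT.
    by apply: contraNneq xe => h'; apply/eqP/val_inj.
  move=> h; split.
    apply/forallP => x; apply/implyP; rewrite inE negb_or => /andP[xe xm].
    have := implyP (h x) xm; rewrite ffunE; have [xe'|//] := eqVneq x e'.
    by rewrite xe' eqxx in xe.
  by have := implyP (h e') em; rewrite ffunE eqxx.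
congr (_ + _); [rewrite -(eq_bigl _ _ (sel false))|rewrite -(eq_bigl _ _ (sel true))];
  by apply: eq_bigl => w; case: (w e').
Qed.

Section FiniteVolume.
Variables (R : realType) (d : nat).
Implicit Types (L : {fset zlattice d}) (w : edge d -> bool) (X : (edge d -> bool) -> R).

Definition edge_wgt (p h : R) (e : edge d) (b : bool) : R :=
  let r := if internal e then p else h in if b then r else 1 - r.

Definition rc_wgt (p h s : R) L := wgt (box true L) (wired_nclusters true L) (edge_wgt p h) s.

Definition rc_mean (p h s : R) L X : R :=
  sumc (box true L) (fun w => X w * rc_wgt p h s L w) (fun=> true) /
  sumc (box true L) (rc_wgt p h s L) (fun=> true).

Lemma wire_true L w : {in predC (mem (box true L)), w =1 fun=> true} -> wire true L w = w.
Proof.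
move=> h; apply/funext => -[i|x] /=.
  case: (boolP (i \in _)) => //= iL; apply: esym; apply: h.
  by rewrite !inE /= mem_cat mem_ints_inl mem_exts_inl orbF.
case: (boolP (x \in _)) => //= iL; apply: esym; apply: h.
by rewrite !inE /= mem_cat mem_ints_inr mem_exts_inr.
Qed.

Lemma rc_weightE (q : nat) (beta : \bar R) (H : R) L w :
  {in predC (mem (box true L)), w =1 fun=> true} ->
  rc_weight q beta H L w = rc_wgt (1 - closed_prob beta) (1 - closed_prob H%:E) q%:R L w.
Proof.
move=> hw; rewrite /rc_weight /rc_wgt /wgt /wired_nclusters wire_true // -mulrA; congr (_ * _).
rewrite /cprod /box big_cat !big_map; congr (_ * _); apply: eq_bigr => e _; rewrite /edge_wgt /=.
  by case: (w _); rewrite /= ?expr0 ?expr1 ?mulr1 ?mul1r // subKr.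
by case: (w _); rewrite /= ?expr0 ?expr1 ?mulr1 ?mul1r // subKr.
Qed.

Lemma rc_wiredE (q : nat) (beta : \bar R) (H : R) L A :
  rc_wired q beta H L A = rc_mean (1 - closed_prob beta) (1 - closed_prob H%:E) q%:R L (ind R A).
Proof.
have ub : uniq (box true L) by exact: box_uniq.
have mb : box true L =i box_edges L by move=> e; rewrite mem_box.
rewrite /rc_wired /rc_mean; congr (_ / _).
  rewrite big_mkcond /=.
  rewrite -(eq_sumc (f := fun w => ind R A w * rc_weight q beta H L w)); last first.
    by move=> w hw; rewrite rc_weightE.
  rewrite -(sum_ffun_sumc _ ub mb); apply: eq_bigr => w _; rewrite /ind.
  by case: ifP => _; rewrite ?mul1r ?mul0r.
rewrite -(eq_sumc (f := fun w => rc_weight q beta H L w)); last first.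
  by move=> w hw; rewrite rc_weightE.
by rewrite -(sum_ffun_sumc _ ub mb); apply: eq_bigr.
Qed.

End FiniteVolume.

Lemma cvg_antitone_net (R : realType) (K : choiceType) (f : {fset K} -> R) :
  (forall L, 0 <= f L) -> (forall L L', (L `<=` L')%fset -> f L' <= f L) ->
  f L @[L --> totally] --> inf (range f).
Proof.
move=> f0 fa.
have hasinf : has_inf (range f).
  by split; [exists (f fset0), fset0|exists 0 => _ [L _ <-]].
apply/cvgrPdist_le => e e0.
have [_ [L0 _ <-] hL0] := inf_adherent e0 hasinf.
exists L0 => //= L /= L0L.
have h1 : inf (range f) <= f L by apply: ge_inf; [case: hasinf|exists L].
have := fa _ _ L0L => h2.
by rewrite ler0_norm ?subr_le0 // opprB lerBlDl; apply: (le_trans h2); apply: ltW.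
Qed.

Section SumcMore.
Variables (E : choiceType) (R : realType).
Implicit Types (w : E -> bool) (l r : seq E) (f : (E -> bool) -> R).

Lemma eq_sumc_mem l l' f : uniq l -> uniq l' -> l =i l' ->
  sumc l f (fun=> true) = sumc l' f (fun=> true).
Proof.
move=> ul ul' ll.
have lF : l =i [fset x in l]%fset by move=> x; rewrite inE.
have lF' : l' =i [fset x in l]%fset by move=> x; rewrite inE ll.
by rewrite -(sum_ffun_sumc _ ul lF) -(sum_ffun_sumc _ ul' lF').
Qed.

Lemma sumc_open r f w : uniq r -> {in r, forall e, w e} ->
  sumc r (fun w => f w * open_all R r w) w = f w.
Proof.
move=> + wr; suff H q : uniq r -> {in r, forall e, w e} ->
    sumc r (fun w => f w * (q w * open_all R r w)) w = f w * q w.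
  move=> ur; rewrite -[RHS]mulr1 -(H (fun=> 1)) //.
  by apply: eq_sumcT => v; rewrite mul1r.
elim: r q {wr} => [|e r IH] q /=; first by rewrite /open_all big_nil mulr1.
move=> /andP[er ur] wr.
rewrite [X in X + _](_ : _ = 0) ?add0r; last first.
  rewrite (eq_sumc (g := fun=> 0 * 0)) ?sumcZ ?mul0r // => v hv.
  rewrite /open_all big_cons hv; last by rewrite inE.
  by rewrite upd_same !mul0r !mulr0.
have we : upd w e true = w by rewrite -{2}(upd_id w e) (wr e) ?mem_head.
rewrite we -(IH q) //; last by move=> x xr; apply: wr; rewrite inE xr orbT.
apply: eq_sumc => v hv; rewrite /open_all big_cons hv ?inE //.
by rewrite (wr e) ?mem_head // mul1r.
Qed.

Lemma sumc_gt0_ex l f w w1 : (forall w, 0 <= f w) -> 0 < f w1 ->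
  {in predC (mem l), w1 =1 w} -> 0 < sumc l f w.
Proof.
move=> f0 f1; elim: l w => [|e l IH] w h /=.
  by rewrite (_ : w = w1) //; apply/funext => x; rewrite h.
have [we|we] := boolP (w1 e).
  apply: ltr_wpDl; first exact: sumc_ge0.
  apply: IH => x xl; rewrite /upd; case: eqP => [->|/eqP xe]; first by rewrite we.
  by apply: h; rewrite !inE negb_or xe.
apply: ltr_wpDr; first exact: sumc_ge0.
apply: IH => x xl; rewrite /upd; case: eqP => [->|/eqP xe]; first by rewrite (negbTE we).
by apply: h; rewrite !inE negb_or xe.
Qed.

End SumcMore.

Section Limits.
Variables (R : realType) (d : nat).
Implicit Types (L : {fset zlattice d}) (w : edge d -> bool) (X : (edge d -> bool) -> R).

Section WiredMeasure.
Variables (p h s : R).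
Hypotheses (p01 : 0 <= p <= 1) (h01 : 0 <= h <= 1) (s1 : 1 <= s).

Lemma edge_wgt_ge0 (e : edge d) b : 0 <= edge_wgt p h e b.
Proof.
case/andP: p01 => p0 p1; case/andP: h01 => h0 h1.
by rewrite /edge_wgt; case: b; case: (internal e) => //=; rewrite subr_ge0.
Qed.

Lemma rc_wgt_ge0 L w : 0 <= rc_wgt p h s L w.
Proof. by apply: wgt_ge0; [exact: edge_wgt_ge0|rewrite (le_trans ler01)]. Qed.

Lemma rc_partition_gt0 L : 0 < sumc (box true L) (rc_wgt p h s L) (fun=> true).
Proof.
(* Some weights vanish at zero field or infinite inverse temperature. Inside the box this
   configuration opens exactly the edges of positive open weight; the others have closed weight
   1. *)
pose w1 (e : edge d) := (e \notin box true L) || (0 < (if internal e then p else h)).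
have /andP[p0 p1] := p01; have /andP[h0 h1] := h01.
apply: (@sumc_gt0_ex _ _ _ _ _ w1); first exact: rc_wgt_ge0.
  apply: mulr_gt0; first by rewrite exprn_gt0 // (lt_le_trans ltr01).
  rewrite /cprod big_seq; apply: prodr_gt0 => e el.
  rewrite /w1 el /= /edge_wgt; set r := if internal e then p else h.
  have r0 : 0 <= r by rewrite /r; case: ifP.
  by case: (ltP 0 r) => // h'; rewrite (_ : r = 0) ?subr0 //; apply/eqP; rewrite eq_le h'.
by move=> e; rewrite !inE /= /w1 => ->.
Qed.

(** With the extra edges open, the vertices of [L'] outside [L] are joined to the ghost, so they
    contribute no counted cluster. *)
Lemma wired_nclusters_sub L L' w : (L `<=` L')%fset ->
  {in box true L', forall e, e \notin box true L -> w e} -> wired_nclusters true L w = wired_nclusters true L' w.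
Proof.
move=> LL wt.
have bE L1 : box true L1 =i box_edges L1 by move=> e; rewrite mem_box.
have vE : wire true L w = wire true L' w.
  apply/funext => -[i|x] /=.
    have iE L1 : (i \in internal_edges L1) = (inl i \in box true L1).
      by rewrite /box mem_cat mem_ints_inl mem_exts_inl orbF.
    have sub : i \in internal_edges L -> i \in internal_edges L'.
      by rewrite !in_internal_edges => /orP[]/(fsubsetP LL) ->; rewrite ?orbT.
    have [iL|iL] := boolP (i \in internal_edges L); first by rewrite sub.
    have [iL'|//] := boolP (i \in internal_edges L').
    by rewrite /= wt // -iE.
  have xE L1 : (x \in L1) = (inr x \in box true L1).
    by rewrite /box mem_cat mem_ints_inr mem_exts_inr.
  have [xL|xL] := boolP (x \in L); first by rewrite (fsubsetP LL).
  have [xL'|//] := boolP (x \in L').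
  by rewrite /= wt // -xE.
rewrite /wired_nclusters -vE /nclusters; congr #|` _|%fset.
apply/fsetP => C; apply/clustersP/clustersP => -[x [xL xg CE]]; exists x; split=> //.
  exact: (fsubsetP LL).
by apply: contra_notT xg => xL'; apply: (@oc_outside _ L) => // y yL /=; rewrite yL.
Qed.

(** The measure of [L] is the measure of [L'] conditioned on the additional edges [r] being open,
    which raises increasing means by [holley]. *)
Lemma rc_mean_antitone L L' X : (L `<=` L')%fset -> (forall w, 0 <= X w) -> incr X ->
  rc_mean p h s L' X <= rc_mean p h s L X.
Proof.
move=> LL X0 Xi.
pose l := box true L; pose l' := box true L'.
have ul : uniq l by exact: box_uniq.
have ul' : uniq l' by exact: box_uniq.
have sub : {subset l <= l'}.
  move=> e; rewrite /l /l' /box !mem_cat => /orP[]; case: e => e; rewrite ?mem_ie //.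
    by rewrite !in_internal_edges => /orP[]/(fsubsetP LL) ->; rewrite ?orbT.
  by move=> /(fsubsetP LL) ->; rewrite orbT.
pose r := [seq e <- l' | e \notin l].
have ur : uniq r by rewrite filter_uniq.
have ulr : uniq (l ++ r).
  rewrite cat_uniq ul ur andbT /=; apply/hasPn => e.
  by rewrite mem_filter => /andP[].
have ml' : l' =i l ++ r.
  move=> e; rewrite [in RHS](mem_cat e l r) mem_filter; have [el|] //= := boolP (e \in l).
  by rewrite sub.
have perm : perm_eq l' (l ++ r) by apply: uniq_perm.
pose m2 w := rc_wgt p h s L w * open_all R r w.
have ext f : sumc l f (fun=> true) = sumc l' (fun w => f w * open_all R r w) (fun=> true).
  rewrite (eq_sumc_mem _ ul' ulr ml') (sumc_cat l r); apply: eq_sumc => w hw.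
  rewrite sumc_open //; move=> e; rewrite /r mem_filter => /andP[el _].
  by rewrite hw.
rewrite /rc_mean !ext -/l -/l' ler_pdivrMr ?rc_partition_gt0 // mulrAC ler_pdivlMr; last first.
  by rewrite -ext rc_partition_gt0.
rewrite [leRHS]mulrC.
rewrite (eq_sumcT l' (f := fun w => X w * rc_wgt p h s L w * open_all R r w)
   (g := fun w => X w * m2 w)); last by move=> w; rewrite /m2 mulrA.
apply: holley => //.
- by move=> w; apply: rc_wgt_ge0.
- by move=> w; rewrite mulr_ge0 ?open_all_ge0 ?rc_wgt_ge0.
move=> w w'; rewrite /m2 !open_allE.
have [/allP w'r|] := boolP (all w' r); last first.
  move=> _; rewrite /= mulr0 mulr0; apply: mulr_ge0; rewrite ?rc_wgt_ge0 // mulr_ge0 ?rc_wgt_ge0 ?ler0n //.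
have -> : all (joinc w w') r by apply/allP => e er; rewrite /joinc w'r ?orbT.
rewrite !mulr1.
have kE (v : edge d -> bool) : {in r, forall e, v e} -> wired_nclusters true L v = wired_nclusters true L' v.
  move=> vr; apply: wired_nclusters_sub => // e el' el; apply: vr.
  by rewrite mem_filter el.
have cE (v : edge d -> bool) : cprod (box true L') (edge_wgt p h) v = cprod l (edge_wgt p h) v * cprod r (edge_wgt p h) v.
  by rewrite /cprod (perm_big _ perm) big_cat.
rewrite /rc_wgt /wgt !cE !kE //; last by move=> e er; rewrite /joinc w'r ?orbT.
(* On [r] the configuration [w'] is open, so the meet coincides with [w] there and the factor over
   [r] is common to both sides. *)
have -> : cprod r (edge_wgt p h) (meetc w w') = cprod r (edge_wgt p h) w.
  by apply: eq_big_seq => e er; rewrite /meetc w'r // andbT.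
have kj := pow_meet_join (rc_sys true L') w w' s1 (lexx s).
have cj : cprod l (edge_wgt p h) w * cprod l (edge_wgt p h) w' <=
    cprod l (edge_wgt p h) (meetc w w') * cprod l (edge_wgt p h) (joinc w w').
  by apply: cprod_meet_join => [e b|e b|e _]; rewrite ?edge_wgt_ge0 // mulrC.
have cr0 : 0 <= cprod r (edge_wgt p h) w by rewrite prodr_ge0 // => e _; apply: edge_wgt_ge0.
have c0 (v : edge d -> bool) : 0 <= cprod l (edge_wgt p h) v by rewrite prodr_ge0 // => e _; apply: edge_wgt_ge0.
have s0 n : 0 <= s ^+ n by rewrite exprn_ge0 // (le_trans ler01).
rewrite -/l.
move: cr0; set C := cprod r (edge_wgt p h) w => cr0.
move: kj cj; set a1 := s ^+ _; set a2 := s ^+ _; set a3 := s ^+ _; set a4 := s ^+ _.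
set b1 := cprod _ _ w; set b2 := cprod _ _ w'; set b3 := cprod _ _ _; set b4 := cprod _ _ _.
move=> kj cj.
have -> : a1 * (b1 * C) * (a2 * b2) = (a1 * a2) * (b1 * b2) * C by ring.
have -> : a3 * (b3 * C) * (a4 * b4) = (a3 * a4) * (b3 * b4) * C by ring.
apply: ler_wpM2r => //; apply: ler_pM => //; rewrite mulr_ge0 //; try exact: s0; exact: c0.
Qed.

Lemma rc_mean_ge0 L X : (forall w, 0 <= X w) -> 0 <= rc_mean p h s L X.
Proof.
move=> X0; rewrite /rc_mean divr_ge0 ?(ltW (rc_partition_gt0 L)) // sumc_ge0 // => w.
by rewrite mulr_ge0 ?rc_wgt_ge0.
Qed.

Lemma rc_meanB L X Y : rc_mean p h s L (fun w => X w - Y w) = rc_mean p h s L X - rc_mean p h s L Y.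
Proof.
by rewrite /rc_mean -mulrBl -sumcB; congr (_ / _); apply: eq_sumcT => w; rewrite mulrBl.
Qed.

Lemma rc_meanD L X Y : rc_mean p h s L (fun w => X w + Y w) = rc_mean p h s L X + rc_mean p h s L Y.
Proof.
by rewrite /rc_mean -mulrDl -sumcD; congr (_ / _); apply: eq_sumcT => w; rewrite mulrDl.
Qed.

Lemma eq_rc_mean L X Y : X =1 Y -> rc_mean p h s L X = rc_mean p h s L Y.
Proof. by move=> /funext ->. Qed.

Lemma rc_mean1 L : rc_mean p h s L (fun=> 1) = 1.
Proof.
rewrite /rc_mean (eq_sumcT _ (g := rc_wgt p h s L)) ?divff ?gt_eqF ?rc_partition_gt0 //.
by move=> w; rewrite mul1r.
Qed.

(** Closed indicators are removed one by one by inclusion-exclusion. The remaining functions are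
    increasing, and their means converge because they decrease as [L] grows. *)
Lemma cvg_rc_mean_open_closed (S T : seq (edge d)) :
  cvg (rc_mean p h s L (fun w => open_all R S w * closed_all R T w) @[L --> totally]).
Proof.
elim: T S => [|e T IH] S.
  apply/cvg_ex; eexists; apply: cvg_antitone_net.
    move=> L; apply: rc_mean_ge0 => w; rewrite mulr_ge0 ?open_all_ge0 //; case/andP: (closed_all01 R [::] w).
  move=> L L' LL; apply: rc_mean_antitone => //.
    move=> w; rewrite mulr_ge0 ?open_all_ge0 //; case/andP: (closed_all01 R [::] w).
  move=> w w' ww'; rewrite /closed_all !big_nil !mulr1 !open_allE ler_nat.
  case: (boolP (all w S)) => // /allP wS; suff -> : all w' S by [].
  by apply/allP => x /wS/ww'.
have -> : (fun L => rc_mean p h s L (fun w => open_all R S w * closed_all R (e :: T) w)) =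
  (fun L => rc_mean p h s L (fun w => open_all R S w * closed_all R T w)
          - rc_mean p h s L (fun w => open_all R (e :: S) w * closed_all R T w)).
  apply/funext => L; rewrite -rc_meanB; apply: eq_rc_mean => w.
  by rewrite /open_all /closed_all !big_cons; case: (w e) => /=; ring.
exact: is_cvgB.
Qed.

Lemma ind_cyl (l : seq (edge d)) eta w :
  ind R (cyl l eta) w = open_all R [seq e <- l | eta e] w * closed_all R [seq e <- l | ~~ eta e] w.
Proof.
rewrite /ind; elim: l => [|e l IH].
  by rewrite cyl_nil /open_all /closed_all !big_nil mulr1; case: asboolP => // -[].
have -> : `[< cyl (e :: l) eta w >] = (w e == eta e) && `[< cyl l eta w >].
  rewrite cyl_cons; apply/asboolP/andP => [[/= -> wl]|[/eqP we /asboolP wl]].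
    by rewrite eqxx; split=> //; apply/asboolP.
  by split.
rewrite -mulnb natrM IH /=; case: (eta e) => /=; rewrite /open_all /closed_all big_cons.
  by case: (w e) => /=; ring.
by case: (w e) => /=; ring.
Qed.

Lemma cvg_rc_mean_cyl (l : seq (edge d)) eta :
  cvg (rc_mean p h s L (ind R (cyl l eta)) @[L --> totally]).
Proof. by rewrite (funext (ind_cyl l eta)); exact: cvg_rc_mean_open_closed.
Qed.

Lemma exists_rc_limit : exists P : probability (config (edge d)) R, forall l eta,
  rc_mean p h s L (ind R (cyl l eta)) @[L --> totally] --> fine (P (cyl l eta)).
Proof.
pose pr (l : seq (edge d)) (eta : edge d -> bool) : R := lim (rc_mean p h s L (ind R (cyl l eta)) @[L --> totally]).
have [P HP] : exists P : probability (config (edge d)) R, forall l eta, P (cyl l eta) = (pr l eta)%:E.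
  apply: exists_measure.
  - move=> eta; rewrite /pr (_ : (fun L => _) = fun=> 1); first exact: lim_cst.
    apply/funext => L; rewrite -(rc_mean1 L); apply: eq_rc_mean => w.
    by rewrite /ind cyl_nil; case: asboolP => // -[].
  - move=> l eta; apply: limr_ge; first exact: cvg_rc_mean_cyl.
    by apply: nearW => L; apply: rc_mean_ge0 => w; rewrite /ind ler0n.
  - move=> l eta eta' ee; rewrite /pr (_ : cyl l eta = cyl l eta') //.
    by apply/seteqP; split=> w hw x xl; rewrite hw // ee.
  - by move=> l l' eta ll; rewrite /pr (cyl_mem _ ll).
  - move=> l e eta el; rewrite /pr.
    have c0 := @cvg_rc_mean_cyl (e :: l) (upd eta e false).
    have c1 := @cvg_rc_mean_cyl (e :: l) (upd eta e true).
    have fE : (fun L => rc_mean p h s L (ind R (cyl l eta))) =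
        (fun L => rc_mean p h s L (ind R (cyl (e :: l) (upd eta e false)))) +
        (fun L => rc_mean p h s L (ind R (cyl (e :: l) (upd eta e true)))).
      apply/funext => L.
    rewrite fctE -rc_meanD; apply: eq_rc_mean => w; rewrite /ind (cyl_split _ el).
    have := cyl_disj e l eta; set A := cyl _ _; set B := cyl _ _ => AB.
    case: (asboolP (A w)) => a; case: (asboolP (B w)) => b; case: asboolP => c; rewrite ?addr0 ?add0r //.
    + by have : (A `&` B) w by []; rewrite AB.
    + by have : (A `&` B) w by []; rewrite AB.
    + by case: c; left.
    + by case: c; right.
    + by case: c.
    by rewrite fE (limD c0 c1).
by exists P => l eta; rewrite HP /=; exact: cvg_rc_mean_cyl.
Qed.

End WiredMeasure.
End Limits.

(** * Percolation through self-avoiding walks *)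

Section Walks.
Variable d : nat.
Notation dir := ('I_d * bool)%type.
Implicit Types (x y : zlattice d) (s : seq dir) (w : iedge d -> bool).

Definition dstep x (a : dir) : zlattice d := if a.2 then x + unit_vec a.1 else x - unit_vec a.1.
Definition dedge x (a : dir) : iedge d := if a.2 then (x, a.1) else (x - unit_vec a.1, a.1).

Fixpoint walk_edges x s : seq (iedge d) :=
  if s is a :: s' then dedge x a :: walk_edges (dstep x a) s' else [::].

(** These events depend on finitely many edges and decrease to percolation as [n] grows, so volume
    limits can be taken at fixed [n]. *)
Definition ex_path n w : bool :=
  [exists s : n.-tuple dir, uniq (0 :: scanl dstep 0 s) && all w (walk_edges 0 s)].

Lemma open_step_dir w x y :
  open_step (@iends d) w x y -> exists a : dir, dstep x a = y /\ w (dedge x a).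
Proof.
move=> /asboolP[[z i] [we h]].
case: h => /pair_equal_spec /= [h1 h2].
  by exists (i, true); rewrite /dstep /dedge /= -h1.
exists (i, false); rewrite /dstep /dedge /= -h2 addrK h1; split=> //.
by rewrite -h1.
Qed.

Lemma dir_open_step w x (a : dir) : w (dedge x a) -> open_step (@iends d) w x (dstep x a).
Proof.
case: a => i [] /= h; apply/asboolP; eexists; split; try exact: h; first by left.
by right; rewrite /iends /dedge /= subrK.
Qed.

Lemma path_dirs w x p : path (open_step (@iends d) w) x p ->
  exists s, scanl dstep x s = p /\ all w (walk_edges x s).
Proof.
elim: p x => [|y p IH] x /=; first by exists [::].
move=> /andP[/open_step_dir[a [<- wa]] /IH[s [<- ws]]].
by exists (a :: s); rewrite /= wa.
Qed.

Lemma dirs_path w x s : all w (walk_edges x s) ->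
  path (open_step (@iends d) w) x (scanl dstep x s).
Proof.
elim: s x => [|a s IH] x //= /andP[wa ws].
by rewrite dir_open_step //= IH.
Qed.

Lemma take_walk n x s : take n (walk_edges x s) = walk_edges x (take n s).
Proof. by elim: s n x => [|a s IH] [|n] x //=; rewrite IH. Qed.

Lemma take_scanl n x s : take n (scanl dstep x s) = scanl dstep x (take n s).
Proof. by elim: s n x => [|a s IH] [|n] x //=; rewrite IH. Qed.

Lemma ex_pathP n w : reflect (exists s, [/\ size s = n, uniq (0 :: scanl dstep 0 s)
   & all w (walk_edges 0 s)]) (ex_path n w).
Proof.
apply: (iffP existsP) => [[s /andP[us ws]]|[s [/eqP ss us ws]]].
  by exists s; rewrite size_tuple.
by exists (Tuple ss); apply/andP; split.
Qed.

Lemma ex_path_le n m w : (n <= m)%N -> ex_path m w -> ex_path n w.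
Proof.
move=> nm /ex_pathP[s [ss us ws]]; apply/ex_pathP; exists (take n s); split.
- by rewrite size_takel // ss.
- rewrite -take_scanl; move: us => /= /andP[h1 h2]; rewrite take_uniq // andbT.
  by apply: contra h1 => /mem_take.
- by rewrite -take_walk; apply/allP => e /mem_take; apply: (allP ws).
Qed.

Lemma ex_path_mono n w w' : lec w w' -> ex_path n w -> ex_path n w'.
Proof.
move=> ww' /existsP[s /andP[us ws]]; apply/existsP; exists s; apply/andP; split=> //.
by apply/allP => e /(allP ws)/ww'.
Qed.

Lemma cluster_walk w x v : open_cluster (@iends d) w x v ->
  exists s, [/\ uniq (x :: scanl dstep x s), all w (walk_edges x s) & last x (scanl dstep x s) = v].
Proof.
move=> [p pp <-]; case/shortenP: pp => p' pp' up' _.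
by have [s [sE ws]] := path_dirs pp'; exists s; rewrite sE.
Qed.

Lemma cluster_walk_size n w s : ~ ex_path n w -> uniq (0 :: scanl dstep 0 s) ->
  all w (walk_edges 0 s) -> (size s < n)%N.
Proof.
move=> hn us ws; rewrite ltnNge; apply/negP => ns; apply: hn; apply: (ex_path_le ns).
by apply/ex_pathP; exists s.
Qed.

(** Every vertex of the cluster is the end of an open self-avoiding walk of fewer than [n] steps,
    and there are finitely many such walks. *)
Lemma finite_cluster n w : ~ ex_path n w -> finite_set (open_cluster (@iends d) w 0).
Proof.
move=> hn; pose T := {m : 'I_n & m.-tuple dir}.
suff sub : open_cluster (@iends d) w 0 `<=`
    [set last 0 (scanl dstep 0 (tagged t)) | t in [set: T]].
  apply: sub_finite_set sub _; apply: finite_image; exact: finite_finset.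
move=> v /cluster_walk[s [us ws <-]].
have sn := cluster_walk_size hn us ws.
by exists (Tagged (fun m : 'I_n => m.-tuple dir) (in_tuple s : (Ordinal sn).-tuple dir)).
Qed.

Lemma percolatesE w : percolates w <-> forall n, ex_path n w.
Proof.
split=> [inf n|h].
  by apply: contrapT => hn; apply: inf; exact: finite_cluster hn.
move=> /finite_fsetP[F FE].
(* A self-avoiding walk with as many steps as [F] has points visits one vertex too many. *)
have /ex_pathP[s [ss us ws]] := h #|` F|.
have sub : {subset 0 :: scanl dstep 0 s <= enum_fset F}.
  move=> v vs; have : [set` F] v; last by [].
  rewrite -FE; move: vs; rewrite inE => /orP[/eqP ->|]; first by exists [::].
  have := dirs_path ws; move: (scanl _ _ _) => p pp vp.
  case/splitPr: vp pp => p1 p2; rewrite cat_path /= => /and3P[pp1 pv _].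
  by exists (rcons p1 v); rewrite ?last_rcons // rcons_path pp1.
by have := uniq_leq_size us sub; rewrite /= size_scanl ss ltnn.
Qed.

Definition path_edges n : seq (iedge d) :=
  undup (flatten [seq walk_edges 0 (tval s) | s : n.-tuple dir]).

Lemma path_edges_uniq n : uniq (path_edges n). Proof. exact: undup_uniq. Qed.

Lemma ex_path_local n w w' : {in path_edges n, w =1 w'} -> ex_path n w -> ex_path n w'.
Proof.
move=> ww' /existsP[s /andP[us ws]]; apply/existsP; exists s; apply/andP; split=> //.
apply/allP => e es; rewrite -ww'; first exact: (allP ws).
rewrite mem_undup; apply/flattenP; exists (walk_edges 0 s) => //.
by apply/fintype.imageP; exists s.
Qed.

End Walks.

Section DecreasingLimits.
Variable R : realType.

Lemma measure_bigcap_le (d1 d2 : measure_display) (T1 : measurableType d1) (T2 : measurableType d2)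
    (P1 : probability T1 R) (P2 : probability T2 R) (A1 : (set T1)^nat) (A2 : (set T2)^nat) :
  (forall n, measurable (A1 n)) -> (forall n, measurable (A2 n)) ->
  (forall n m, (n <= m)%N -> A1 m `<=` A1 n) -> (forall n m, (n <= m)%N -> A2 m `<=` A2 n) ->
  (forall n, (P1 (A1 n) <= P2 (A2 n))%E) ->
  (P1 (\bigcap_n A1 n) <= P2 (\bigcap_n A2 n))%E.
Proof.
move=> m1 m2 s1 s2 h.
have c1 : (P1 \o A1) x @[x --> \oo] --> P1 (\bigcap_n A1 n).
  apply: nonincreasing_cvg_mu => //.
  - by apply: (le_lt_trans (probability_le1 P1 (m1 0%N))); rewrite ltry.
  - exact: bigcapT_measurable.
  - by move=> n m nm; apply/subsetPset/s1.
have c2 : (P2 \o A2) x @[x --> \oo] --> P2 (\bigcap_n A2 n).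
  apply: nonincreasing_cvg_mu => //.
  - by apply: (le_lt_trans (probability_le1 P2 (m2 0%N))); rewrite ltry.
  - exact: bigcapT_measurable.
  - by move=> n m nm; apply/subsetPset/s2.
rewrite -(cvg_lim _ c1) // -(cvg_lim _ c2) //; apply: lee_lim.
- by apply/cvg_ex; eexists; exact: c1.
- by apply/cvg_ex; eexists; exact: c2.
- by apply: nearW => n; exact: h.
Qed.

End DecreasingLimits.

Section InfiniteVolume.
Variables (R : realType) (d : nat).
Implicit Types (L : {fset zlattice d}).

Lemma closed_probR (b : R) : closed_prob b%:E = expR (- (2 * b)).
Proof. by []. Qed.

Lemma closed_prob01 (b : \bar R) : (0 <= b)%E -> 0 <= 1 - closed_prob b <= 1.
Proof.
case: b => [b| |] //; rewrite ?lee_fin => b0.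
  rewrite closed_probR gerBl expR_ge0 andbT subr_ge0 -expR0 ler_expR oppr_le0.
  by rewrite mulr_ge0.
have -> : closed_prob +oo%E = 0 :> R.
  by rewrite /closed_prob gt0_muley ?lte_fin.
by rewrite subr0 ler01 lexx.
Qed.

Lemma closed_prob_oo : closed_prob +oo%E = 0 :> R.
Proof. by rewrite /closed_prob gt0_muley ?lte_fin. Qed.

Lemma rc_infinite_limit (q : nat) (beta : \bar R) (H : R) l eta :
  (0 <= beta)%E -> 0 <= H -> (1 <= q)%N ->
  rc_mean (1 - closed_prob beta) (1 - closed_prob H%:E) q%:R L (ind R (cyl l eta)) @[L --> totally]
    --> fine (rc_infinite d q beta H (cyl l eta)).
Proof.
move=> b0 H0 q1.
have p01 := closed_prob01 b0.
have h01 : 0 <= 1 - closed_prob H%:E <= 1 by apply: closed_prob01; rewrite lee_fin.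
have s1 : 1 <= q%:R :> R by rewrite ler1n.
have : is_rc_limit q beta H (rc_infinite d q beta H).
  have [P HP] := @exists_rc_limit R d _ _ _ p01 h01 s1.
  (* Once a limit is known to exist, the [get] of the definition returns a genuine one. *)
  apply: (@getPex _ [set P | is_rc_limit q beta H P]); exists P => F eta' /=.
  have finP : P (cyl F eta') \is a fin_num.
    by apply: fin_num_measure; exact: measurable_cyl.
  rewrite -[P _](fineK finP).
  apply: cvg_EFin; first by near=> L.
  have := HP (enum_fset F) eta'; apply: cvg_trans.
  apply: near_eq_cvg; near=> L; rewrite /= rc_wiredE.
  by [].
move=> /(_ [fset e in l]%fset eta) /=.
have -> : [set w : edge d -> bool | forall e, e \in [fset e in l]%fset -> w e = eta e] = cyl l eta.
  by apply/seteqP; split=> w h e el; apply: h; move: el; rewrite inE.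
rewrite -[rc_infinite _ _ _ _ _]fineK; last by apply: fin_num_measure; exact: measurable_cyl.
move=> /fine_cvg; apply: cvg_trans; apply: near_eq_cvg; near=> L; rewrite /= rc_wiredE.
by [].
Unshelve. all: by end_near.
Qed.

Lemma additive_rc_mean (p h s : R) L l (A : set (edge d -> bool)) :
  uniq l -> local_event l A ->
  rc_mean p h s L (ind R A) = sumc l (fun eta => ind R A eta * rc_mean p h s L (ind R (cyl l eta))) (fun=> true).
Proof.
move=> ul lA.
apply: (additive_local (nu := fun A => rc_mean p h s L (ind R A))) => //.
  rewrite /rc_mean (eq_sumcT _ (g := fun=> 0 * 0)) ?sumcZ ?mul0r // => w.
  by rewrite /ind; case: asboolP => // _; rewrite !mul0r.
move=> m eta e em; rewrite -rc_meanD; apply: eq_rc_mean => w.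
rewrite /ind (cyl_split _ em) setIUr.
have := cyl_disj e m eta; set B1 := cyl _ _; set B2 := cyl _ _ => BB.
case: (asboolP ((A `&` B1) w)) => a; case: (asboolP ((A `&` B2) w)) => b; case: asboolP => c;
  rewrite ?addr0 ?add0r //.
+ by have : (B1 `&` B2) w := conj a.2 b.2; rewrite BB.
+ by have : (B1 `&` B2) w := conj a.2 b.2; rewrite BB.
+ by case: c; left.
+ by case: c; right.
+ by case: c.
Qed.

Lemma rc_infinite_local (q : nat) (beta : \bar R) (H : R) l A :
  (0 <= beta)%E -> 0 <= H -> (1 <= q)%N -> uniq l -> local_event l A ->
  rc_mean (1 - closed_prob beta) (1 - closed_prob H%:E) q%:R L (ind R A) @[L --> totally]
    --> fine (rc_infinite d q beta H A).
Proof.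
move=> b0 H0 q1 ul lA.
have p01 := closed_prob01 b0.
have h01 : 0 <= 1 - closed_prob H%:E <= 1 by apply: closed_prob01; rewrite lee_fin.
have s1 : 1 <= q%:R :> R by rewrite ler1n.
rewrite (probability_local _ (fun=> true) ul lA) /=.
set p := 1 - _; set h := 1 - _.
rewrite (funext (fun L => additive_rc_mean p h q%:R L ul lA)).
apply: cvg_sumc => eta; apply: cvgM; first exact: cvg_cst.
exact: rc_infinite_limit.
Qed.

Definition ex_path_edge n : set (edge d -> bool) := [set w | ex_path n (fun e => w (inl e))].

Definition pedges n : seq (edge d) := [seq inl e | e <- @path_edges d n].

Lemma pedges_uniq n : uniq (pedges n).
Proof. by rewrite map_inj_uniq ?path_edges_uniq // => ? ? []. Qed.

Lemma ex_path_edge_local n : local_event (pedges n) (ex_path_edge n).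
Proof.
move=> w w' ww'; apply: ex_path_local => e en; apply: ww'.
exact: map_f.
Qed.

Lemma percolates_bigcap :
  [set w : edge d -> bool | percolates (fun e => w (inl e))] = \bigcap_n ex_path_edge n.
Proof.
by apply/seteqP; split=> w /=; [move/percolatesE => h n _; exact: h|move=> h; apply/percolatesE => n; exact: h].
Qed.

Lemma measurable_ex_path_edge n : measurable (ex_path_edge n : set (config (edge d))).
Proof. exact: measurable_local (pedges_uniq n) (@ex_path_edge_local n). Qed.

Lemma ex_path_edge_sub n m : (n <= m)%N -> ex_path_edge m `<=` ex_path_edge n.
Proof. by move=> nm w; exact: ex_path_le. Qed.

Definition Xpath n : (edge d -> bool) -> R := ind R (ex_path_edge n).

Lemma Xpath_incr n : incr (Xpath n).
Proof.
move=> w w' ww'; rewrite /Xpath /ind ler_nat; case: asboolP => // h.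
case: asboolP => // h'; case: h'; apply: ex_path_mono h => e; exact: ww'.
Qed.

Lemma Xpath_ge0 n w : 0 <= Xpath n w. Proof. exact: ler0n. Qed.

Lemma theta_limit (q : nat) (beta : \bar R) (H : R) n :
  (0 <= beta)%E -> 0 <= H -> (1 <= q)%N ->
  rc_mean (1 - closed_prob beta) (1 - closed_prob H%:E) q%:R L (Xpath n) @[L --> totally]
    --> fine (rc_infinite d q beta H (ex_path_edge n)).
Proof.
move=> b0 H0 q1; apply: rc_infinite_local => //; first exact: pedges_uniq.
exact: ex_path_edge_local.
Qed.

(** The volume limit is taken at fixed [n], before [n] tends to infinity. Two spaces are allowed
    because Bernoulli configurations have no ghost edges. *)
Lemma limit_bigcap_le (d1 d2 : measure_display) (T1 : measurableType d1) (T2 : measurableType d2)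
    (P1 : probability T1 R) (P2 : probability T2 R) (A1 : (set T1)^nat) (A2 : (set T2)^nat)
    (f1 f2 : {fset zlattice d} -> nat -> R) :
  (forall n, measurable (A1 n)) -> (forall n, measurable (A2 n)) ->
  (forall n m, (n <= m)%N -> A1 m `<=` A1 n) -> (forall n m, (n <= m)%N -> A2 m `<=` A2 n) ->
  (forall n, f1 L n @[L --> totally] --> fine (P1 (A1 n))) ->
  (forall n, f2 L n @[L --> totally] --> fine (P2 (A2 n))) ->
  (forall L n, f1 L n <= f2 L n) ->
  (P1 (\bigcap_n A1 n) <= P2 (\bigcap_n A2 n))%E.
Proof.
move=> m1 m2 s1 s2 c1 c2 le; apply: measure_bigcap_le => // n.
rewrite -[X in (X <= _)%E]fineK ?fin_num_measure // -[X in (_ <= X)%E]fineK ?fin_num_measure //.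
rewrite lee_fin.
have c := @cvgB _ _ _ _ totally_filter _ _ _ _ (c2 n) (c1 n).
rewrite -subr_ge0 -(cvg_lim _ c) //; apply: limr_ge.
  by apply/cvg_ex; eexists; exact: c.
by apply: nearW => L; rewrite !fctE subr_ge0; exact: le.
Qed.

End InfiniteVolume.

Lemma sumc_cprod (E : eqType) (R : realType) (l : seq E) (c : E -> bool -> R) w : uniq l ->
  sumc l (cprod l c) w = \prod_(e <- l) (c e false + c e true).
Proof.
elim: l w => [|e l IH] w /=; first by rewrite /cprod !big_nil.
move=> /andP[el ul]; have H b : sumc l (cprod (e :: l) c) (upd w e b) =
    sumc l (fun w => c e b * cprod l c w) (upd w e b).
  by apply: eq_sumc => v hv; rewrite /cprod big_cons hv ?inE // upd_same.
by rewrite !H !sumcZ !IH // big_cons mulrDl.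
Qed.

Lemma sumc_map (E E' : eqType) (R : realType) (g : E -> E') (l : seq E) (f : (E -> bool) -> R) w :
  injective g -> sumc (map g l) (fun v => f (v \o g)) w = sumc l f (w \o g).
Proof.
move=> gi; elim: l w => //= e l IH w; rewrite !IH.
have H b : upd w (g e) b \o g = upd (w \o g) e b.
  by apply/funext => x; rewrite /= /upd /= (inj_eq gi).
by rewrite !H.
Qed.

Section Bernoulli.
Variables (R : realType) (d : nat).
Implicit Types (L : {fset zlattice d}).

Definition bprod (p : R) (l : seq (iedge d)) (eta : iedge d -> bool) : R :=
  \prod_(e <- l) (if eta e then p else 1 - p).

Lemma bernoulli_bond_cyl (p : R) l (eta : iedge d -> bool) : 0 <= p <= 1 -> uniq l ->
  bernoulli_bond d p (cyl l eta) = (bprod p l eta)%:E.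
Proof.
move=> /andP[p0 p1] ul.
have : is_bernoulli p (bernoulli_bond d p).
  have [P HP] : exists P : probability (config (iedge d)) R,
      forall l (eta : iedge d -> bool), P (cyl l eta) = (bprod p (undup l) eta)%:E.
    apply: exists_measure.
    - by move=> eta'; rewrite /bprod big_nil.
    - move=> l' eta'; apply: prodr_ge0 => e _; case: ifP => // _.
      by rewrite subr_ge0.
    - move=> l' e1 e2 h; apply: eq_big_seq => e; rewrite mem_undup => el.
      by rewrite h.
    - move=> l1 l2 eta' ll; apply: perm_big; apply: uniq_perm; rewrite ?undup_uniq //.
      by move=> x; rewrite !mem_undup.
    - move=> l' e eta' el /=; rewrite (negbTE el) /bprod !big_cons !upd_same.
      have H b : \prod_(f <- undup l') (if upd eta' e b f then p else 1 - p) = bprod p (undup l') eta'.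
        apply: eq_big_seq => f; rewrite mem_undup => fl; rewrite /upd.
        by case: eqP => // fe; rewrite -fe fl in el.
      by rewrite !H -/(bprod p _ _); ring.
  apply: (@getPex _ [set P | is_bernoulli p P]); exists P => F eta' /=.
  by have := HP (enum_fset F) eta'; rewrite undup_id ?fset_uniq.
move=> /(_ [fset e in l]%fset eta).
have -> : [set w : iedge d -> bool | forall e, e \in [fset e in l]%fset -> w e = eta e] = cyl l eta.
  by apply/seteqP; split=> w h e el; apply: h; move: el; rewrite inE.
move=> ->; congr (_%:E); apply: perm_big; apply: uniq_perm => //; try exact: fset_uniq.
by move=> x; rewrite inE.
Qed.

Lemma bernoulli_bond_local (p : R) l (A : set (iedge d -> bool)) w0 : 0 <= p <= 1 -> uniq l ->
  local_event l A ->
  bernoulli_bond d p A = (sumc l (fun eta => ind R A eta * bprod p l eta) w0)%:E.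
Proof.
move=> p01 ul lA; rewrite (probability_local _ w0 ul lA); congr (_%:E).
by apply: eq_sumcT => eta; rewrite bernoulli_bond_cyl.
Qed.

Lemma rc_mean_bernoulli_cyl (p h : R) L l (eta : edge d -> bool) :
  0 <= p <= 1 -> 0 <= h <= 1 -> uniq l -> {subset l <= box true L} ->
  rc_mean p h 1 L (ind R (cyl l eta)) = cprod l (edge_wgt p h) eta.
Proof.
move=> p01 h01 ul sub.
have cw1 e : edge_wgt p h e false + edge_wgt p h e true = 1 by rewrite /edge_wgt; case: ifP => _; ring.
have ub : uniq (box true L) by exact: box_uniq.
rewrite /rc_mean.
have wE w : rc_wgt p h 1 L w = cprod (box true L) (edge_wgt p h) w by rewrite /rc_wgt /wgt expr1n mul1r.
have -> : sumc (box true L) (rc_wgt p h 1 L) (fun=> true) = 1.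
  by rewrite (eq_sumcT _ _ wE) sumc_cprod // big1.
rewrite divr1.
(* The indicator of the cylinder is absorbed into the edge weights, so that the sum factorises. *)
pose c' e b : R := edge_wgt p h e b * ((e \in l) ==> (b == eta e))%:R.
have -> : sumc (box true L) (fun w => ind R (cyl l eta) w * rc_wgt p h 1 L w) (fun=> true) =
  sumc (box true L) (cprod (box true L) c') (fun=> true).
  apply: eq_sumcT => w; rewrite wE /cprod big_split /= mulrC; congr (_ * _).
  rewrite /ind; case: asboolP => hw.
    by rewrite big1_seq // => e _; case: (boolP (e \in l)) => //= el; rewrite hw // eqxx.
  have [e el we] : exists2 e, e \in l & w e != eta e.
    apply: contrapT => hn; apply: hw => e el; apply/eqP; apply: contraT => we.
    by case: hn; exists e.
  by rewrite (big_rem e) ?sub //= el (negbTE we) mul0r.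
rewrite sumc_cprod //.
have c'1 e : c' e false + c' e true = if e \in l then edge_wgt p h e (eta e) else 1.
  rewrite /c'; case: (e \in l) => /=; last by rewrite !mulr1 cw1.
  by case: (eta e); rewrite /= ?mulr1 ?mulr0 ?addr0 ?add0r.
under eq_bigr do rewrite c'1.
rewrite -big_mkcond -big_filter /cprod; apply: perm_big; apply: uniq_perm => //.
  by rewrite filter_uniq.
by move=> e; rewrite mem_filter; case: (boolP (e \in l)) => // /sub ->.
Qed.

Definition ex_path_set n : set (iedge d -> bool) := [set w | ex_path n w].

Lemma ex_path_set_local n : local_event (@path_edges d n) (ex_path_set n).
Proof. by move=> w w'; exact: ex_path_local. Qed.

Lemma measurable_ex_path_set n : measurable (ex_path_set n : set (config (iedge d))).
Proof. exact: measurable_local (path_edges_uniq d n) (@ex_path_set_local n). Qed.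

Lemma percolates_ex_path_set : [set w : iedge d -> bool | percolates w] = \bigcap_n ex_path_set n.
Proof.
by apply/seteqP; split=> w /=; [move/percolatesE => h n _; exact: h|move=> h; apply/percolatesE => n; exact: h].
Qed.

(** At cluster weight 1 the edges are independent and the ghost edges integrate out. The mean is
    constant once [L] contains the base points of the path edges. *)
Lemma bernoulli_limit (p h : R) n : 0 <= p <= 1 -> 0 <= h <= 1 ->
  rc_mean p h 1 L (@Xpath R d n) @[L --> totally] --> fine (bernoulli_bond d p (ex_path_set n)).
Proof.
move=> p01 h01.
have H (L : {fset zlattice d}) : ([fset e.1 | e in path_edges d n] `<=` L)%fset ->
    rc_mean p h 1 L (Xpath R n) = fine (bernoulli_bond d p (ex_path_set n)).
  move=> sub; rewrite (bernoulli_bond_local (fun=> true) p01 (path_edges_uniq d n)) /=; last first.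
    exact: ex_path_set_local.
  rewrite (additive_rc_mean _ _ _ _ (pedges_uniq d n) (@ex_path_edge_local d n)).
  transitivity (sumc (pedges d n) (fun v => ind R (ex_path_set n) (v \o inl) *
      bprod p (path_edges d n) (v \o inl)) (fun=> true)); last first.
    exact: (@sumc_map _ _ _ inl (path_edges d n)
      (fun eta => ind R (ex_path_set n) eta * bprod p (path_edges d n) eta) (fun=> true) inl_inj).
  apply: eq_sumcT => eta; congr (_ * _).
  rewrite rc_mean_bernoulli_cyl //; first by rewrite /cprod /pedges big_map.
    exact: pedges_uniq.
  move=> e /mapP[f fe ->]; rewrite /box mem_cat mem_ints_inl in_internal_edges.
  by rewrite (fsubsetP sub) //; apply/imfsetP; exists f.
apply: cvg_near_cst; exists [fset e.1 | e in path_edges d n]%fset => // L /= sub; exact: H.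
Qed.

Lemma theta_le_bernoulli (q : nat) (beta : \bar R) (H p h : R) :
  (0 <= beta)%E -> 0 <= H -> (1 <= q)%N -> 0 <= p <= 1 -> 0 <= h <= 1 ->
  (forall L n, rc_mean (1 - closed_prob beta) (1 - closed_prob H%:E) q%:R L (Xpath R n)
     <= rc_mean p h 1 L (Xpath R n)) ->
  (theta d q beta H <= bernoulli_bond d p [set w | percolates w])%E.
Proof.
move=> b0 H0 q1 p01 h01 le; rewrite /theta percolates_bigcap percolates_ex_path_set.
apply: limit_bigcap_le le.
- exact: measurable_ex_path_edge.
- exact: measurable_ex_path_set.
- exact: ex_path_edge_sub.
- by move=> n m nm w; exact: ex_path_le.
- by move=> n; exact: theta_limit.
- by move=> n; exact: bernoulli_limit.
Qed.

Lemma bernoulli_le_theta (q : nat) (beta : \bar R) (H p h : R) :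
  (0 <= beta)%E -> 0 <= H -> (1 <= q)%N -> 0 <= p <= 1 -> 0 <= h <= 1 ->
  (forall L n, rc_mean p h 1 L (Xpath R n) <=
     rc_mean (1 - closed_prob beta) (1 - closed_prob H%:E) q%:R L (Xpath R n)) ->
  (bernoulli_bond d p [set w | percolates w] <= theta d q beta H)%E.
Proof.
move=> b0 H0 q1 p01 h01 le; rewrite /theta percolates_bigcap percolates_ex_path_set.
apply: limit_bigcap_le le.
- exact: measurable_ex_path_set.
- exact: measurable_ex_path_edge.
- by move=> n m nm w; exact: ex_path_le.
- exact: ex_path_edge_sub.
- by move=> n; exact: bernoulli_limit.
- by move=> n; exact: theta_limit.
Qed.

Lemma theta_le (q q' : nat) (beta beta' : \bar R) (H H' : R) :
  (0 <= beta)%E -> 0 <= H -> (1 <= q)%N -> (0 <= beta')%E -> 0 <= H' -> (1 <= q')%N ->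
  (forall L n, rc_mean (1 - closed_prob beta) (1 - closed_prob H%:E) q%:R L (Xpath R n) <=
               rc_mean (1 - closed_prob beta') (1 - closed_prob H'%:E) q'%:R L (Xpath R n)) ->
  (theta d q beta H <= theta d q' beta' H')%E.
Proof.
move=> b0 H0 q1 b0' H0' q1' le; rewrite /theta percolates_bigcap.
apply: limit_bigcap_le le; try exact: measurable_ex_path_edge; try exact: ex_path_edge_sub;
  by move=> n; exact: theta_limit.
Qed.

Lemma rc_mean_le (p h s p' h' s' : R) L X :
  0 <= p <= 1 -> 0 <= h <= 1 -> 0 <= p' <= 1 -> 0 <= h' <= 1 -> 1 <= s' -> s' <= s ->
  p <= p' -> h <= h' -> (forall w, 0 <= X w) -> incr X ->
  rc_mean p h s L X <= rc_mean p' h' s' L X.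
Proof.
move=> p01 h01 p01' h01' s1' ss pp hh X0 Xi.
have s1 : 1 <= s by rewrite (le_trans s1').
rewrite /rc_mean ler_pdivrMr ?rc_partition_gt0 // mulrAC ler_pdivlMr ?rc_partition_gt0 // [leRHS]mulrC.
apply: holley => // [w|w|w w'].
- exact: rc_wgt_ge0.
- exact: rc_wgt_ge0.
- apply: (wgt_meet_join (rc_sys true L)) => // [e b|e b|e _]; try exact: edge_wgt_ge0.
  rewrite /edge_wgt; case: ifP => _.
    by case/andP: p01 => ? ?; case/andP: p01' => ? ?; nra.
  by case/andP: h01 => ? ?; case/andP: h01' => ? ?; nra.
Qed.

Lemma bernoulli_mono (p p' : R) : 0 <= p -> p <= p' -> p' <= 1 ->
  (bernoulli_bond d p [set w | percolates w] <= bernoulli_bond d p' [set w | percolates w])%E.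
Proof.
move=> p0 pp p1; rewrite percolates_ex_path_set.
have p01 : 0 <= p <= 1 by rewrite p0 (le_trans pp).
have p01' : 0 <= p' <= 1 by rewrite p1 (le_trans p0).
have h01 : (0%R : R) <= (0%R : R) <= (1%R : R) by rewrite lexx ler01.
apply: (@limit_bigcap_le _ _ _ _ _ _ _ _ _ _ (fun L n => rc_mean p 0 1 L (Xpath R n))
  (fun L n => rc_mean p' 0 1 L (Xpath R n))).
- exact: measurable_ex_path_set.
- exact: measurable_ex_path_set.
- by move=> n m nm w; exact: ex_path_le.
- by move=> n m nm w; exact: ex_path_le.
- by move=> n; exact: bernoulli_limit.
- by move=> n; exact: bernoulli_limit.
- by move=> L n; apply: rc_mean_le => //; exact: Xpath_incr.
Qed.

End Bernoulli.

(** * Bounds on the critical probability of Bernoulli percolation *)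

Section SelfAvoiding.
Variable d : nat.
Notation dir := ('I_d * bool)%type.
Implicit Types (x y : zlattice d) (s : seq dir).

Lemma dedge_ends x (a : dir) :
  (dedge x a).1 = x /\ (dedge x a).1 + unit_vec (dedge x a).2 = dstep x a \/
  (dedge x a).1 = dstep x a /\ (dedge x a).1 + unit_vec (dedge x a).2 = x.
Proof. by case: a => i []; rewrite /dedge /dstep /=; [left|right; rewrite subrK]. Qed.

Lemma walk_edges_ends x s e y : e \in walk_edges x s ->
  y = e.1 \/ y = e.1 + unit_vec e.2 -> y \in x :: scanl (@dstep d) x s.
Proof.
elim: s x => [|a s IH] x //=; rewrite inE => /orP[/eqP -> |es] he; last first.
  by rewrite inE (IH _ es he) orbT.
rewrite !inE; case: (dedge_ends x a) he => -[-> ->] [->|->]; rewrite eqxx ?orbT //.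
Qed.

Lemma walk_edges_uniq x s : uniq (x :: scanl (@dstep d) x s) -> uniq (walk_edges x s).
Proof.
elim: s x => [|a s IH] x //= /andP[xs us].
rewrite IH // andbT; apply: contra xs => es.
apply: (walk_edges_ends es); case: (dedge_ends x a) => -[-> ->]; by [left|right].
Qed.

Lemma size_walk_edges x s : size (walk_edges x s) = size s.
Proof. by elim: s x => //= a s IH x; rewrite IH. Qed.

End SelfAvoiding.

Section UnionBound.
Variable R : realType.

Lemma union_bound d (T : measurableType d) (P : probability T R) (I : eqType) (r : seq I)
    (A : set T) (B : I -> set T) (b : R) :
  measurable A -> (forall i, measurable (B i)) ->
  A `<=` (fun w => exists2 i, i \in r & B i w) ->
  (forall i, i \in r -> (P (B i) <= b%:E)%E) ->
  (P A <= ((size r)%:R * b)%:E)%E.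
Proof.
move=> + mB; elim: r A => [|i r IH] A mA sub Pb.
  rewrite mul0r (_ : A = set0) ?measure0 //.
  by apply/seteqP; split=> // w /sub[].
have mAB : measurable (A `\` B i) by exact: measurableD.
have -> : A = (A `&` B i) `|` (A `\` B i) by rewrite setUIDK.
have h1 : (P (A `&` B i) <= b%:E)%E.
  apply: le_trans (Pb i (mem_head _ _)).
  by apply: le_measure; rewrite ?inE //; exact: measurableI.
have h2 : (P (A `\` B i) <= ((size r)%:R * b)%:E)%E.
  apply: IH => // [w [/sub[j + Bj] nB]|j jr]; last by apply: Pb; rewrite inE jr orbT.
  by rewrite inE => /orP[/eqP ji|jr]; [case: nB; rewrite -ji|exists j].
apply: (@le_trans _ _ (P (A `&` B i) + P (A `\` B i))%E).
  by apply: measureU2 => //; exact: measurableI.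
apply: (le_trans (leeD h1 h2)); rewrite -EFinD lee_fin /= -natr1 mulrDl mul1r addrC.
exact: lexx.
Qed.

End UnionBound.

Section SmallP.
Variables (R : realType) (d : nat).

Lemma bernoulli_path_bound (p : R) n : 0 <= p <= 1 ->
  (bernoulli_bond d p (@ex_path_set d n) <= (((d * 2) ^ n)%:R * p ^+ n)%:E)%E.
Proof.
move=> p01.
pose C (s : n.-tuple ('I_d * bool)) : set (config (iedge d)) :=
  if uniq (0 :: scanl (@dstep d) 0 s) then cyl (walk_edges 0 s) (fun=> true) else set0.
have := @union_bound R _ _ (bernoulli_bond d p) _ (enum {: n.-tuple ('I_d * bool)})
  (@ex_path_set d n) C (p ^+ n).
rewrite -cardE card_tuple card_prod card_ord card_bool; apply.
- exact: measurable_ex_path_set.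
- by move=> s; rewrite /C; case: ifP => _; [exact: measurable_cyl|exact: measurable0].
- move=> w /existsP[s /andP[us ws]]; exists s; first by rewrite mem_enum.
  by rewrite /C us => e es; rewrite (allP ws).
- move=> s _; rewrite /C; case: ifP => us; last first.
    by rewrite measure0 lee_fin exprn_ge0 //; case/andP: p01.
  rewrite bernoulli_bond_cyl //; last exact: walk_edges_uniq.
  by rewrite lee_fin /bprod big_const_seq count_predT size_walk_edges size_tuple -Monoid.iteropE.
Qed.

(** The value makes [2 * d * p = 1/2], so the union bound over the [(2 * d) ^ n] walks of length [n]
    gives [2^-1 ^+ n]. *)
Lemma bernoulli_small (p : R) : (1 <= d)%N -> p = (d%:R * 4)^-1 ->
  bernoulli_bond d p [set w | percolates w] = 0%E.
Proof.
move=> d1 pE; have d0 : 1 <= d%:R :> R by rewrite ler1n.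
have p0 : 0 <= p by rewrite pE invr_ge0 mulr_ge0.
have p1 : p <= 1 by rewrite pE invf_le1 ?mulr_gt0 ?ltr0n //; lra.
have p01 : 0 <= p <= 1 by rewrite p0.
apply/eqP; rewrite eq_le measure_ge0 andbT.
have bound n : (bernoulli_bond d p [set w | percolates w] <= (2^-1 ^+ n)%:E)%E.
  apply: (@le_trans _ _ (bernoulli_bond d p (@ex_path_set d n))).
    apply: le_measure; rewrite ?inE.
    - rewrite percolates_ex_path_set; apply: bigcapT_measurable => m.
      exact: measurable_ex_path_set.
    - exact: measurable_ex_path_set.
    - by move=> w /= /percolatesE; apply.
  apply: (le_trans (bernoulli_path_bound n p01)); rewrite lee_fin natrX -exprMn natrM.
  have -> : d%:R * 2 * p = 2^-1 by rewrite pE; field; apply/eqP; lra.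
  exact: lexx.
have finP : bernoulli_bond d p [set w | percolates w] \is a fin_num.
  apply: fin_num_measure; rewrite percolates_ex_path_set; apply: bigcapT_measurable => m.
  exact: measurable_ex_path_set.
rewrite -(fineK finP) lee_fin.
have c : (fun n : nat => (2^-1 : R) ^+ n) @ \oo --> (0 : R).
  by apply: cvg_expr; rewrite ger0_norm; lra.
rewrite -(cvg_lim _ c) //; apply: limr_ge.
  by apply/cvg_ex; eexists; exact: c.
by apply: nearW => n; rewrite -lee_fin fineK.
Qed.

End SmallP.

(** * Boundary contours of finite planar sets *)

Section Contour.

Notation pt := (int * int)%type.
Notation state := (pt * pt)%type.

Definition padd (u v : pt) : pt := (u.1 + v.1, u.2 + v.2).
Definition rot (u : pt) : pt := (- u.2, u.1).
Definition pneg (u : pt) : pt := (- u.1, - u.2).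
Definition dirs4 : seq pt := [:: (1, 0); (0, 1); (-1, 0); (0, -1)].

(* A state [(v, u)] is the edge from [v], inside the cluster, to [v + u],
   outside of it; its dual edge is followed with the cluster on the left, and
   ends at [v + u/2 + rot u / 2]. *)
Definition turn (c : option bool) (s : state) : state :=
  match c with
  | None => (s.1, rot s.2)
  | Some false => (padd s.1 (rot s.2), s.2)
  | Some true => (padd (padd s.1 (rot s.2)) s.2, pneg (rot s.2))
  end.

Variable C : {fset pt}.

Definition boundary (s : state) := [&& s.1 \in C, padd s.1 s.2 \notin C & s.2 \in dirs4].

(** [None] is a left turn, [Some false] goes straight on, [Some true] is a right turn. When only the
    diagonal point is in [C], the contour turns left and stays with its current inside point, which
    keeps the walk reversible. *)
Definition choice (s : state) : option bool :=
  if padd s.1 (rot s.2) \notin C then None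
  else if padd (padd s.1 (rot s.2)) s.2 \notin C then Some false else Some true.

Definition next_state (s : state) : state := turn (choice s) s.

Lemma next_stateE s : next_state s =
  if padd s.1 (rot s.2) \notin C then (s.1, rot s.2)
  else if padd (padd s.1 (rot s.2)) s.2 \notin C then (padd s.1 (rot s.2), s.2)
  else (padd (padd s.1 (rot s.2)) s.2, pneg (rot s.2)).
Proof.
by rewrite /next_state /choice /turn; case: ifP => _; [|case: ifP => _].
Qed.

Lemma boundary_next s : boundary s -> boundary (next_state s).
Proof.
case: s => v u /and3P[/= vC vuC ud]; rewrite next_stateE /=.
have rd : rot u \in dirs4 by move: ud; rewrite !inE => /or4P[]/eqP ->.
have nd : pneg (rot u) \in dirs4 by move: ud; rewrite !inE => /or4P[]/eqP ->.
case: ifP => h1; first by apply/and3P.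
case: ifP => h2; apply/and3P; split=> //=; first by apply: negbFE.
  by apply: negbFE.
suff -> : padd (padd (padd v (rot u)) u) (pneg (rot u)) = padd v u by [].
by rewrite /padd /rot /pneg /=; congr pair; ring.
Qed.

Lemma pt_eq (u v : pt) : u.1 = v.1 -> u.2 = v.2 -> u = v.
Proof. by case: u v => [? ?] [? ?] /= -> ->. Qed.

(** The last step can be undone. For equal turns the coordinates agree; for different turns, an
    equality of images would identify a point of [C] with a point outside [C]. *)
Lemma next_state_inj s t : boundary s -> boundary t -> next_state s = next_state t -> s = t.
Proof.
case: s t => [[x y] [a b]] [[x' y'] [a' b']] /and3P[/= vC vuC _] /and3P[/= wC wuC _].
rewrite !next_stateE /=.
have contra u v : u \in C -> v \notin C -> u = v -> (x, y, (a, b)) = (x', y', (a', b')).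
  by move=> uC + uv; rewrite -uv uC.
case: ifP => h1; [|case: ifP => h2; [move/negbFE in h1|move/negbFE in h1; move/negbFE in h2]];
(case: ifP => k1; [|case: ifP => k2; [move/negbFE in k1|move/negbFE in k1; move/negbFE in k2]]);
rewrite /padd /rot /pneg /= in vC vuC wC wuC h1 k1 *; rewrite /padd /rot /pneg /=;
move=> [e1 e2 e3 e4].
- by congr (_, _, (_, _)); lia.
- by apply: (contra _ _ wC vuC); apply: pt_eq => /=; lia.
- by apply: (contra _ _ k1 vuC); apply: pt_eq => /=; lia.
- by apply: (contra _ _ vC wuC); apply: pt_eq => /=; lia.
- by congr (_, _, (_, _)); lia.
- by apply: (contra _ _ wC vuC); apply: pt_eq => /=; lia.
- by apply: (contra _ _ h1 wuC); apply: pt_eq => /=; lia.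
- by apply: (contra _ _ vC wuC); apply: pt_eq => /=; lia.
- by congr (_, _, (_, _)); lia.
Qed.

(* [xpos] is twice the abscissa of the midpoint of the edge, [ypos] twice the
   height of the initial end of its dual edge. *)
Definition xpos (s : state) : int := 2 * s.1.1 + s.2.1.
Definition ypos (s : state) : int := 2 * s.1.2 + s.2.2 - s.2.1.

Lemma xpos_next s : boundary s -> xpos s - 2 <= xpos (next_state s).
Proof.
case: s => [[x y] [a b]] /and3P[_ _ ud]; rewrite next_stateE /xpos /=.
move: ud; rewrite !inE => /or4P[]/eqP[-> ->]; case: ifP => _; [|case: ifP => _| |case: ifP => _| |case: ifP => _| |case: ifP => _];
  rewrite /padd /rot /pneg /=; lia.
Qed.

(** The sign of a crossing of the horizontal axis by the dual edge, +1 upwards and -1 downwards. At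
    a boundary state [ypos] is odd, so the dual edge never ends on the axis. *)
Definition cross (s : state) : int := (0 < ypos (next_state s))%R%:Z - (0 < ypos s)%R%:Z.
Definition cross_pos (s : state) : int := (0 < xpos s)%R%:Z * cross s.

Lemma ypos_next s : ypos (next_state s) = 2 * s.1.2 + s.2.2 + s.2.1.
Proof.
case: s => [[x y] [a b]]; rewrite next_stateE /ypos /=.
by case: ifP => _; [|case: ifP => _]; rewrite /padd /rot /pneg /=; lia.
Qed.

(** The two orientations of the edge between [(a, 0)] and [(a + 1, 0)]: the dual edge of [sright a]
    crosses the positive half-axis upwards, that of [sleft a] downwards. *)
Definition sright (a : nat) : state := ((a%:Z, 0), (1, 0)).
Definition sleft (a : nat) : state := ((a.+1%:Z, 0), (-1, 0)).

Lemma sum_eq_ord (M n : nat) : \sum_(i < M) (n == i :> nat)%:Z = (n < M)%N%:Z.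
Proof.
elim: M => [|M IH]; first by rewrite big_ord0.
rewrite big_ord_recr /= IH ltnS [in RHS]leq_eqVlt.
by case: eqP => [->|_] /=; rewrite ?ltnn ?addr0 ?add0r.
Qed.

Lemma cross_posE (M : nat) s : boundary s -> s.1.1 < M%:Z ->
  cross_pos s = \sum_(a < M) ((s == sright a)%:Z - (s == sleft a)%:Z).
Proof.
case: s => [[x y] [a b]] /and3P[_ _ ud] /= xM.
rewrite /cross_pos /cross ypos_next /ypos /xpos /=.
move: ud; rewrite !inE => /or4P[]/eqP[-> ->].
- rewrite (eq_bigr (fun i : 'I_M => (y == 0)%:Z * (x == i%:Z)%:Z)); last first.
    move=> i _; rewrite /sright /sleft !xpair_eqE /= !andbT !andbF subr0.
    by case: eqP; case: eqP.
  rewrite -mulr_sumr; case: x xM => n xM; last first.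
    by rewrite big1 // mulr0 [X in nat_of_bool X](_ : _ = false) ?mul0r //; lia.
  rewrite sum_eq_ord [X in nat_of_bool X](_ : _ = true) ?mul1r //; last by lia.
  by case: eqP => y0; lia.
- rewrite big1 => [|i _]; last by rewrite /sright /sleft !xpair_eqE /= !andbF.
  by rewrite addr0 subr0 subrr mulr0.
- rewrite (eq_bigr (fun i : 'I_M => - (y == 0)%:Z * (x == i.+1%:Z)%:Z)); last first.
    move=> i _; rewrite /sright /sleft !xpair_eqE /= !andbT !andbF sub0r.
    by case: eqP; case: eqP.
  rewrite -mulr_sumr; case: x xM => n xM; last first.
    by rewrite big1 // mulr0 [X in nat_of_bool X](_ : _ = false) ?mul0r //; lia.
  case: n xM => [|n] xM.
    by rewrite big1 // mulr0 [X in nat_of_bool X](_ : _ = false) ?mul0r //; lia.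
  rewrite [X in nat_of_bool X](_ : _ = true) ?mul1r //; last by lia.
  rewrite (eq_bigr (fun i : 'I_M => (n == i :> nat)%:Z)) // sum_eq_ord.
  by case: eqP => y0; lia.
- rewrite big1 => [|i _]; last by rewrite /sright /sleft !xpair_eqE /= !andbF.
  by rewrite addr0 subr0 subrr mulr0.
Qed.

Definition states : {fset state} :=
  [fset s in [seq (v, u) | v <- C, u <- dirs4] | boundary s]%fset.

Lemma mem_states s : (s \in states) = boundary s.
Proof.
apply/idP/idP => [|bs]; first by rewrite !inE /= => /andP[_].
rewrite !inE /= bs andbT; case: s bs => v u /and3P[/= h1 _ h3].
have h : (v, u) \in [seq (v, u) | v <- C, u <- dirs4] by apply/allpairsP; exists (v, u).
exact: h.
Qed.

Definition nxt (s : states) : states :=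
  [` (etrans (mem_states _) (boundary_next (etrans (esym (mem_states _)) (valP s))))]%fset.

Lemma val_nxt s : val (nxt s) = next_state (val s). Proof. by []. Qed.

Lemma state_boundary (s : states) : boundary (val s).
Proof. by rewrite -mem_states (valP s). Qed.

Lemma nxt_inj : injective nxt.
Proof.
move=> s t h; apply: val_inj; apply: next_state_inj; try exact: state_boundary.
by rewrite -!val_nxt h.
Qed.

Lemma sum_states (t : state) : \sum_(s : states) (val s == t)%:Z = boundary t.
Proof.
rewrite -mem_states; have [tF|tF] := boolP (t \in states).
  rewrite (bigD1 [` tF]%fset) //= eqxx big1 ?addr0 // => s st.
  by case: eqP => // h; case/eqP: st; apply: val_inj.
by rewrite big1 // => s _; case: eqP => // h; rewrite -h (valP s) in tF.
Qed.

(** The crossings at abscissa [a + 1/2] contribute the indicator of [(a, 0)] minus that of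
    [(a + 1, 0)]. The sum telescopes from the origin, which is in [C], to a point beyond [C]. *)
Lemma sum_cross_pos : (0, 0) \in C -> \sum_(s : states) cross_pos (val s) = 1.
Proof.
move=> C0.
have [M HM] : exists M : nat, forall v, v \in C -> v.1 < M%:Z.
  exists (\max_(v <- C) `|v.1|%N).+1 => v vC.
  have := @leq_bigmax_seq _ (enum_fset C) xpredT (fun v : pt => `|v.1|%N) v vC isT.
  move: (\max_(_ <- _) _)%N => m; case: v {vC} => [[n|n] y] /=; last by [].
  by rewrite ltz_nat ltnS.
have sE (s : states) : cross_pos (val s) = \sum_(a < M) ((val s == sright a)%:Z - (val s == sleft a)%:Z).
  by apply: cross_posE; [exact: state_boundary|apply: HM; case/and3P: (state_boundary s)].
under eq_bigr do rewrite sE.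
rewrite exchange_big /=.
pose c (a : nat) : int := ((a%:Z, 0) \in C).
rewrite (eq_bigr (fun a : 'I_M => - (c a.+1 - c a))); last first.
  move=> a _; rewrite sumrB !sum_states /boundary /sright /sleft /padd /= /c.
  have -> : (a.+1%:Z + -1, 0 + 0) = (a%:Z, 0) :> pt by congr pair; lia.
  have -> : (a%:Z + 1, 0 + 0) = (a.+1%:Z, 0) :> pt by congr pair; lia.
  by case: (_ \in C); case: (_ \in C).
rewrite sumrN -(big_mkord xpredT (fun a => c a.+1 - c a)) telescope_sumr // opprB /c C0.
by have [/HM|//] := boolP ((M%:Z, 0) \in C); rewrite ltxx.
Qed.

Lemma sum_cross_iter N (s : states) :
  \sum_(i < N) cross (val (iter i nxt s)) = (0 < ypos (val (iter N nxt s)))%R%:Z - (0 < ypos (val s))%R%:Z.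
Proof.
elim: N => [|N IH]; first by rewrite big_ord0 subrr.
by rewrite big_ord_recr /= IH /cross -val_nxt -iterS addrC addrA subrK.
Qed.

(* Summed over all the boundary states, the signed crossings of the positive
   half-axis amount to 1, while along every orbit those of the whole axis cancel
   out: some orbit crosses both half-axes, hence is at least as long as the
   distance from its starting point to the origin. *)
Lemma exists_contour : (0, 0) \in C -> exists a : nat,
  all boundary (traject next_state (sright a) a.+1) /\ uniq (traject next_state (sright a) a.+1).
Proof.
move=> C0.
(* A common period of all the orbits. *)
pose N := (\prod_(s : states) order nxt s)%N.
have iterN s : iter N nxt s = s.
  rewrite /N (bigD1 s) //= mulnC; elim: (\prod_(_ | _) _)%N => [|m IH] //.
  by rewrite mulSn iterD IH iter_order //; exact: nxt_inj.
have N0 : (0 < N)%N by rewrite /N prodn_gt0 // => s; exact: order_gt0.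
have : \sum_(s : states) \sum_(i < N) cross_pos (val (iter i nxt s)) = N%:Z.
  rewrite exchange_big /= (eq_bigr (fun=> 1)).
    by rewrite sumr_const card_ord natz.
  move=> i _; rewrite -(sum_cross_pos C0) [RHS](reindex_inj (h := iter i nxt)) //.
  elim: (i : nat) => [|k IH] //= x y /nxt_inj; exact: IH.
move=> sumN.
have [s sp] : exists s : states, 0 < \sum_(i < N) cross_pos (val (iter i nxt s)).
  apply: contrapT => hn.
  have : \sum_(s : states) \sum_(i < N) cross_pos (val (iter i nxt s)) <= 0.
    by apply: sumr_le0 => s _; rewrite leNgt; apply/negP => h; apply: hn; exists s.
  by rewrite sumN; lia.
have s0 : \sum_(i < N) cross (val (iter i nxt s)) = 0 by rewrite sum_cross_iter iterN subrr.
have [i ip] : exists i : 'I_N, 0 < cross_pos (val (iter i nxt s)).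
  apply: contrapT => hn; move: sp; rewrite ltNge => /negP; apply.
  by apply: sumr_le0 => i _; rewrite leNgt; apply/negP => h; apply: hn; exists i.
(* Were [xpos] positive along the whole orbit, [cross_pos] would equal [cross], whose sum over a
   period vanishes. *)
have [j jp] : exists j : 'I_N, xpos (val (iter j nxt s)) <= 0.
  apply: contrapT => hn; move: sp; rewrite (eq_bigr (fun i : 'I_N => cross (val (iter i nxt s)))).
    by rewrite s0.
  move=> k _; rewrite /cross_pos; case: ltP => h; first by rewrite mul1r.
  by case: hn; exists k.
set s1 := iter i nxt s in ip.
have [a s1E] : exists a, val s1 = sright a.
  have := state_boundary s1; move: ip; case: (val s1) => [[x y] [u v]].
  rewrite /cross_pos /cross ypos_next /xpos /ypos /= => + /and3P[_ _ ud].
  move: ud; rewrite !inE /= => /or4P[]/eqP[-> ->] h; try by exfalso; move: h; lia.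
  have y0 : y = 0 by move: h; lia.
  case: x h => n h; last by exfalso; move: h; lia.
  by exists n; rewrite y0.
have con : fconnect nxt s1 (iter j nxt s).
  have -> : iter j nxt s = iter (j + N - i) nxt s1.
    rewrite /s1 -iterD subnK; last by have := ltn_ord i; lia.
    by rewrite iterD iterN.
  exact: fconnect_iter.
(* [xpos] drops by at most 2 per step and starts at [2 * a + 1], so more than [a] steps are needed
   to reach a nonpositive value. *)
have xk k : xpos (val s1) - (2 * k)%N%:Z <= xpos (val (iter k nxt s1)).
  elim: k => [|k IH]; first by rewrite muln0 subr0.
  have := xpos_next (state_boundary (iter k nxt s1)); rewrite -val_nxt -iterS.
  move: (xpos _) (xpos _) (xpos _) IH => x1 x2 x3; lia.
have ka := xk (findex nxt s1 (iter j nxt s)).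
rewrite iter_findex // s1E (_ : xpos (sright a) = 2 * a%:Z + 1) // in ka.
have ord : (a.+1 <= order nxt s1)%N.
  apply: leq_trans (findex_max con); rewrite ltnS.
  move: ka jp; move: (xpos _) (findex _ _ _) => x k; lia.
exists a.
have tr m : traject next_state (sright a) m = [seq val x | x <- traject nxt s1 m].
  rewrite -s1E; elim: m s1 {s1E ip con xk ka ord} => //= m IH t.
  by rewrite -IH.
rewrite tr; split; first by apply/allP => _ /mapP[x _ ->]; exact: state_boundary.
rewrite (map_inj_uniq val_inj) -(take_traject nxt s1 ord); apply: take_uniq.
exact: orbit_uniq.
Qed.

End Contour.

(** Given its first state, a contour is determined by its [a] successive turns; this bounds the
    number of contours by [3 ^ a]. *)
Lemma traject_codes (C : {fset (int * int)%type}) a s :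
  exists t : a.-tuple (option bool),
    traject (next_state C) s a.+1 = s :: scanl (fun s c => turn c s) s t.
Proof.
elim: a s => [|a IH] s; first by exists [tuple].
have [t ht] := IH (next_state C s).
exists [tuple of choice C s :: t].
by rewrite trajectS ht.
Qed.

Section Plane.
Variables (d : nat) (i0 i1 : 'I_d).
Hypothesis i01 : i0 != i1.
Notation pt := (int * int)%type.

(** The contour argument runs in a coordinate plane. The trace of a cluster on it may be
    disconnected, which is why [exists_contour] is stated for any finite set containing the
    origin. *)
Definition emb (v : pt) : zlattice d :=
  \row_j (if j == i0 then v.1 else if j == i1 then v.2 else 0).

Definition sdir (u : pt) : 'I_d * bool :=
  if u == (1, 0) then (i0, true) else if u == (-1, 0) then (i0, false)
  else if u == (0, 1) then (i1, true) else (i1, false).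

Lemma emb_inj : injective emb.
Proof.
move=> u v /rowP h; have := h i0; have := h i1; rewrite !mxE !eqxx eq_sym (negbTE i01).
by move=> h2 h1; apply: pt_eq.
Qed.

Lemma emb0 : emb (0, 0) = 0.
Proof. by apply/rowP => j; rewrite !mxE; case: eqP => // _; case: eqP. Qed.

Lemma dstep_emb v u : u \in dirs4 -> dstep (emb v) (sdir u) = emb (padd v u).
Proof.
have i10 := i01; rewrite eq_sym in i10.
move=> ud; apply/rowP => j; move: ud.
rewrite !inE => /or4P[]/eqP ->; rewrite /sdir /dstep /= /unit_vec !mxE /=;
  (have [ji|j0] := eqVneq j i0; [rewrite ?ji ?(negbTE i01)|have [ji|j1] := eqVneq j i1;
  rewrite ?ji ?(negbTE i10) ?(negbTE j0)]); rewrite /= ?addr0 ?subr0 //.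
Qed.

Definition pedge (s : pt * pt) : iedge d := dedge (emb s.1) (sdir s.2).

Section Cluster.
Variables (w : iedge d -> bool) (C : {fset pt}).
Hypothesis HC : forall v, v \in C <-> open_cluster (@iends d) w 0 (emb v).

Lemma boundary_closed s : boundary C s -> w (pedge s) = false.
Proof.
case: s => v u /and3P[/= vC vuC ud]; apply/negbTE/negP => h; move/negP: vuC; apply.
apply/HC; rewrite -dstep_emb //; move/HC: vC => vC.
exact: oc_trans vC (oc_step (dir_open_step h)).
Qed.

(** The end of a boundary edge lying in [C] is determined by the edge, hence so is its orientation.
    Distinct states thus give distinct, independent edges. *)
Lemma pedge_inj s t : boundary C s -> boundary C t -> pedge s = pedge t -> s = t.
Proof.
case: s t => v u [v' u'] /and3P[/= vC vuC ud] /and3P[/= vC' vuC' ud'] h.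
have E := dedge_ends (emb v) (sdir u); have E' := dedge_ends (emb v') (sdir u').
have hd : dedge (emb v) (sdir u) = dedge (emb v') (sdir u') by exact: h.
rewrite (dstep_emb _ ud) hd in E; rewrite (dstep_emb _ ud') in E'.
have contra : v <> padd v' u' by move=> vv; move/negP: vuC'; apply; rewrite -vv.
have same : emb v = emb v' -> emb (padd v u) = emb (padd v' u') -> (v, u) = (v', u').
  move=> /emb_inj vv /emb_inj; rewrite vv /padd => -[/addrI a1 /addrI a2].
  by rewrite (pt_eq a1 a2).
case: E => -[e1 e2]; case: E' => -[e1' e2'].
- by apply: same; [exact: etrans (esym e1) e1'|exact: etrans (esym e2) e2'].
- by exfalso; apply: contra; apply: emb_inj; exact: etrans (esym e1) e1'.
- by exfalso; apply: contra; apply: emb_inj; exact: etrans (esym e2) e2'.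
- by apply: same; [exact: etrans (esym e2) e2'|exact: etrans (esym e1) e1'].
Qed.

End Cluster.

Definition contour_states (a : nat) (t : seq (option bool)) :=
  sright a :: scanl (fun s c => turn c s) (sright a) t.

(** Turn sequences with a repeated edge get the empty event, so that each sequence has probability
    at most [(1 - p) ^+ a.+1]. *)
Definition contour_event (a : nat) (t : seq (option bool)) : set (config (iedge d)) :=
  if uniq (map pedge (contour_states a t))
  then cyl (map pedge (contour_states a t)) (fun=> false) else set0.

Definition blocked (a : nat) : set (config (iedge d)) :=
  [set w | exists t : a.-tuple (option bool), contour_event a t w].

Lemma walk_coord x s (i : 'I_d) :
  (last x (scanl (@dstep d) x s)) 0 i <= x 0 i + (size s)%:Z.
Proof.
elim: s x => [|a s IH] x /=; first by rewrite addr0.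
apply: (le_trans (IH _)).
suff : (dstep x a) 0 i <= x 0 i + 1 by lia.
rewrite /dstep /unit_vec; case: ifP => _; rewrite !mxE /=;
  by case: (_ == _) => /=; lia.
Qed.

Lemma blocked_cover n (w : iedge d -> bool) : ~ ex_path n w ->
  exists2 a, (a < n)%N & blocked a w.
Proof.
move=> hn; have fin := finite_cluster hn.
have finC : finite_set [set v | open_cluster (@iends d) w 0 (emb v)].
  by apply: (finite_preimage (f := emb)) => // u v _ _; exact: emb_inj.
have /finite_fsetP[C CE] := finC.
have HC v : v \in C <-> open_cluster (@iends d) w 0 (emb v).
  by move: CE => /seteqP[h1 h2]; split=> [/h2|/h1].
have [|a [bd us]] := @exists_contour C.
  by apply/HC; rewrite emb0; exact: oc_refl.
have [t tE] := traject_codes C a (sright a).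
exists a.
  (* The point [(a, 0)] is in the cluster, hence at the end of a self-avoiding walk of fewer than
     [n] steps, so [a < n]. *)
  have : boundary C (sright a) by have /andP[] := bd.
  case/and3P => /HC /cluster_walk[s [us' ws sE]] _ _.
  have := walk_coord 0 s i0; rewrite sE !mxE eqxx /= add0r lez_nat => h.
  by apply: (leq_ltn_trans h); apply: cluster_walk_size us' ws.
exists t; rewrite /contour_event /contour_states -tE ifT; last first.
  rewrite map_inj_in_uniq // => x y xs ys.
  exact: (pedge_inj (allP bd _ xs) (allP bd _ ys)).
by move=> e /mapP[x xs ->]; apply: (boundary_closed HC); apply: (allP bd).
Qed.

Lemma measurable_contour_event a t : measurable (contour_event a t).
Proof. by rewrite /contour_event; case: ifP => _; [exact: measurable_cyl|exact: measurable0]. Qed.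

Lemma measurable_blocked a : measurable (blocked a).
Proof.
rewrite (_ : blocked a = \bigcup_(t in [set: a.-tuple (option bool)]) contour_event a t).
  apply: fin_bigcup_measurable; first exact: finite_finset.
  by move=> t _; exact: measurable_contour_event.
by apply/seteqP; split=> w /= [t]; [exists t|move=> ?; exists t].
Qed.

Variable R : realType.

Lemma blocked_bound (p : R) a : 0 <= p <= 1 ->
  (bernoulli_bond d p (blocked a) <= ((3 ^ a)%:R * (1 - p) ^+ a.+1)%:E)%E.
Proof.
move=> p01; have p1 : 0 <= 1 - p by rewrite subr_ge0; case/andP: p01.
have := @union_bound R _ _ (bernoulli_bond d p) _ (enum {: a.-tuple (option bool)})
  (blocked a) (contour_event a) ((1 - p) ^+ a.+1).
rewrite -cardE card_tuple card_option card_bool; apply.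
- exact: measurable_blocked.
- by move=> t; exact: measurable_contour_event.
- by move=> w [t wt]; exists t; rewrite ?mem_enum.
- move=> t _; rewrite /contour_event; case: ifP => us; last by rewrite measure0 lee_fin exprn_ge0.
  have sz : size (map pedge (contour_states a t)) = a.+1.
    by rewrite size_map /= size_scanl size_tuple.
  by rewrite bernoulli_bond_cyl // lee_fin /bprod big_const_seq count_predT sz -Monoid.iteropE.
Qed.

(** With [1 - p = 1/6], the contours starting at [a] cost at most [1/6 * 2^-1 ^+ a], whose sum is at
    most 1/3. Hence every [ex_path_set n] has probability at least 1/2, and so has the limit. *)
Lemma bernoulli_percolates (p : R) : p = 5 / 6 ->
  (0 < bernoulli_bond d p [set w | percolates w])%E.
Proof.
move=> pE; have p01 : 0 <= p <= 1 by rewrite pE; lra.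
have lower n : (2^-1%:E <= bernoulli_bond d p (@ex_path_set d n))%E.
  have mA := @measurable_ex_path_set d n.
  have finP (B : set (config (iedge d))) : measurable B -> bernoulli_bond d p B \is a fin_num.
    exact: fin_num_measure.
  have hC : (bernoulli_bond d p (~` @ex_path_set d n) <= (2^-1)%:E)%E.
    apply: (@le_trans _ _ (\sum_(a < n) bernoulli_bond d p (blocked a))%E).
      apply: (@le_trans _ _ (bernoulli_bond d p (\big[setU/set0]_(a < n) blocked a))).
        apply: le_measure; rewrite ?inE.
        - exact: measurableC.
        - by apply: bigsetU_measurable => a _; exact: measurable_blocked.
        - move=> w /= /blocked_cover[a an wa].
          by rewrite -bigcup_mkord; exists a.
      by apply: le_mu_bigsetU => a _; exact: measurable_blocked.
    apply: (@le_trans _ _ (\sum_(a < n) ((1 / 6) * 2^-1 ^+ a)%:E)%E).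
      apply: lee_sum => a _; apply: (le_trans (blocked_bound a p01)).
      rewrite lee_fin pE exprS natrX mulrCA -exprMn.
      have -> : (1 - 5 / 6 : R) = 1 / 6 by field.
      by have -> : (3 * (1 / 6) : R) = 2^-1 by field.
    rewrite sumEFin lee_fin -mulr_sumr.
    have geo : \sum_(a < n) (2^-1 : R) ^+ a <= 2.
      have := subrX1 (2^-1 : R) n; set S := \sum_(i < n) _ => h.
      have p2 : 0 <= (2^-1 : R) ^+ n by rewrite exprn_ge0.
      lra.
    lra.
  have := probability_setC (bernoulli_bond d p) mA => eC.
  rewrite eC in hC; move: hC; rewrite -(fineK (finP _ mA)) -EFinB !lee_fin; lra.
apply: (@lt_le_trans _ _ (2^-1)%:E); first by rewrite lte_fin invr_gt0.
rewrite percolates_ex_path_set.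
have c : (bernoulli_bond d p \o @ex_path_set d) x @[x --> \oo]
    --> bernoulli_bond d p (\bigcap_n @ex_path_set d n).
  apply: nonincreasing_cvg_mu => //.
  - apply: (le_lt_trans (probability_le1 _ _)); rewrite ?ltry //; exact: measurable_ex_path_set.
  - by move=> n; exact: measurable_ex_path_set.
  - by apply: bigcapT_measurable => n; exact: measurable_ex_path_set.
  - by move=> n m nm; apply/subsetPset => w; exact: ex_path_le.
rewrite -(cvg_lim _ c) //; apply: lime_ge.
  by apply/cvg_ex; eexists; exact: c.
by apply: nearW => n; exact: lower.
Qed.

End Plane.

(** * Comparison of random-cluster measures *)

Section Comparisons.
Variables (R : realType) (d : nat).
Implicit Types (L : {fset zlattice d}) (w : edge d -> bool) (X : (edge d -> bool) -> R).

Definition mean (g : bool) (c : edge d -> bool -> R) (s : R) L X : R :=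
  sumc (box g L) (fun w => X w * wgt (box g L) (wired_nclusters g L) c s w) (fun=> true) /
  sumc (box g L) (wgt (box g L) (wired_nclusters g L) c s) (fun=> true).

(** Only the odds of each edge matter, so a weight whose internal odds have been tilted can be
    renormalised into a density. *)
Lemma mean_scale g (c c' : edge d -> bool -> R) (k : edge d -> R) s L X :
  (forall e, 0 < k e) -> (forall e b, c' e b = k e * c e b) -> mean g c' s L X = mean g c s L X.
Proof.
move=> k0 cc; set K := \prod_(e <- box g L) k e.
have K0 : K != 0 by rewrite gt_eqF // prodr_gt0.
have wE w : wgt (box g L) (wired_nclusters g L) c' s w = K * wgt (box g L) (wired_nclusters g L) c s w.
  rewrite /wgt mulrCA; congr (_ * _); rewrite /cprod /K -big_split /=.
  by apply: eq_bigr => e _; rewrite cc.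
rewrite /mean (eq_sumcT _ _ wE) sumcZ.
rewrite (@eq_sumcT _ _ _ _ (fun w => K * (X w * wgt (box g L) (wired_nclusters g L) c s w))) ?sumcZ.
  by rewrite -mulf_div divff // mul1r.
by move=> w; rewrite wE mulrCA.
Qed.

Lemma edge_wgt_gt0 (p h : R) (e : edge d) b : 0 < p < 1 -> 0 < h < 1 -> 0 < edge_wgt p h e b.
Proof.
move=> /andP[p0 p1] /andP[h0 h1].
by rewrite /edge_wgt; case: b; case: (internal e) => //=; rewrite subr_gt0.
Qed.

Lemma ler_div_cross (a b c e : R) : 0 < b -> 0 < e -> a * e <= b * c -> a / b <= c / e.
Proof. by move=> b0 e0 h; rewrite ler_pdivrMr // mulrAC ler_pdivlMr // [leRHS]mulrC. Qed.

(* The constants [kap], [a] are uniform in the volume, which makes the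
   comparison strict in the infinite-volume limit. *)
Lemma mean_tradeoff g (h pc s s2 : R) : 0 < h < 1 -> 0 < pc < 1 -> 1 <= s2 < s ->
  exists p' p'', [/\ pc < p' < 1, 0 < p'' < pc & forall L X,
    (forall w, 0 <= X w) -> incr X ->
    mean g (edge_wgt p' h) s L X <= mean g (edge_wgt p'' h) s2 L X].
Proof.
move=> h01 pc01 /andP[s21 ss].
have /andP[h0 h1] := h01; have /andP[pc0 pc1] := pc01.
have s20 : 0 < s2 by rewrite (lt_le_trans ltr01).
have s0 : 0 < s by rewrite (lt_trans s20).
pose D := (d + d).+1.
pose b := ln (s / s2).
have b0 : 0 < b by rewrite ln_gt0 // ltr_pdivlMr // mul1r.
have sE : s2 = s * expR (- b).
  by rewrite expRN lnK ?posrE ?divr_gt0 // invf_div mulrCA divff ?mulr1 // gt_eqF.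
(* The closed weight is at least [(1 - pc) / 2] for internal edges, by the choice of [p'] below, and
   equals [1 - h] for ghost edges; the product is below both. *)
pose kap := (1 - pc) / 2 * (1 - h).
have kap0 : 0 < kap by rewrite /kap !mulr_gt0 // ?subr_gt0.
have kap1 : kap <= 1.
  by rewrite /kap -[leRHS]mulr1; apply: ler_pM; lra.
(* The largest decrease of the log-odds that [wgt_tradeoff] allows for this [b]. *)
pose a := b * kap ^+ D / (2 * D%:R).
have D0 : 0 < 2 * D%:R :> R by rewrite mulr_gt0 // ltr0n.
have a0 : 0 < a by rewrite /a divr_gt0 // mulr_gt0 // exprn_gt0.
pose t := expR (- a).
have t0 : 0 < t := expR_gt0 _.
have t1 : t < 1 by rewrite /t -expR0 ltr_expR oppr_lt0.
(* Small enough for the tilt by [t] to bring [p' = pc + dl] back below [pc], and at most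
   [(1 - pc) / 2] as [kap] presupposes. *)
pose dl := pc * (1 - pc) * (1 - t) / 2.
have dl0 : 0 < dl by rewrite /dl !mulr_gt0 // ?subr_gt0.
have dl1 : dl <= (1 - pc) / 2.
  have y1 : pc * (1 - t) <= 1 by rewrite -[leRHS]mulr1; apply: ler_pM; lra.
  have -> : dl = (1 - pc) / 2 * (pc * (1 - t)) by rewrite /dl; ring.
  by apply: ler_piMr; lra.
pose p' := pc + dl.
have p'1 : p' < 1 by rewrite /p'; lra.
have p'0 : 0 < p' by rewrite /p'; lra.
have p'pc : pc < p' by rewrite /p' ltrDl.
pose den := p' * t + (1 - p').
have den0 : 0 < den by rewrite /den addr_gt0 ?mulr_gt0 // subr_gt0.
(* The density whose odds are [t] times those of [p']. *)
pose p'' := p' * t / den.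
have p''0 : 0 < p'' by rewrite /p'' divr_gt0 // mulr_gt0.
have p''pc : p'' < pc.
  rewrite /p'' ltr_pdivrMr //.
  have e1 : t * (1 - pc) <= 1 - pc by apply: ler_piMl; lra.
  rewrite -subr_gt0; have -> : pc * den - p' * t = (dl + dl) - dl * (t * (1 - pc) + pc).
    by rewrite /den /p' /dl; field.
  have : dl * (t * (1 - pc) + pc) <= dl by apply: ler_piMr; lra.
  lra.
exists p', p''; split; [by rewrite p'pc|by rewrite p''0|].
move=> L X X0 Xi.
have p'01 : 0 < p' < 1 by rewrite p'0.
pose c : edge d -> bool -> R := edge_wgt p' h.
have c0 (e : edge d) o : 0 < c e o by apply: edge_wgt_gt0.
pose c2 (e : edge d) (o : bool) := if internal e && o then c e o * expR (- a) else c e o.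
have c20 (e : edge d) o : 0 < c2 e o by rewrite /c2; case: ifP => // _; rewrite mulr_gt0.
rewrite -(@mean_scale g (edge_wgt p'' h) c2 (fun e => if internal e then den else 1)).
- apply: ler_div_cross.
  + by apply: sumc_gt0 => w; apply: wgt_gt0.
  + by apply: sumc_gt0 => w; apply: wgt_gt0.
  have Hint (e : edge d) : e \in box g L -> internal e -> exists2 x, x \in enum_fset L & e \in star g x.
    by move=> eb ie; have [x xL ex] := int_star eb ie; exists x.
  have Hstep (f : edge d) w : f \in box g L -> \sum_(x <- enum_fset L)
      (closed_all R (star g x) (upd w f false) - closed_all R (star g x) (upd w f true))
      <= 2 * (~~ cn g L f w)%:R.
    by move=> fb; exact: star_step.
  apply: (@wgt_tradeoff _ R _ _ _ (rc_sys g L) _ (enum_fset L) (star g) D (@internal d)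
    (fun x => @star_sub d g L x) (fun x _ => star_uniq g x) (fun x _ => star_size g x)
    Hint Hstep c c2 s s2 kap a b X (fun=> true)) => //.
  + by rewrite (ltW kap0).
  + move=> f _; rewrite /c /edge_wgt; set r := if internal f then p' else h.
    rewrite subrK mulr1 /r /kap; case: ifP => _; last by apply: ler_piMl; lra.
    apply: (@le_trans _ _ ((1 - pc) / 2)); last by rewrite /p'; lra.
    by apply: ler_piMr; lra.
  + exact: ltW.
  + exact: ltW.
  + by rewrite /a divfK ?gt_eqF.
- by move=> e; case: ifP.
- move=> e o; rewrite /c2 /c /edge_wgt; case: (internal e); case: o => //=; rewrite ?mul1r //.
    by rewrite /p'' [RHS]mulrC divfK ?gt_eqF.
  rewrite /p'' mulrBr mulr1 [den * _]mulrC divfK ?gt_eqF // /den; ring.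
Qed.

Definition internal_fun X := forall w w', (forall e, w (inl e) = w' (inl e)) -> X w = X w'.

Lemma Xpath_internal n : internal_fun (Xpath R n).
Proof.
move=> w w' ww'; rewrite /Xpath /ind /ex_path_edge /=.
by rewrite (_ : (fun e => w (inl e)) = (fun e => w' (inl e))) //; apply/funext => e; exact: ww'.
Qed.

Lemma sumc_closed (E : eqType) (r : seq E) (f : (E -> bool) -> R) (w : E -> bool) : uniq r ->
  (forall (w' : E -> bool) e, e \in r -> w' e -> f w' = 0) ->
  sumc r f w = f (fun e => (e \notin r) && w e).
Proof.
elim: r w => [|e r IH] w /=; first by move=> _ _; congr f; apply/funext.
move=> /andP[er ur] f0.
rewrite [X in _ + X](_ : _ = 0) ?addr0; last first.
  rewrite (eq_sumc (g := fun=> 0 * 0)) ?sumcZ ?mul0r // => v hv.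
  by rewrite (f0 v e) ?mul0r ?mem_head // hv ?upd_same // inE.
rewrite IH // => [|w' x xr]; last by apply: f0; rewrite inE xr orbT.
congr f; apply/funext => x; rewrite inE /upd; case: eqP => [->|_] //=.
by rewrite andbF.
Qed.

Lemma wire_closed L w :
  wire true L (fun e => (e \notin exts L) && w e) = wire false L w.
Proof.
apply/funext => -[i|x] /=; first by rewrite mem_exts_inl.
by rewrite mem_exts_inr; case: (x \in L).
Qed.

(** At density 0 the weight vanishes unless all ghost edges of [L] are closed. On the right [h] is a
    free parameter, as [box false] has no ghost edges; it can be chosen to keep the edge weights
    positive. *)
Lemma rc_mean_no_field (p h s : R) L X : internal_fun X ->
  rc_mean p 0 s L X = mean false (edge_wgt p h) s L X.
Proof.
move=> Xint.
have key (Y : (edge d -> bool) -> R) : internal_fun Y ->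
    sumc (box true L) (fun w => Y w * rc_wgt p 0 s L w) (fun=> true) =
    sumc (box false L) (fun w => Y w * wgt (box false L) (wired_nclusters false L) (edge_wgt p h) s w) (fun=> true).
  move=> Yint; rewrite /box cats0 sumc_cat; apply: eq_sumcT => w.
  rewrite sumc_closed ?exts_uniq //; last first.
    move=> w' e ee we; rewrite /rc_wgt /wgt /cprod /box big_cat /= (big_rem e ee) /= /edge_wgt we.
    case: e ee we => [e|e] /=; first by rewrite mem_exts_inl.
    by move=> _ _; rewrite mul0r !mulr0.
  congr (_ * _); first by apply: Yint => e /=; rewrite mem_exts_inl.
  rewrite /rc_wgt /wgt /wired_nclusters wire_closed; congr (_ * _); rewrite /cprod /box big_cat /=.
  rewrite [X in _ * X]big1_seq ?mulr1.
    apply: eq_big_seq => -[e|e] ee /=; first by rewrite mem_exts_inl.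
    by rewrite mem_ints_inr in ee.
  by move=> e /= ee; rewrite ee /= /edge_wgt; case: e ee => [e|e] //=; rewrite ?mem_exts_inl // subr0.
rewrite /rc_mean /mean key //; congr (_ / _).
have key1 := key (fun=> 1) (fun _ _ _ => erefl).
rewrite (eq_sumcT (box true L) (g := fun w => 1 * rc_wgt p 0 s L w)); last by move=> w; rewrite mul1r.
by rewrite key1; apply: eq_sumcT => w; rewrite mul1r.
Qed.

Lemma mean_ghost (p h s a t : R) L X : 0 < p < 1 -> 0 < h < 1 -> 1 <= s ->
  0 <= a <= 1 -> a * (h + s * (1 - h)) <= h -> 1 <= t ->
  t^-1 <= s^-1 + (1 - s^-1) * a ^+ 2 ->
  (forall w, 0 <= X w) -> incr X -> internal_fun X ->
  mean false (edge_wgt p h) t L X <= rc_mean p h s L X.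
Proof.
move=> p01 h01 s1 a01 ah t1 ht X0 Xi Xint.
have c0 (e : edge d) b : 0 < edge_wgt p h e b by exact: edge_wgt_gt0.
have sys0 : rc_system (ints L) (wired_nclusters false L) (cn false L).
  by have := rc_sys false L; rewrite /box cats0.
rewrite /mean /rc_mean /box cats0; apply: ler_div_cross.
- by apply: sumc_gt0 => w; apply: wgt_gt0 => //; rewrite (lt_le_trans ltr01).
- by apply: sumc_gt0 => w; apply: wgt_gt0 => //; rewrite (lt_le_trans ltr01).
apply: (@ghost_marginal _ R _ _ _ _ _ _ (ghost_ends L) (edge_wgt p h) s (rc_sys true L) sys0 _ _ _ _ _ c0 s1 a) => //.
- by move=> e w w'; exact: cn0_cn.
- by move=> e; exact: ghost_ends_uniq.
- by move=> e _; exact: ghost_ends_sub.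
- by move=> e; exact: ghost_ends_size.
- by move=> e w; exact: ghost_ends_cn.
- by move=> [e|e]; rewrite ?mem_exts_inl //= => _; rewrite /edge_wgt.
- by move=> w w' ww'; apply: Xint => e; apply: ww'; rewrite !inE /= mem_exts_inl.
Qed.

(** The conditional odds of an open edge are at least those of [p] divided by [t], and the
    hypothesis places the odds of [p'] below this value. *)
Lemma bernoulli_le_mean (p p' h t : R) L X : 0 < p < 1 -> 0 < p' < 1 -> 1 <= t ->
  p' * (t * (1 - p)) <= (1 - p') * p ->
  (forall w, 0 <= X w) -> incr X -> internal_fun X -> 0 < h < 1 ->
  rc_mean p' 0 1 L X <= mean false (edge_wgt p h) t L X.
Proof.
move=> p01 p01' t1 hp X0 Xi Xint h01; rewrite (rc_mean_no_field p' h) //.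
have c0 (e : edge d) b : 0 < edge_wgt p h e b by exact: edge_wgt_gt0.
have c0' (e : edge d) b : 0 < edge_wgt p' h e b by exact: edge_wgt_gt0.
have t0 : 0 < t by rewrite (lt_le_trans ltr01).
rewrite /mean; apply: ler_div_cross.
- by apply: sumc_gt0 => w; apply: wgt_gt0.
- by apply: sumc_gt0 => w; apply: wgt_gt0.
apply: holley => // [w|w|].
- by apply/ltW/wgt_gt0.
- by apply/ltW/wgt_gt0.
apply: (wgt_meet_join_local (rc_sys false L)) => //.
- by move=> w; apply: wgt_gt0.
- by move=> w w'; apply: (wgt_local (rc_sys false L)).
move=> e B eb Be; rewrite expr1n mulr1.
have uB : upd B e false = B by rewrite -Be upd_id.
have := wgt_step (rc_sys false L) (edge_wgt p h) t B eb; rewrite uB.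
set G0 := wgt _ _ _ _ B; set G1 := wgt _ _ _ _ _.
have G10 : 0 < G1 by apply: wgt_gt0.
have ie : internal e by move: eb; rewrite /box cats0; case: (e) => // x; rewrite mem_ints_inr.
rewrite /edge_wgt ie => st.
have /andP[p0 p1] := p01; have /andP[p0' p1'] := p01'.
rewrite -(ler_pM2l p0) mulrCA st.
have tn : t ^+ (~~ cn false L e B) <= t by case: (cn _ _ _ _); rewrite ?expr0 ?expr1.
apply: (@le_trans _ _ (p' * (t * (1 - p) * G1))).
  rewrite ler_wpM2l ?(ltW p0') // ler_wpM2r ?(ltW G10) // ler_wpM2r ?subr_ge0 ?(ltW p1) //.
by rewrite mulrA [leRHS]mulrCA [leRHS]mulrA ler_wpM2r ?(ltW G10).
Qed.

End Comparisons.

(** * Critical points *)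

Section Suprema.
Variable R : realType.

Lemma le_sup_nneg (A : set R) x : A x -> (x%:E <= sup_nneg A)%E.
Proof.
move=> Ax; rewrite /sup_nneg; case: eqP => [A0|_]; first by rewrite A0 in Ax.
by apply: ereal_sup_ubound; exists x.
Qed.

Lemma sup_nneg_le (A : set R) (b : \bar R) : (0 <= b)%E -> (forall x, A x -> (x%:E <= b)%E) ->
  (sup_nneg A <= b)%E.
Proof.
move=> b0 h; rewrite /sup_nneg; case: eqP => // _.
by apply: ub_ereal_sup => _ [x Ax <-]; exact: h.
Qed.

Lemma sup_nneg_ge0 (A : set R) : (forall x, A x -> 0 <= x) -> (0 <= sup_nneg A)%E.
Proof.
move=> h; have [->|/set0P[x Ax]] := eqVneq A set0; first by rewrite /sup_nneg eqxx.
by apply: (@le_trans _ _ x%:E); [rewrite lee_fin; exact: h|exact: le_sup_nneg].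
Qed.

End Suprema.

Section Inverse.
Variable R : realType.

Definition temperature (p : R) : R := - ln (1 - p) / 2.

Lemma temperatureK (p : R) : p < 1 -> 1 - closed_prob (temperature p)%:E = p.
Proof.
move=> p1; rewrite closed_probR /temperature.
have -> : - (2 * (- ln (1 - p) / 2)) = ln (1 - p) by field.
by rewrite lnK ?posrE ?subr_gt0 // subKr.
Qed.

Lemma closed_probK (b : R) : temperature (1 - closed_prob b%:E) = b.
Proof. by rewrite /temperature subKr closed_probR expRK; field. Qed.

Lemma temperature_lt (p p' : R) : p < p' -> p' < 1 -> temperature p < temperature p'.
Proof.
move=> pp p1; rewrite /temperature ltr_pM2r ?invr_gt0 // ltrN2 ltr_ln ?posrE ?subr_gt0 //.
  by rewrite ltrD2l ltrN2.
exact: lt_trans pp p1.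
Qed.

Lemma temperature_ge0 (p : R) : 0 <= p -> p < 1 -> 0 <= temperature p.
Proof.
move=> p0 p1; rewrite /temperature divr_ge0 // oppr_ge0 -ln1 ler_ln ?posrE ?subr_gt0 //.
by rewrite gerBl.
Qed.

Lemma open_prob_gt0 (b : R) : 0 < b -> 0 < 1 - closed_prob b%:E < 1.
Proof.
move=> b0; rewrite closed_probR gtrBl expR_gt0 andbT subr_gt0 -expR0 ltr_expR oppr_lt0.
by rewrite mulr_gt0.
Qed.

Lemma open_prob_le (b b' : R) : b <= b' -> 1 - closed_prob b%:E <= 1 - closed_prob b'%:E.
Proof. by move=> bb; rewrite !closed_probR lerD2l lerN2 ler_expR lerN2 ler_pM2l. Qed.

End Inverse.

Section CriticalPoint.
Variables (R : realType) (d : nat).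
Hypothesis hd : (1 <= d)%N.

Local Notation bernoulli p := (bernoulli_bond d p [set w | percolates w]).
Let S : set R := [set p : R | 0 <= p <= 1 /\ bernoulli p = 0%E].

Let p0 : R := (d%:R * 4)^-1.

Let p0_gt0 : 0 < p0.
Proof. by rewrite /p0 invr_gt0 mulr_gt0 // ltr0n. Qed.

Let p0_lt1 : p0 < 1.
Proof.
have d1 : 1 <= d%:R :> R by rewrite ler1n.
by rewrite /p0 invf_lt1 ?mulr_gt0 ?ltr0n //; lra.
Qed.

Let S_p0 : S p0.
Proof. by split; [rewrite !ltW|exact: bernoulli_small]. Qed.

Lemma bernoulli_ge0 (p : R) : (0 <= bernoulli p)%E. Proof. exact: measure_ge0. Qed.

Let S_sup : has_sup S.
Proof. by split; [exists p0|exists 1 => p [/andP[]]]. Qed.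

Lemma pc_ge_p0 : p0 <= p_c R d.
Proof. by apply: sup_upper_bound. Qed.

Lemma pc_gt0 : 0 < p_c R d.
Proof. exact: lt_le_trans p0_gt0 pc_ge_p0. Qed.

Lemma bernoulli_subcritical (p : R) : 0 <= p -> p < p_c R d -> bernoulli p = 0%E.
Proof.
move=> pp pc; have e0 : 0 < p_c R d - p by rewrite subr_gt0.
have [p' [/andP[p'0 p'1] p'S]] := sup_adherent e0 S_sup; rewrite subKr => pp'.
apply/eqP; rewrite eq_le bernoulli_ge0 andbT -p'S.
by apply: bernoulli_mono => //; exact: ltW.
Qed.

Lemma bernoulli_supercritical (p : R) : p_c R d < p -> p <= 1 -> (0 < bernoulli p)%E.
Proof.
move=> pc p1; rewrite lt0e bernoulli_ge0 andbT; apply/eqP => h.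
have : p <= p_c R d.
  by apply: sup_upper_bound => //; split=> //; rewrite p1 andbT ltW // (lt_trans pc_gt0).
by rewrite leNgt pc.
Qed.

Lemma pc_lt1 : (2 <= d)%N -> p_c R d < 1.
Proof.
move=> d2; apply: (@le_lt_trans _ _ (5 / 6)); last by lra.
apply: sup_le_ub; first by exists p0.
move=> p [/andP[pp p1] h]; rewrite leNgt; apply/negP => hp.
pose i0 := Ordinal (ltnW d2 : (0 < d)%N); pose i1 := Ordinal d2.
have i01 : i0 != i1 by [].
have := bernoulli_percolates i01 (erefl (5 / 6 : R)).
have : (bernoulli (5 / 6 : R) <= bernoulli p)%E by apply: bernoulli_mono => //; lra.
by rewrite h => h1 /lt_le_trans/(_ h1); rewrite ltxx.
Qed.

Lemma small_parameter : exists p : R, [/\ 0 < p, p < 1 & bernoulli p = 0%E].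
Proof. by exists p0; split=> //; case: S_p0. Qed.

End CriticalPoint.

Section Theta.
Variables (R : realType) (d q : nat).
Hypotheses (hd : (1 <= d)%N) (hq : (2 <= q)%N).

Let q1 : (1 <= q)%N. Proof. exact: ltnW. Qed.
Let q1R : 1 <= q%:R :> R. Proof. by rewrite ler1n. Qed.

Local Notation bernoulli p := (bernoulli_bond d p [set w | percolates w]).
Local Notation theta b H := (theta d q b H).

Lemma theta_ge0 (b : \bar R) (H : R) : (0 <= theta b H)%E. Proof. exact: measure_ge0. Qed.

Let field01 (H : R) : 0 <= H -> 0 <= 1 - closed_prob H%:E <= 1.
Proof. by move=> H0; apply: closed_prob01; rewrite lee_fin. Qed.

Lemma theta_mono (b b' H H' : R) : 0 <= b -> b <= b' -> 0 <= H -> H <= H' ->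
  (theta b%:E H <= theta b'%:E H')%E.
Proof.
move=> b0 bb H0 HH; have b0' := le_trans b0 bb; have H0' := le_trans H0 HH.
apply: theta_le => // L n; apply: rc_mean_le; rewrite ?field01 ?lexx ?open_prob_le //.
exact: Xpath_incr.
Qed.

Lemma theta_mono_field (b : \bar R) (H H' : R) : (0 <= b)%E -> 0 <= H -> H <= H' ->
  (theta b H <= theta b H')%E.
Proof.
move=> b0 H0 HH; have H0' := le_trans H0 HH.
apply: theta_le => // L n; apply: rc_mean_le; rewrite ?field01 ?closed_prob01 ?lexx ?open_prob_le //.
exact: Xpath_incr.
Qed.

Lemma le_beta_c (b : R) : 0 <= b -> theta b%:E 0 = 0%E -> (b%:E <= beta_c R d q)%E.
Proof. by move=> b0 h; apply: le_sup_nneg. Qed.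

Lemma theta_supercritical (b : R) : 0 <= b -> (beta_c R d q < b%:E)%E -> (0 < theta b%:E 0)%E.
Proof.
move=> b0 bc; rewrite lt0e theta_ge0 andbT; apply/eqP => h.
by have := le_beta_c b0 h; rewrite leNgt bc.
Qed.

Lemma beta_c_gt0 : (0 < beta_c R d q)%E.
Proof.
have [p [p0 p1 bp]] := @small_parameter R d hd.
have t0 : 0 < temperature p.
  by apply: le_lt_trans (temperature_lt p0 p1); apply: temperature_ge0.
apply: (@lt_le_trans _ _ (temperature p)%:E); first by rewrite lte_fin.
apply: le_beta_c; first exact: ltW.
apply/eqP; rewrite eq_le theta_ge0 andbT -bp.
have p01 : 0 <= p <= 1 by rewrite !ltW.
apply: (@theta_le_bernoulli _ _ _ _ _ _ (1 - closed_prob 0%:E)) => //.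
- by rewrite lee_fin ltW.
- exact: field01.
move=> L n; rewrite temperatureK //; apply: rc_mean_le; rewrite ?field01 ?lexx //.
exact: Xpath_incr.
Qed.

(** At density 1 a closed internal edge makes the weight vanish, and otherwise the straight walk
    along one axis is open. This settles the case of an infinite [beta_c]. *)
Lemma rc_mean_all_open (h s : R) L n : 0 <= h <= 1 -> 1 <= s -> rc_mean 1 h s L (@Xpath R d n) = 1.
Proof.
move=> h01 s1; have p01 : 0 <= (1 : R) <= 1 by rewrite ler01 lexx.
rewrite -[RHS](rc_mean1 p01 h01 s1 L) /rc_mean; congr (_ / _); apply: eq_sumc => w hw.
have [wo|[e ee we]] : (forall e, w (inl e)) \/ exists2 e, inl e \in box true L & ~~ w (inl e).
  have [cl|cl] := pselect (exists2 e, inl e \in box true L & ~~ w (inl e)); [by right|left=> e].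
  apply: contrapT => /negP we; apply: cl; exists e => //.
  by apply: contraT => eb; move: we; rewrite hw.
- congr (_ * _); rewrite /Xpath /ind; case: asboolP => // nex; case: nex.
  rewrite /ex_path_edge /=; apply/ex_pathP.
  pose i0 : 'I_d := Ordinal hd.
  exists (nseq n (i0, true)); split; first by rewrite size_nseq.
    have sE x m : scanl (@dstep d) x (nseq m (i0, true))
        = [seq x + unit_vec i0 *+ k.+1 | k <- iota 0 m].
      elim: m x => [|m IH] x //=; rewrite IH /dstep /=; congr (_ :: _).
      rewrite (iotaDl 1 0) -map_comp; apply: eq_map => k /=.
      by rewrite -addrA -mulrS.
    have -> : 0 :: scanl (@dstep d) 0 (nseq n (i0, true)) =
        [seq unit_vec i0 *+ k | k <- iota 0 n.+1].
      rewrite sE /= mulr0n; congr (_ :: _); rewrite (iotaDl 1 0) -map_comp.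
      by apply: eq_map => k /=; rewrite add0r.
    rewrite map_inj_uniq ?iota_uniq // => k m /matrixP/(_ 0 i0).
    by rewrite !mulmxnE !mxE !eqxx /= => /eqP; rewrite eqr_nat => /eqP.
  by apply/allP => e _; exact: wo.
- suff -> : rc_wgt 1 h s L w = 0 by rewrite !mulr0.
  rewrite /rc_wgt /wgt /cprod (big_rem _ ee) /= /edge_wgt /= (negbTE we) subrr mul0r mulr0.
  by [].
Qed.

Lemma theta_all_open (H : R) : 0 <= H -> (0 < theta +oo%E H)%E.
Proof.
move=> H0; apply: (@lt_le_trans _ _ 1%E) => //.
have -> : 1%E = rc_infinite d q +oo%E H (\bigcap_(n in [set: nat]) setT : set (config (edge d))).
  by rewrite bigcapT ?probability_setT //; apply/seteqP; split.
rewrite /Defs.theta percolates_bigcap.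
apply: (@limit_bigcap_le R d _ _ _ _ _ _ _ _ (fun _ _ => 1)
  (fun L n => rc_mean (1 - closed_prob +oo%E) (1 - closed_prob H%:E) q%:R L (@Xpath R d n))) => //.
- exact: measurable_ex_path_edge.
- exact: ex_path_edge_sub.
- by move=> n; rewrite probability_setT; exact: cvg_cst.
- by move=> n; apply: theta_limit.
- by move=> L n; rewrite closed_prob_oo subr0 rc_mean_all_open // field01.
Qed.

Lemma kertesz_beta_c : kertesz d q (beta_c R d q) = 0%E.
Proof.
suff pos (H : R) : 0 < H -> (0 < theta (beta_c R d q) H)%E.
  apply/eqP; rewrite eq_le; apply/andP; split; last by apply: sup_nneg_ge0 => x [].
  apply: sup_nneg_le => // H [H0 h]; rewrite lee_fin leNgt; apply/negP => /pos.
  by rewrite h ltxx.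
move=> H0; have := beta_c_gt0.
case E1 : (beta_c R d q) => [b| |] //; last by move=> _; apply: theta_all_open; exact: ltW.
rewrite lte_fin => b0.
have hp := open_prob_gt0 b0; have hh := open_prob_gt0 H0.
set pc := 1 - closed_prob b%:E in hp; set h := 1 - closed_prob H%:E in hh.
have /andP[h0 h1] := hh; have /andP[pc0 pc1] := hp.
have q0 : 0 < q%:R :> R by rewrite ltr0n ltnW.
(* The conditional probability of an open ghost edge in the worst case, when opening it destroys a
   cluster. *)
pose a := h / (h + q%:R * (1 - h)).
have den0 : 0 < h + q%:R * (1 - h) by rewrite addr_gt0 // mulr_gt0 // subr_gt0.
have a0 : 0 < a by rewrite /a divr_gt0.
have a1 : a <= 1.
  rewrite /a ler_pdivrMr // mul1r lerDl mulr_ge0 // ?ltW // subr_gt0 //.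
(* [y^-1] is the effective cluster weight produced by the field; it is strictly below [q] because
   [a] is positive. *)
pose y := q%:R^-1 + (1 - q%:R^-1) * a ^+ 2.
have qV1 : q%:R^-1 < 1 :> R by rewrite invf_lt1 // ltr1n.
have qV0 : 0 < q%:R^-1 :> R by rewrite invr_gt0.
have a20 : 0 < a ^+ 2 by rewrite exprn_gt0.
have a21 : a ^+ 2 <= 1 by rewrite expr_le1 // ltW.
have yq : q%:R^-1 < y by rewrite /y ltrDl mulr_gt0 // subr_gt0.
have y1 : y <= 1.
  have : (1 - q%:R^-1) * a ^+ 2 <= 1 - q%:R^-1 by apply: ler_piMr; lra.
  by rewrite /y; lra.
have y0 : 0 < y := lt_trans qV0 yq.
have t1 : 1 <= y^-1 by rewrite invf_ge1.
have tq : y^-1 < q%:R by rewrite invf_plt ?posrE.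
(* The gap between [q] and [y^-1] pays for raising the density above [pc], that is, for an inverse
   temperature above [beta_c] at zero field. *)
have [p' [p'' [/andP[pp' p'1] /andP[p''0 p''p] cmp]]] :=
  @mean_tradeoff R d false h pc q%:R y^-1 hh hp (introT andP (conj t1 tq)).
have b'b : b < temperature p'.
  by rewrite -[b]closed_probK; apply: temperature_lt.
have b'0 : 0 <= temperature p' := ltW (lt_trans b0 b'b).
apply: (@lt_le_trans _ _ (theta (temperature p')%:E 0)).
  by apply: theta_supercritical => //; rewrite E1 lte_fin.
have b0' := ltW b0; have H0' := ltW H0.
apply: theta_le; rewrite ?lee_fin // => L n.
have X0 := @Xpath_ge0 R d n; have Xi := @Xpath_incr R d n; have Xint := @Xpath_internal R d n.
have -> : 1 - closed_prob 0%:E = 0 :> R by rewrite closed_probR mulr0 oppr0 expR0 subrr.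
rewrite temperatureK // (rc_mean_no_field _ h) //.
apply: (le_trans (cmp L _ X0 Xi)).
have hp'' : 0 < p'' < 1 by rewrite p''0 (lt_trans p''p).
apply: (@le_trans _ _ (mean false (edge_wgt pc h) y^-1 L (@Xpath R d n))).
  rewrite -!(rc_mean_no_field _ h) //; apply: rc_mean_le; rewrite ?lexx ?ler01 ?(ltW p''p) //; try by rewrite !ltW //; case/andP: hp''.
apply: (@mean_ghost _ _ _ _ _ a) => //.
- by rewrite (ltW a0).
- by rewrite /a divfK // gt_eqF.
- by rewrite invrK.
Qed.

Lemma beta_P_temperature : (2 <= d)%N -> beta_P R d = (temperature (p_c R d))%:E.
Proof.
move=> d2; have pc0 := @pc_gt0 R d hd; have pc1 := pc_lt1 R hd d2.
have : [set b : \bar R | (0 <= b)%E /\ 1 - closed_prob b = p_c R d] (beta_P R d).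
  apply: getPex; exists (temperature (p_c R d))%:E; split.
    by rewrite lee_fin temperature_ge0 // ltW.
  exact: temperatureK.
case: (beta_P R d) => [b| |] [b0 bE] //; first by rewrite -bE closed_probK.
by move: pc1; rewrite -bE closed_prob_oo subr0 ltxx.
Qed.

Lemma theta_strong_field (b : R) : 0 < b -> p_c R d < 1 - closed_prob b%:E ->
  exists2 H : R, 0 <= H & (0 < theta b%:E H)%E.
Proof.
move=> b0; have hp := open_prob_gt0 b0; set p := 1 - _ in hp *; move=> pcp.
have /andP[p0 p1] := hp; have pc0 := @pc_gt0 R d hd.
(* A supercritical density strictly below [p], which leaves room for an effective weight [t] above
   1. *)
pose p' := (p_c R d + p) / 2.
have p'0 : 0 < p' by rewrite /p'; lra.
have p'p : p' < p by rewrite /p'; lra.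
have pcp' : p_c R d < p' by rewrite /p'; lra.
have p'1 : p' < 1 := lt_trans p'p p1.
(* The ratio of the odds of [p] to those of [p']: the largest weight that [bernoulli_le_mean]
   accepts. *)
pose t := (1 - p') * p / (p' * (1 - p)).
have den0 : 0 < p' * (1 - p) by rewrite mulr_gt0 // subr_gt0.
have t1 : 1 < t by rewrite /t ltr_pdivlMr // mul1r; nra.
have t0 : 0 < t := lt_trans ltr01 t1.
have tV1 : t^-1 < 1 by rewrite invf_lt1.
have tV0 : 0 < t^-1 by rewrite invr_gt0.
(* So that [t^-1 = 1 - 2 * eta <= (1 - eta) ^+ 2], with [1 - eta] the lower bound [a] for an open
   ghost edge. *)
pose eta := (1 - t^-1) / 2.
have eta0 : 0 < eta by rewrite /eta; lra.
have eta1 : eta < 1 by rewrite /eta; lra.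
have q0 : 0 < q%:R :> R by rewrite ltr0n ltnW.
have qV1 : q%:R^-1 < 1 :> R by rewrite invf_lt1 // ltr1n.
have qV0 : 0 < q%:R^-1 :> R by rewrite invr_gt0.
(* [y] is the probability [e^{-2H}] of a closed ghost edge before cluster weighting; then
   [q * y = eta], so the cluster factor cannot spoil the bound [a]. *)
pose y := eta * q%:R^-1.
have y0 : 0 < y by rewrite /y mulr_gt0.
have yeta : y < eta by rewrite /y gtr_pMr.
have h01 : 0 < 1 - y < 1 by apply/andP; split; lra.
pose a := 1 - eta.
have H0 : 0 <= temperature (1 - y) by apply: temperature_ge0; lra.
exists (temperature (1 - y)) => //.
apply: (lt_le_trans (@bernoulli_supercritical R d hd _ pcp' (ltW p'1))).
have z01 : 0 <= (0 : R) <= 1 by rewrite lexx ler01.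
apply: (@bernoulli_le_theta _ _ _ _ _ _ 0) => //; first by rewrite lee_fin ltW.
  by rewrite !ltW.
move=> L n; have X0 := @Xpath_ge0 R d n; have Xi := @Xpath_incr R d n; have Xint := @Xpath_internal R d n.
rewrite temperatureK; last by lra.
rewrite -/p; apply: (@le_trans _ _ (mean false (edge_wgt p (1 - y)) t L (@Xpath R d n))).
  apply: bernoulli_le_mean => //; [by rewrite p'0|exact: ltW|].
  rewrite mulrCA /t divfK // gt_eqF //.
apply: (@mean_ghost _ _ _ _ _ a) => //.
- by apply/andP; rewrite /a; split; lra.
- rewrite subKr; have qy : q%:R * y = eta by rewrite /y mulrCA divff ?mulr1 // gt_eqF.
  rewrite qy /a -subr_ge0.
  have -> : 1 - y - (1 - eta) * (1 - y + eta) = eta ^+ 2 - y * eta by ring.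
  by rewrite expr2 -mulrBl; apply: mulr_ge0; [rewrite subr_ge0|]; exact: ltW.
- exact: ltW.
- have a2 : 1 - 2 * eta <= a ^+ 2.
    by rewrite -subr_ge0 (_ : _ - _ = eta ^+ 2) ?sqr_ge0 // /a; ring.
  have : (1 - q%:R^-1) * (1 - 2 * eta) <= (1 - q%:R^-1) * a ^+ 2.
    by apply: ler_wpM2l => //; lra.
  have : 0 <= q%:R^-1 * (2 * eta) by apply: mulr_ge0; [exact: ltW|lra].
  have -> : t^-1 = 1 - 2 * eta by rewrite /eta; field; rewrite gt_eqF.
  by rewrite mulrBl mul1r mulrBr mulr1; lra.
Qed.

Lemma kertesz_lt_oo (b : R) : 0 < b -> p_c R d < 1 - closed_prob b%:E ->
  (kertesz d q b%:E < +oo)%E.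
Proof.
move=> b0 pcb; have [H0 H00 pos] := theta_strong_field b0 pcb.
apply: (@le_lt_trans _ _ H0%:E); last exact: ltry.
apply: sup_nneg_le => // H [HH h]; rewrite lee_fin leNgt; apply/negP => HH0.
have b0e : (0 <= b%:E)%E by rewrite lee_fin ltW.
have := lt_le_trans pos (theta_mono_field b0e H00 (ltW HH0)).
by rewrite h ltxx.
Qed.

Lemma theta_eq0_above_beta_P : (2 <= d)%N ->
  exists2 b : R, temperature (p_c R d) < b & theta b%:E 1 = 0%E.
Proof.
move=> d2; have pc0 := @pc_gt0 R d hd; have pc1 := pc_lt1 R hd d2.
have hh := @open_prob_gt0 R 1 ltr01; set h := 1 - _ in hh.
have qq : 1 <= (1 : R) < q%:R by rewrite lexx ltr1n.
have pc01 : 0 < p_c R d < 1 by rewrite pc0.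
(* The ghost edges are kept here and the target weight is 1, so the dominating model is Bernoulli
   with density [p''] below [p_c]. *)
have [p' [p'' [/andP[pp' p'1] /andP[p''0 p''p] cmp]]] := @mean_tradeoff R d true h _ _ _ hh pc01 qq.
exists (temperature p'); first exact: temperature_lt.
have p''01 : 0 <= p'' <= 1 by apply/andP; split; lra.
apply/eqP; rewrite eq_le theta_ge0 andbT -(@bernoulli_subcritical R d hd p'' (ltW p''0) p''p).
have b0 : 0 <= temperature p' by apply: temperature_ge0 => //; lra.
apply: (@theta_le_bernoulli _ _ _ _ _ _ h) => //; first by apply/andP; split; case/andP: hh => *; exact: ltW.
move=> L n; rewrite temperatureK // -/h.
by apply: cmp; [exact: Xpath_ge0|exact: Xpath_incr].
Qed.

End Theta.

(** On Z both [beta_P] and [beta_c] are infinite and leave no room for [eps], hence the restriction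
    of the second claim to [2 <= d], which enters through [p_c < 1]. *)
Theorem theorem7 (R : realType) (d q : nat) (hd : (1 <= d)%N) (hq : (2 <= q)%N) :
  kertesz d q (beta_c R d q) = 0%E /\
  ((2 <= d)%N ->
   exists eps : R,
     [/\ (0 < eps)%R,
         (eps%:E < beta_c R d q - beta_P R d)%E &
         (0 < kertesz d q (beta_P R d + eps%:E) < +oo)%E]).
Proof.
split=> [|d2]; first exact: kertesz_beta_c.
have [b bPb hb] := @theta_eq0_above_beta_P R d q hd hq d2.
rewrite beta_P_temperature //; move: bPb; set bP := temperature _ => bPb.
have pc0 := @pc_gt0 R d hd; have pc1 := pc_lt1 R hd d2.
have bP0 : 0 <= bP by apply: temperature_ge0 => //; exact: ltW.
(* Since [theta] vanishes at [b] and field 1, it also vanishes at [b] and field 0, so [b <= beta_c].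
   Halving the gap gives the strict bound on [eps], and [theta] still vanishes at [bP + eps] and
   field 1, so the Kertesz line is at least 1 there. *)
pose eps := (b - bP) / 2.
have eps0 : 0 < eps by rewrite /eps; lra.
have b0 : 0 <= b by lra.
have epsb : bP + eps <= b by rewrite /eps; lra.
exists eps; split=> //.
- have bc : (b%:E <= beta_c R d q)%E.
    apply: le_beta_c => //; apply/eqP; rewrite eq_le theta_ge0 andbT -hb.
    exact: theta_mono.
  apply: (@lt_le_trans _ _ (b%:E - bP%:E)%E); last exact: leeD2r.
  by rewrite -EFinB lte_fin /eps; lra.
- rewrite -EFinD; apply/andP; split.
    apply: (@lt_le_trans _ _ 1%:E) => //; apply: le_sup_nneg; split=> //.
    apply/eqP; rewrite eq_le theta_ge0 andbT -hb; apply: theta_mono => //; lra.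
  apply: kertesz_lt_oo => //; first by lra.
  rewrite -(temperatureK pc1) ltrD2l ltrN2 !closed_probR ltr_expR ltrN2 ltr_pM2l //.
  by rewrite -/bP; lra.
Qed.
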